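(* Let $n_+,n_-\ge 1$ be integers, $n=n_++n_-$, and let $B$ be the indefinite Kirchhoff Laplacian on the star graph $G$ with $n$ unit edges (defined in the context). Then $B$ is similar to a selfadjoint operator in the Hilbert space $L^2(G)$. In particular, its eigenfunctions form a Riesz basis, i.e. there exists a Riesz basis of $L^2(G)$ consisting of eigenfunctions of $B$.
   Context: $G$ is a star graph with $n=n_++n_-$ edges $I_1,\dots,I_n$, each identified with $(0,1)$, all joined at the central vertex $0$; the outer vertices correspond to the endpoint $1$. $L^2(G)=\bigoplus_{j=1}^n L^2((0,1))$ with $\langle f,g\rangle=\sum_{j=1}^n\int_0^1 f_j\overline{g_j}\,dt$. The operator $B$ in $L^2(G)$ has domain $$\mathcal D(B)=\Big\{f=(f_1,\dots,f_n): f_j\in H^2((0,1)),\ f_j(1)=0\ \text{for all } j,\ f_1(0)=\dots=f_n(0),\ \sum_{j=1}^n f_j'(0)=0\Big\}$$ and acts as $(Bf)_j=-f_j''$ for $1\le j\le n_+$ and $(Bf)_j=f_j''$ for $n_++1\le j\le n$. $B$ is similar to a densely defined operator $C$ if $B=VCV^{-1}$ for some bounded linear operator $V$ with a bounded everywhere defined inverse. A Riesz basis of a Hilbert space is a sequence that is an orthonormal basis with respect to some equivalent Hilbert space inner product, up to normalization (equivalently, the image of an orthonormal basis under a bounded, boundedly invertible operator). *)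

(* Defs.v *)
From HB Require Import structures.
From mathcomp Require Import all_boot all_order all_algebra.
From mathcomp Require Import all_classical all_reals all_analysis.
From mathcomp Require Import measurable_realfun.
From mathcomp Require Import generic_quotient ring_quotient sesquilinear.
From mathcomp Require Import complex.
From mathcomp Require Import ring lra.

Set Implicit Arguments.
Unset Strict Implicit.
Unset Printing Implicit Defensive.
Import Order.TTheory GRing.Theory Num.Theory.
Import numFieldNormedType.Exports.

Local Open Scope quotient_scope.
Local Open Scope classical_set_scope.
Local Open Scope ring_scope.
Local Open Scope complex_scope.

Local Notation Re := (@complex.Re _).
Local Notation Im := (@complex.Im _).

Section cL2.
Variable R : realType.
Local Notation mu := (@lebesgue_measure R).

Definition unit_itv : set (measurableTypeR R) := `]0, 1[%classic.
Local Notation I := unit_itv.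
Local Notation C := (R[i]).

Lemma measurable_unit_itv : measurable I.
Proof. exact: measurable_itv. Qed.
Hint Resolve measurable_unit_itv : core.

Definition sqnorm (z : R[i]) : R := Re z ^+ 2 + Im z ^+ 2.

(* On R -> R[i], with no condition outside ]0, 1[. *)
Definition square_integrable (f : R -> R[i]) : Prop :=
  [/\ measurable_fun I (Re \o f), measurable_fun I (Im \o f) &
      mu.-integrable I (fun t => (sqnorm (f t))%:E)].

Definition csqint : {pred R -> R[i]} := fun f => `[< square_integrable f >].

Lemma csqintP f : reflect (square_integrable f) (f \in csqint).
Proof. exact: asboolP. Qed.

Lemma ReD (x y : R[i]) : Re (x + y) = Re x + Re y.
Proof. by case: x; case: y. Qed.
Lemma ImD (x y : R[i]) : Im (x + y) = Im x + Im y.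
Proof. by case: x; case: y. Qed.
Lemma ReM (x y : R[i]) : Re (x * y) = Re x * Re y - Im x * Im y.
Proof. by case: x; case: y. Qed.
Lemma ImM (x y : R[i]) : Im (x * y) = Re x * Im y + Im x * Re y.
Proof. by case: x; case: y. Qed.
Lemma ReJ (x : R[i]) : Re (conjc x) = Re x.
Proof. by case: x. Qed.
Lemma ImJ (x : R[i]) : Im (conjc x) = - Im x.
Proof. by case: x. Qed.

Lemma sqnorm_ge0 z : 0 <= sqnorm z.
Proof. by rewrite addr_ge0 ?sqr_ge0. Qed.

Lemma sqnorm0 z : sqnorm z = 0 -> z = 0.
Proof.
case: z => a b /eqP; rewrite /sqnorm /= paddr_eq0 ?sqr_ge0// !sqrf_eq0.
by move=> /andP[/eqP-> /eqP->].
Qed.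

Lemma csqint_submod_closed : submod_closed csqint.
Proof.
split.
  apply/csqintP; split; [exact: measurable_cst|exact: measurable_cst|].
  rewrite (_ : (fun t => _) = cst 0%E); first exact: integrable0.
  by apply/funext => t; rewrite /sqnorm /= expr0n/= addr0.
move=> a f g /csqintP[mRf mIf if2] /csqintP[mRg mIg ig2].
have mR : measurable_fun I (Re \o (a *: f + g)).
  rewrite (_ : _ \o _ = (fun t => Re a * (Re \o f) t - Im a * (Im \o f) t
                                    + (Re \o g) t)).
    apply: measurable_funD => //; apply: measurable_funB;
      by apply: measurable_funM => //; exact: measurable_cst.
  by apply/funext => t /=; rewrite ReD ReM.
have mI : measurable_fun I (Im \o (a *: f + g)).
  rewrite (_ : _ \o _ = (fun t => Re a * (Im \o f) t + Im a * (Re \o f) t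
                                    + (Im \o g) t)).
    apply: measurable_funD => //; apply: measurable_funD;
      by apply: measurable_funM => //; exact: measurable_cst.
  by apply/funext => t /=; rewrite ImD ImM.
apply/csqintP; split => //.
apply: (@le_integrable _ _ _ mu I measurable_unit_itv _
  (fun t => (2 * sqnorm a)%:E * (sqnorm (f t))%:E
            + 2%:E * (sqnorm (g t))%:E)%E).
- apply/measurable_EFinP; apply: measurable_funD; apply: measurable_funX;
  [exact: mR|exact: mI].
- move=> t _; rewrite -!EFinM -EFinD !abse_EFin lee_fin.
  rewrite (ger0_norm (sqnorm_ge0 _)) ger0_norm; last first.
    by rewrite addr_ge0 ?mulr_ge0 ?sqnorm_ge0.
  rewrite /sqnorm !ReD !ImD !ReM !ImM.
  clear mR mI; move: a (f t) (g t) => [a b] [x y] [u v] /=; rewrite -subr_ge0.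
  rewrite [leRHS](_ : _ = (a * x - b * y - u) ^+ 2 + (a * y + b * x - v) ^+ 2).
    by rewrite addr_ge0 ?sqr_ge0.
  by ring.
- exact: (integrableD measurable_unit_itv
    (integrableZl measurable_unit_itv _ if2)
    (integrableZl measurable_unit_itv _ ig2)).

Qed.
HB.instance Definition _ := GRing.isSubmodClosed.Build R[i] (R -> R[i]) csqint
  csqint_submod_closed.

Definition sqintfun : Type := {f : R -> R[i] | f \in csqint}.
HB.instance Definition _ := [isSub of sqintfun for @proj1_sig _ _].
HB.instance Definition _ := [Choice of sqintfun by <:].
HB.instance Definition _ := [SubChoice_isSubLmodule of sqintfun by <:].

Definition ae_null : {pred sqintfun} :=
  fun f => `[< \forall t \ae mu, I t -> val f t = 0 >].

Lemma ae_nullP f :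
  reflect (\forall t \ae mu, I t -> val f t = 0) (f \in ae_null).
Proof. exact: asboolP. Qed.

Lemma ae_null_submod_closed : submod_closed ae_null.
Proof.
split; first by apply/ae_nullP; apply: aeW => t _.
move=> a f g /ae_nullP f0 /ae_nullP g0; apply/ae_nullP.
apply: filterS2 f0 g0 => t ft gt It.
by rewrite -[LHS]/(a *: val f t + val g t) ft// gt// scaler0 addr0.
Qed.
HB.instance Definition _ := GRing.isSubmodClosed.Build R[i] sqintfun ae_null
  ae_null_submod_closed.

(* L^2(]0, 1[; C): square integrable functions modulo equality a.e. on ]0, 1[ *)
Definition L2 : Type := Quotient.quot ae_null.
HB.instance Definition _ := Choice.on L2.
HB.instance Definition _ := EqQuotient.on L2.
HB.instance Definition _ := GRing.Zmodule.on L2.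

Definition L2scale (a : C) : L2 -> L2 := lift_op1 L2 ( *:%R a).

Lemma pi_L2scale a : {morph \pi_L2 : f / a *: f >-> L2scale a f}.
Proof.
move=> f; unlock L2scale; apply/eqP; rewrite piE Quotient.equivE.
rewrite -scalerBr rpredZ//.
by rewrite Quotient.idealrBE reprK.
Qed.

Canonical pi_L2scale_morph a := PiMorph1 (pi_L2scale a).

Lemma L2scaleA a b (f : L2) : L2scale a (L2scale b f) = L2scale (a * b) f.
Proof. by rewrite -[f]reprK !piE scalerA. Qed.

Lemma L2scale1 : left_id 1 L2scale.
Proof. by move=> f; rewrite -[f]reprK !piE scale1r. Qed.

Lemma L2scaleDr : right_distributive L2scale +%R.
Proof. by move=> a f g; rewrite -[f]reprK -[g]reprK !piE scalerDr. Qed.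

Lemma L2scaleDl (f : L2) : {morph L2scale^~ f : a b / a + b}.
Proof. by move=> a b; rewrite -[f]reprK !piE scalerDl. Qed.

HB.instance Definition _ := GRing.Zmodule_isLmodule.Build C L2
  L2scaleA L2scale1 L2scaleDr L2scaleDl.

Definition L2fun (u : L2) : R -> C := val (repr u).

Definition L2class (f : sqintfun) : L2 := \pi f.

Lemma L2fun_sqint (u : L2) : square_integrable (L2fun u).
Proof. exact/csqintP/(valP (repr u)). Qed.

Lemma L2funK (f : sqintfun) : \forall t \ae mu, I t -> L2fun (L2class f) t = val f t.
Proof.
have /eqP : \pi_L2 (repr (L2class f)) = \pi_L2 f by rewrite reprK.
rewrite piE Quotient.equivE => /ae_nullP; apply: filterS => t /[apply] /eqP.
by rewrite -[val _ t]/(L2fun (L2class f) t - val f t) subr_eq0 => /eqP.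
Qed.

Lemma L2P (u v : L2) : (\forall t \ae mu, I t -> L2fun u t = L2fun v t) -> u = v.
Proof.
move=> uv; rewrite -[u]reprK -[v]reprK; apply/eqP; rewrite piE Quotient.equivE.
apply/ae_nullP; apply: filterS uv => t /[apply] uv.
by rewrite -[LHS]/(L2fun u t - L2fun v t) uv subrr.
Qed.

Lemma L2funP a (u v : L2) :
  \forall t \ae mu, I t -> L2fun (a *: u + v) t = a * L2fun u t + L2fun v t.
Proof.
have -> : a *: u + v = L2class (a *: repr u + repr v).
  have : L2class (a *: repr u + repr v) = L2scale a (\pi_L2 (repr u)) + \pi_L2 (repr v).
    by rewrite !piE.
  by rewrite !reprK => ->.
exact: L2funK.
Qed.

Definition Cintegral (f : R -> C) : C :=
  (\int[mu]_(t in I) Re (f t))%R +i* (\int[mu]_(t in I) Im (f t))%R.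

Definition Cintegrable (f : R -> C) : Prop :=
  mu.-integrable I (fun t => (Re (f t))%:E) /\
  mu.-integrable I (fun t => (Im (f t))%:E).

Lemma normM2_le (x y u v : R) :
  `|x * u + y * v| <= (x ^+ 2 + y ^+ 2) + (u ^+ 2 + v ^+ 2).
Proof.
have := (sqr_ge0 (x + u), sqr_ge0 (x - u), sqr_ge0 (y + v), sqr_ge0 (y - v)).
have := (sqr_ge0 x, sqr_ge0 y, sqr_ge0 u, sqr_ge0 v).
move=> [[[? ?] ?] ?] [[[? ?] ?] ?].
by rewrite ler_norml; apply/andP; split; nra.
Qed.

Lemma sqint_CintegrableM (f g : R -> C) :
  square_integrable f -> square_integrable g ->
  Cintegrable (fun t => f t * conjc (g t)).
Proof.
move=> [mRf mIf if2] [mRg mIg ig2].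
have ifg := integrableD measurable_unit_itv if2 ig2.
split; apply: (le_integrable measurable_unit_itv _ _ ifg).
- apply/measurable_EFinP.
  rewrite (_ : (fun t => Re _) = (fun t => (Re \o f) t * (Re \o g) t
                                     + (Im \o f) t * (Im \o g) t)).
    by apply: measurable_funD; exact: measurable_funM.
  by apply/funext => t; rewrite ReM ReJ ImJ mulrN opprK.
- move=> t _; rewrite -EFinD !abse_EFin lee_fin.
  rewrite (ger0_norm (addr_ge0 (sqnorm_ge0 _) (sqnorm_ge0 _))) ReM ReJ ImJ.
  by rewrite mulrN opprK; exact: normM2_le.
- apply/measurable_EFinP.
  rewrite (_ : (fun t => Im _) = (fun t => (Im \o f) t * (Re \o g) t
                                     - (Re \o f) t * (Im \o g) t)).
    by apply: measurable_funB; exact: measurable_funM.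
  by apply/funext => t; rewrite ImM ReJ ImJ mulrN addrC.
- move=> t _; rewrite -EFinD !abse_EFin lee_fin.
  rewrite (ger0_norm (addr_ge0 (sqnorm_ge0 _) (sqnorm_ge0 _))) ImM ReJ ImJ.
  rewrite mulrN addrC -mulrN [sqnorm (g t)]addrC.
  by have := normM2_le (Im (f t)) (Re (f t)) (Re (g t)) (- Im (g t));
    rewrite sqrrN [Im (f t) ^+ 2 + _]addrC [Re (g t) ^+ 2 + _]addrC.
Qed.

Lemma ae_eq_Cintegral f g : Cintegrable f -> Cintegrable g ->
  (\forall t \ae mu, I t -> f t = g t) -> Cintegral f = Cintegral g.
Proof.
move=> [/measurable_int iRf /measurable_int iIf].
move=> [/measurable_int iRg /measurable_int iIg] fg.
rewrite /Cintegral /Rintegral; congr (fine _ +i* fine _);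
  apply: ae_eq_integral => //;
  by apply: filterS fg => t /[apply] ->.
Qed.

Lemma CintegralP a f g : Cintegrable f -> Cintegrable g ->
  Cintegral (fun t => a * f t + g t) = a * Cintegral f + Cintegral g.
Proof.
move=> [iRf iIf] [iRg iIg].
have mI := measurable_unit_itv.
have Z k h : mu.-integrable I (fun t => (h t)%:E) ->
    mu.-integrable I (fun t => (k * h t)%:E).
  by move=> ih; exact: (integrableZl mI k ih).
have D h k : mu.-integrable I (fun t => (h t)%:E) ->
    mu.-integrable I (fun t => (k t)%:E) ->
    mu.-integrable I (fun t => (h t + k t)%:E).
  by move=> ih ik; exact: (integrableD mI ih ik).
have B h k : mu.-integrable I (fun t => (h t)%:E) ->
    mu.-integrable I (fun t => (k t)%:E) ->
    mu.-integrable I (fun t => (h t - k t)%:E).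
  by move=> ih ik; exact: (integrableB mI ih ik).
apply/eqP; rewrite eq_complex ReD ImD ReM ImM /=; apply/andP; split; apply/eqP.
  under eq_Rintegral do rewrite ReD ReM.
  rewrite (RintegralD mI (B _ _ (Z (Re a) _ iRf) (Z (Im a) _ iIf)) iRg).
  by rewrite (RintegralB mI (Z (Re a) _ iRf) (Z (Im a) _ iIf)) !RintegralZl.
under eq_Rintegral do rewrite ImD ImM.
rewrite (RintegralD mI (D _ _ (Z (Re a) _ iIf) (Z (Im a) _ iRf)) iIg).
by rewrite (RintegralD mI (Z (Re a) _ iIf) (Z (Im a) _ iRf)) !RintegralZl.
Qed.

(* Linear in the first argument, conjugate-linear in the second one. *)
Definition L2dot (u v : L2) : C :=
  Cintegral (fun t => L2fun u t * conjc (L2fun v t)).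

Lemma L2dot_herm (u v : L2) : L2dot u v = (-1) ^+ false * conjc (L2dot v u).
Proof.
rewrite expr0 mul1r; apply/eqP; rewrite eq_complex ReJ ImJ.
have [_ /= i2] := sqint_CintegrableM (L2fun_sqint v) (L2fun_sqint u).
apply/andP; split; apply/eqP.
  by apply: eq_Rintegral => t _; rewrite !ReM !ReJ !ImJ; ring.
rewrite -mulN1r -RintegralZl//.
by apply: eq_Rintegral => t _; rewrite !ImM !ReJ !ImJ; ring.
Qed.

Lemma L2dotPl (v : L2) : GRing.linear_for *%R (L2dot^~ v).
Proof.
move=> a u w; have sv := L2fun_sqint v.
rewrite /L2dot -CintegralP; [|exact: sqint_CintegrableM (L2fun_sqint _) sv..].
apply: ae_eq_Cintegral; first exact: sqint_CintegrableM (L2fun_sqint _) sv.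
  have sq : square_integrable (fun t => a * L2fun u t + L2fun w t).
    exact/csqintP/(rpredD (rpredZ a (valP (repr u))) (valP (repr w))).
  have := sqint_CintegrableM sq sv; congr Cintegrable.
  by apply/funext => t; rewrite mulrDl mulrA.
by apply: filterS (L2funP a u w) => t /[apply] ->; rewrite mulrDl mulrA.
Qed.

Lemma L2dotPr (u : L2) : GRing.linear_for (@conjc R \; *%R) (L2dot u).
Proof.
move=> a v w.
rewrite ![L2dot u _]L2dot_herm !expr0 !mul1r L2dotPl.
by rewrite rmorphD rmorphM.
Qed.

Lemma L2dot_bilinear : bilinear_for
  (GRing.Scale.Law.clone _ _ *%R _) (GRing.Scale.Law.clone _ _ (@conjc R \; *%R) _)
  L2dot.
Proof. by split=> [v|u]; [exact: L2dotPl|exact: L2dotPr]. Qed.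

Lemma L2dot_gt0 (u : L2) : u != 0 -> 0 < L2dot u u.
Proof.
move=> u0; have [_ _ iu] := L2fun_sqint u.
have ReE t : Re (L2fun u t * conjc (L2fun u t)) = sqnorm (L2fun u t).
  by rewrite ReM ReJ ImJ /sqnorm; ring.
have ImE t : Im (L2fun u t * conjc (L2fun u t)) = 0.
  by rewrite ImM ReJ ImJ; ring.
have -> : L2dot u u = (\int[mu]_(t in I) sqnorm (L2fun u t))%R%:C.
  rewrite /L2dot /Cintegral; congr (_ +i* _).
    by apply: eq_Rintegral => t _.
  rewrite (@eq_Rintegral _ _ _ _ _ (cst 0)); last by move=> t _.
  by rewrite Rintegral_cst// mul0r.
rewrite ltcR lt_neqAle Rintegral_ge0 ?andbT; last by move=> t _; exact: sqnorm_ge0.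
apply: contraNneq u0 => i0; apply/eqP/L2P.
have e0 : (\int[mu]_(t in I) `|(sqnorm (L2fun u t))%:E| = 0)%E.
  under eq_integral do rewrite abse_EFin ger0_norm ?sqnorm_ge0//.
  rewrite -[LHS](fineK (integrable_fin_num measurable_unit_itv iu)).
  by congr EFin; rewrite [RHS]i0.
have := (ae_eq_integral_abs mu measurable_unit_itv (measurable_int mu iu)).1 e0.
have := L2funP (-1) 0 0.
apply: filterS2 => t z0 u0 It.
have /sqnorm0 -> : sqnorm (L2fun u t) = 0 by case: (u0 It).
by have := z0 It; rewrite scaler0 addr0 mulN1r addNr.
Qed.

HB.instance Definition _ := bilinear_isBilinear.Build C L2 L2 C
  (GRing.Scale.Law.clone _ _ *%R _) (GRing.Scale.Law.clone _ _ (@conjc R \; *%R) _)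
  L2dot L2dot_bilinear.
HB.instance Definition _ :=
  isHermitianSesquilinear.Build C L2 false (@conjc R) L2dot L2dot_herm.
HB.instance Definition _ := isDotProduct.Build C L2 L2dot L2dot_gt0.
End cL2.

Section star_graph.
Variables (R : realType) (n : nat).

Definition L2G : Type := {ffun 'I_n -> L2 R}.
HB.instance Definition _ := GRing.Lmodule.on L2G.

Definition L2Gdot (f g : L2G) : R[i] := \sum_(j < n) L2dot (f j) (g j).

Lemma L2Gdot_bilinear : bilinear_for
  (GRing.Scale.Law.clone _ _ *%R _) (GRing.Scale.Law.clone _ _ (@conjc R \; *%R) _)
  L2Gdot.
Proof.
split=> [h|h] a f g; rewrite /= /L2Gdot mulr_sumr -big_split;
  apply: eq_bigr => j _; rewrite !ffunE.
- exact: L2dotPl.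
- exact: L2dotPr.
Qed.

Lemma L2Gdot_herm (f g : L2G) : L2Gdot f g = (-1) ^+ false * conjc (L2Gdot g f).
Proof.
rewrite /L2Gdot rmorph_sum mulr_sumr.
by apply: eq_bigr => j _; exact: L2dot_herm.
Qed.

Lemma L2Gdot_gt0 (f : L2G) : f != 0 -> 0 < L2Gdot f f.
Proof.
have ge0 (u : L2 R) : 0 <= L2dot u u.
  have [->|/L2dot_gt0/ltW//] := eqVneq u 0.
  by rewrite linear0l.
move=> f0; have [j fj0] : exists j, f j != 0.
  apply/existsP; apply: contraNT f0; rewrite negb_exists => /forallP f0.
  by apply/eqP/ffunP => j; rewrite ffunE; apply/eqP; rewrite -[_ == _]negbK.
rewrite /L2Gdot (bigD1 j)//= ltr_pwDl ?L2dot_gt0//.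
exact: sumr_ge0.
Qed.

HB.instance Definition _ := bilinear_isBilinear.Build R[i] L2G L2G R[i]
  (GRing.Scale.Law.clone _ _ *%R _) (GRing.Scale.Law.clone _ _ (@conjc R \; *%R) _)
  L2Gdot L2Gdot_bilinear.
HB.instance Definition _ :=
  isHermitianSesquilinear.Build R[i] L2G false (@conjc R) L2Gdot L2Gdot_herm.
HB.instance Definition _ := isDotProduct.Build R[i] L2G L2Gdot L2Gdot_gt0.
End star_graph.

Section Hilbert.
Variables (R : realType) (U : lmodType R[i]) (dot : {dot U for @conjc R}).

Definition dnorm (u : U) : R := Num.sqrt (Re (dot u u)).

Definition bounded_op (V : {linear U -> U}) : Prop :=
  exists M : R, forall u, dnorm (V u) <= M * dnorm u.

Definition bounded_inverses (V W : {linear U -> U}) : Prop :=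
  [/\ bounded_op V, bounded_op W, cancel V W & cancel W V].

(* Unbounded operators are given by their graphs: T (u, v) says that u is in the
   domain of T and is mapped to v. *)
Definition op_domain (T : set (U * U)) : set U := [set u | exists v, T (u, v)].

Definition linear_operator (T : set (U * U)) : Prop :=
  [/\ T (0, 0),
      forall (a : R[i]) u v u' v',
        T (u, u') -> T (v, v') -> T (a *: u + v, a *: u' + v') &
      forall u v w, T (u, v) -> T (u, w) -> v = w].

Definition densely_defined (T : set (U * U)) : Prop :=
  forall (u : U) (e : R), 0 < e -> exists2 v, op_domain T v & dnorm (u - v) < e.

Definition adjoint_op (T : set (U * U)) : set (U * U) :=
  [set vw | forall u u', T (u, u') -> dot u' vw.1 = dot u vw.2].

Definition selfadjoint (T : set (U * U)) : Prop :=
  [/\ linear_operator T, densely_defined T & adjoint_op T = T].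

(* B = V C V^-1, with W = V^-1 *)
Definition similar_op (B C : set (U * U)) : Prop :=
  exists V W : {linear U -> U}, bounded_inverses V W /\
    B = [set uv | exists2 w, C (W uv.1, w) & uv.2 = V w].

Definition orthonormal_basis (b : nat -> U) : Prop :=
  (forall i j, dot (b i) (b j) = (i == j)%:R) /\
  (forall u, dnorm (u - \sum_(k < m) dot u (b k) *: b k) @[m --> \oo] --> (0 : R)).

Definition riesz_basis (e : nat -> U) : Prop :=
  exists (b : nat -> U) (V W : {linear U -> U}),
    [/\ orthonormal_basis b, bounded_inverses V W & forall k, e k = V (b k)].

Definition eigenvector (T : set (U * U)) (u : U) : Prop :=
  u != 0 /\ exists lambda : R[i], T (u, lambda *: u).

End Hilbert.

Section Kirchhoff.
Variable R : realType.
Local Notation mu := (@lebesgue_measure R).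
Local Notation I := (@unit_itv R).

(* C^1 functions with compact support in ]0, 1[; testing against them yields the
   same weak derivatives as testing against C^oo functions. *)
Definition test_function (phi : R -> R) : Prop :=
  [/\ forall x, derivable phi x 1, continuous (derive1 phi) &
      exists a b : R, [/\ 0 < a, b < 1 & forall x, x \notin `[a, b] -> phi x = 0]].

Definition weak_derivative (u v : L2 R) : Prop :=
  forall phi, test_function phi ->
    Cintegral (fun t => L2fun u t * (derive1 phi t)%:C) =
    - Cintegral (fun t => L2fun v t * (phi t)%:C).

(* z is the value at x of a representative of u that is continuous on [0, 1];
   continuity is stated componentwise as R[i] carries no topology here. *)
Definition boundary_value (u : L2 R) (x : R) (z : R[i]) : Prop :=
  exists c : R -> R[i],
    [/\ {within `[0, 1], continuous (fun t => Re (c t))},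
        {within `[0, 1], continuous (fun t => Im (c t))},
        \forall t \ae mu, I t -> L2fun u t = c t & c x = z].

Section operator.
Variables np nm : nat.
Local Notation n := (np + nm)%N.
Local Notation L2G := (L2G R n).

(* f1 and f2 are the edgewise first and second weak derivatives of f: since they
   are in L2, the first clause says that every f j is in H^2(]0, 1[). *)
Definition kirchhoff_domain (f f1 f2 : L2G) : Prop :=
  [/\ forall j, weak_derivative (f j) (f1 j) /\ weak_derivative (f1 j) (f2 j),
      forall j, boundary_value (f j) 1 0,
      exists z : R[i], forall j, boundary_value (f j) 0 z &
      exists2 d : 'I_n -> R[i],
        (forall j, boundary_value (f1 j) 0 (d j)) & \sum_j d j = 0].

Definition indefinite_kirchhoff : set (L2G * L2G) :=
  [set fg : L2G * L2G | exists f1 f2 : L2G, kirchhoff_domain fg.1 f1 f2 /\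
     forall j : 'I_n, fg.2 j = if (j < np)%N then - f2 j else f2 j].

End operator.
End Kirchhoff.

Arguments indefinite_kirchhoff : clear implicits.

(* Main.v *)
Require Import Defs.
From HB Require Import structures.
From mathcomp Require Import all_boot all_order all_algebra.
From mathcomp Require Import all_classical all_reals all_analysis.
From mathcomp Require Import complex.
From mathcomp Require Import measurable_realfun sesquilinear ring lra.

Set Implicit Arguments.
Unset Strict Implicit.
Unset Printing Implicit Defensive.
Import Order.TTheory GRing.Theory Num.Theory.
Import numFieldNormedType.Exports.
Import Defs.

Local Open Scope classical_set_scope.
Local Open Scope ring_scope.
Local Open Scope complex_scope.
Local Notation Re := (@complex.Re _).
Local Notation Im := (@complex.Im _).

(**
Let A be the definite Kirchhoff Laplacian, K = A^-1 and J multiplication by 1 on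
the first [np] edges and by -1 on the others, so that B = (K J)^-1. The operator
J K is injective, symmetric and compact for the energy form <Kx, y>; let p_k be
its orthonormal eigenvectors, t_k its eigenvalues, and e_k := |t_k|^(-1/2) K p_k.
These are eigenvectors of B, biorthogonal up to signs to the J e_k. Since J is
unitary, the e_k form a Riesz basis as soon as they satisfy a Bessel inequality.

The Bessel inequality comes from Reid's inequality, for which a Hermitian form w
is needed that is coercive for the L^2 norm and satisfies
|w (K x, K y)| <= C |x| |J K y| in energy norms. With w = <.,.> the bound fails
only because of the common value at the central vertex. The remedy is
w (f, g) = <f, g> + gamma (<D f_-, g_+> + <f_+, D g_->), where f_+ and f_- are
the sums of f over the edges of each sign and (D u)(x) = (1 - s x) u (s x): the
factor gamma makes the vertex terms cancel, and s large keeps w coercive.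
*)

(** * Hermitian forms *)

(** Let V be the Volterra operator and V' its adjoint. One has K x = V' h, where h is the orthogonal
    projection of V x onto the functions with the same mean on all edges, and |h| is the energy norm
    of x. Moving V' across <K x, J q> leaves <h, J V q>, and V q differs from its own projection by
    constants e_j on the edges, with sum 0. If m is the common mean of h, these constants contribute
    2 m times the conjugate sum of the e_j over the positive edges. The e_j are derivatives of K q
    at the vertex, which the energy does not control: this is the term to cancel. The dilated
    pairings produce the same product, because D u and its adjoint (1 - x) u (x / s) / s take the
    values u (0) and u (0) / s at the vertex. The weight 1 - s x makes this adjoint vanish at the
    outer vertices, as integration by parts requires. The value of D u at the vertex does not depend
    on s, whereas the norm of D is at most s^(-1/2): hence cancellation and coercivity are
    compatible. The energy norm is weaker than the L^2 norm and not complete. The spectral theorem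
    therefore works with cluster points inside L^2, which the smoothing by K supplies. *)

Section complex_modulus.
Variable R : realType.
Implicit Types z w : R[i].

Definition cmod z : R := Num.sqrt (sqnorm z).

Lemma cmod_ge0 z : 0 <= cmod z. Proof. exact: sqrtr_ge0. Qed.

Lemma cmod_sqr z : cmod z ^+ 2 = sqnorm z.
Proof. by rewrite sqr_sqrtr ?sqnorm_ge0. Qed.

Lemma sqnormM z w : sqnorm (z * w) = sqnorm z * sqnorm w.
Proof. by rewrite /sqnorm ReM ImM; ring. Qed.

Lemma sqnormJ z : sqnorm (conjc z) = sqnorm z.
Proof. by rewrite /sqnorm ReJ ImJ sqrrN. Qed.

Lemma sqnormN z : sqnorm (- z) = sqnorm z.
Proof. by case: z => x y; rewrite /sqnorm /= !sqrrN. Qed.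

Lemma sqnorm_real (x : R) : sqnorm x%:C = x ^+ 2.
Proof. by rewrite /sqnorm /= expr0n addr0. Qed.

Lemma mulJ_sqnorm z : z * conjc z = (sqnorm z)%:C.
Proof.
case: z => x y; apply/eqP; rewrite eq_complex ReM ImM /sqnorm /=.
by apply/andP; split; apply/eqP; ring.
Qed.

Lemma mulrN_Re (z : R[i]) : Re (- z) = - Re z.
Proof. by case: z. Qed.

Lemma mulrN_Im (z : R[i]) : Im (- z) = - Im z.
Proof. by case: z. Qed.

Lemma ReZ (x : R) z : Re (x%:C * z) = x * Re z.
Proof. by rewrite ReM /= mul0r subr0. Qed.

Lemma ImZ (x : R) z : Im (x%:C * z) = x * Im z.
Proof. by rewrite ImM /= mul0r addr0. Qed.

Lemma Re_sum (J : Type) (r : seq J) (P : pred J) (F : J -> R[i]) :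
  Re (\sum_(j <- r | P j) F j) = \sum_(j <- r | P j) Re (F j).
Proof. by apply: (big_morph _ (@ReD R)). Qed.

Lemma real_of_selfconj z : conjc z = z -> z = (Re z)%:C.
Proof.
case: z => x y [] /eqP; rewrite eq_sym -subr_eq0 opprK -mulr2n mulrn_eq0 /=.
by move=> /eqP ->.
Qed.

Lemma conjc_Mreal z (x : R) : conjc (z * x%:C) = conjc z * x%:C.
Proof.
by case: z => u v; apply/eqP; rewrite eq_complex /=; apply/andP; split; apply/eqP; ring.
Qed.

Lemma cmodM z w : cmod (z * w) = cmod z * cmod w.
Proof. by rewrite /cmod sqnormM sqrtrM ?sqnorm_ge0. Qed.

Lemma Re_le_cmod z : `|Re z| <= cmod z.
Proof.
by rewrite -sqrtr_sqr ler_wsqrtr// /sqnorm lerDl sqr_ge0.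
Qed.

Lemma Im_le_cmod z : `|Im z| <= cmod z.
Proof.
by rewrite -sqrtr_sqr ler_wsqrtr// /sqnorm lerDr sqr_ge0.
Qed.

Lemma cmod0 : cmod 0 = 0.
Proof. by rewrite /cmod /sqnorm /= expr0n /= addr0 sqrtr0. Qed.

Lemma cmod_real (x : R) : cmod x%:C = `|x|.
Proof. by rewrite /cmod sqnorm_real sqrtr_sqr. Qed.

Lemma cmodN z : cmod (- z) = cmod z.
Proof. by rewrite /cmod sqnormN. Qed.

Lemma cmodJ z : cmod (conjc z) = cmod z.
Proof. by rewrite /cmod sqnormJ. Qed.

Lemma cmodD z w : cmod (z + w) <= cmod z + cmod w.
Proof.
rewrite -(ler_pXn2r (n := 2)) ?nnegrE ?addr_ge0 ?cmod_ge0// sqrrD !cmod_sqr.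
have := Re_le_cmod (z * conjc w); rewrite cmodM cmodJ ler_norml => /andP[_].
rewrite /sqnorm !ReM !ReD !ImD ReJ ImJ -mulr_natl.
by move: (_ * cmod w) => y; nra.
Qed.

Lemma cmod_eq0 z : cmod z = 0 -> z = 0.
Proof. by move=> z0; apply: sqnorm0; rewrite -cmod_sqr z0 expr0n. Qed.

End complex_modulus.

Section hermitian_form.
Variables (R : realType) (U : lmodType R[i]).
Implicit Types (a : U -> U -> R[i]) (x y z : U).

Definition hermitian_form a : Prop :=
  [/\ forall (c : R[i]) x y z, a (c *: x + y) z = c * a x z + a y z,
      forall x y, a y x = conjc (a x y) &
      forall x, 0 <= Re (a x x)].

Definition sqf a x : R := Re (a x x).
Definition nrm a x : R := Num.sqrt (sqf a x).

Definition definite a : Prop := forall x, sqf a x = 0 -> x = 0.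

Variable a : U -> U -> R[i].
Hypothesis ha : hermitian_form a.

Lemma formDl x y z : a (x + y) z = a x z + a y z.
Proof. by have [/(_ 1 x y z) + _ _] := ha; rewrite scale1r mul1r. Qed.

Lemma form0l z : a 0 z = 0.
Proof. by apply: (@addrI _ (a 0 z)); rewrite -formDl !addr0. Qed.

Lemma formZl (c : R[i]) x z : a (c *: x) z = c * a x z.
Proof. by have [/(_ c x 0 z) + _ _] := ha; rewrite form0l !addr0. Qed.

Lemma formNl x z : a (- x) z = - a x z.
Proof. by rewrite -scaleN1r formZl mulN1r. Qed.

Lemma formBl x y z : a (x - y) z = a x z - a y z.
Proof. by rewrite formDl formNl. Qed.

Lemma formC x y : a y x = conjc (a x y). Proof. by case: ha. Qed.

Lemma formDr x y z : a z (x + y) = a z x + a z y.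
Proof. by rewrite !(formC _ z) formDl rmorphD. Qed.

Lemma form0r z : a z 0 = 0.
Proof. by rewrite formC form0l rmorph0. Qed.

Lemma formZr (c : R[i]) x z : a z (c *: x) = conjc c * a z x.
Proof. by rewrite !(formC _ z) formZl rmorphM. Qed.

Lemma formNr x z : a z (- x) = - a z x.
Proof. by rewrite !(formC _ z) formNl rmorphN. Qed.

Lemma formBr x y z : a z (x - y) = a z x - a z y.
Proof. by rewrite formDr formNr. Qed.

Lemma form_suml (J : Type) (r : seq J) (P : pred J) (F : J -> U) z :
  a (\sum_(j <- r | P j) F j) z = \sum_(j <- r | P j) a (F j) z.
Proof. by apply: (big_morph (a^~ z)) => [x y|]; [exact: formDl|exact: form0l]. Qed.

Lemma form_sumr (J : Type) (r : seq J) (P : pred J) (F : J -> U) z :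
  a z (\sum_(j <- r | P j) F j) = \sum_(j <- r | P j) a z (F j).
Proof. by apply: (big_morph (a z)) => [x y|]; [exact: formDr|exact: form0r]. Qed.

Lemma sqf_ge0 x : 0 <= sqf a x. Proof. by case: ha => _ _ /(_ x). Qed.

Lemma form_sqf x : a x x = (sqf a x)%:C.
Proof. by apply: real_of_selfconj; rewrite -formC. Qed.

Lemma sqf0 : sqf a 0 = 0. Proof. by rewrite /sqf form0l. Qed.

Lemma sqfZ (c : R[i]) x : sqf a (c *: x) = sqnorm c * sqf a x.
Proof.
by rewrite {1}/sqf formZl formZr mulrA mulJ_sqnorm ReZ.
Qed.

Lemma sqfN x : sqf a (- x) = sqf a x.
Proof. by rewrite /sqf formNl formNr opprK. Qed.

Lemma sqfD x y : sqf a (x + y) = sqf a x + sqf a y + 2 * Re (a x y).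
Proof.
by rewrite /sqf formDl !formDr !ReD (formC x y) ReJ; ring.
Qed.

Lemma sqfB x y : sqf a (x - y) = sqf a x + sqf a y - 2 * Re (a x y).
Proof. by rewrite sqfD sqfN formNr mulrN_Re; ring. Qed.

(** The form is only semidefinite, so [sqf a y] may vanish: then [key] is affine in t and a large t
    forces [a x y] to vanish. Otherwise t = 1 / [sqf a y] is optimal. *)
Lemma cauchy_schwarz_sqr x y : sqnorm (a x y) <= sqf a x * sqf a y.
Proof.
set B := sqnorm _; set A := sqf a x; set C := sqf a y.
have B0 : 0 <= B by exact: sqnorm_ge0.
have A0 : 0 <= A by exact: sqf_ge0.
have C0 : 0 <= C by exact: sqf_ge0.
have key t : 0 <= A - 2 * t * B + t ^+ 2 * B * C.
  have := sqf_ge0 (x - (t%:C * a x y) *: y).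
  rewrite sqfB sqfZ sqnormM sqnorm_real formZr -/B -/A -/C.
  have -> : Re (conjc (t%:C * a x y) * a x y) = t * B.
    by rewrite /B /sqnorm; case: (a x y) => u v /=; ring.
  by congr (0 <= _); ring.
have [C_gt0|] := ltP 0 C; last first.
  move=> Cle; have C00 : C = 0 by apply/eqP; rewrite eq_le Cle C0.
  rewrite C00 mulr0 leNgt; apply/negP => Bgt.
  have := key ((A + 1) / B); rewrite C00 mulr0 addr0.
  rewrite -mulrA [_ / B * B]divfK ?gt_eqF//.
  by lra.
have := key C^-1.
have -> : A - 2 * C^-1 * B + C^-1 ^+ 2 * B * C = A - B / C.
  by field; rewrite gt_eqF.
by rewrite subr_ge0 ler_pdivrMr.
Qed.

Lemma nrm_ge0 x : 0 <= nrm a x. Proof. exact: sqrtr_ge0. Qed.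

Lemma nrm_sqr x : nrm a x ^+ 2 = sqf a x.
Proof. by rewrite sqr_sqrtr ?sqf_ge0. Qed.

Lemma cauchy_schwarz x y : cmod (a x y) <= nrm a x * nrm a y.
Proof.
rewrite /nrm -sqrtrM ?sqf_ge0// ler_wsqrtr//; exact: cauchy_schwarz_sqr.
Qed.

Lemma nrm0 : nrm a 0 = 0. Proof. by rewrite /nrm sqf0 sqrtr0. Qed.

Lemma nrmZ (c : R[i]) x : nrm a (c *: x) = cmod c * nrm a x.
Proof. by rewrite /nrm sqfZ sqrtrM ?sqnorm_ge0. Qed.

Lemma nrmN x : nrm a (- x) = nrm a x. Proof. by rewrite /nrm sqfN. Qed.

Lemma nrmB x y : nrm a (x - y) = nrm a (y - x).
Proof. by rewrite -nrmN opprB. Qed.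

Lemma nrm_triangle x y : nrm a (x + y) <= nrm a x + nrm a y.
Proof.
have D0 : 0 <= nrm a x + nrm a y by rewrite addr_ge0 ?nrm_ge0.
rewrite -(ler_pXn2r (n := 2)) ?nnegrE ?nrm_ge0//.
rewrite nrm_sqr sqfD sqrrD !nrm_sqr.
have := cauchy_schwarz x y; have := Re_le_cmod (a x y).
by rewrite ler_norml => /andP[_ h1] h2; rewrite -mulr_natl; lra.
Qed.

Lemma nrm_sum_le (J : Type) (r : seq J) (P : pred J) (F : J -> U) :
  nrm a (\sum_(j <- r | P j) F j) <= \sum_(j <- r | P j) nrm a (F j).
Proof.
elim/big_ind2 : _ => [|x1 x2 y1 y2 h1 h2|//]; first by rewrite nrm0.
by rewrite (le_trans (nrm_triangle _ _))// lerD.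
Qed.

Lemma nrm_eq0 x : definite a -> nrm a x = 0 -> x = 0.
Proof.
by move=> da x0; apply: da; rewrite -nrm_sqr x0 expr0n.
Qed.

Lemma definite_nrm_small x : definite a ->
  (forall e, 0 < e -> nrm a x <= e) -> x = 0.
Proof.
move=> da xe; apply: nrm_eq0 => //; apply/eqP; rewrite eq_le nrm_ge0 andbT.
by apply/ler_addgt0Pr => e e0; rewrite add0r; exact: xe.
Qed.

End hermitian_form.

Lemma hermitian_formP (R : realType) (U : lmodType R[i]) (a : U -> U -> R[i]) :
  hermitian_form a -> forall x y, a x y = 0 -> a y x = 0.
Proof. by move=> ha x y xy; rewrite (formC ha) xy conjc0. Qed.

(** * Compact symmetric operators on an incomplete space *)

Section spectral_theorem.
Variables (R : realType) (U : lmodType R[i]) (a : U -> U -> R[i]).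
Hypotheses (ha : hermitian_form a) (da : definite a).
Implicit Types (T : {linear U -> U}) (x y z : U).

Definition symmetric_op (T : U -> U) := forall x y, a (T x) y = a x (T y).

(** Approach along infinitely many indices, without extracting a subsequence. In [compact_op] the
    point lies in U itself, which stands in for completeness. *)
Definition cluster_point (x : nat -> U) q := forall e, 0 < e ->
  forall N, exists2 n, (N <= n)%N & nrm a (x n - q) <= e.

Definition compact_op (T : U -> U) := forall x : nat -> U,
  (forall n, nrm a (x n) <= 1) -> exists q, cluster_point (T \o x) q.

Definition infinite_dim := forall s : seq U,
  exists2 x, x != 0 & forall y, y \in s -> a x y = 0.

Variable T : {linear U -> U}.
Hypotheses (sT : symmetric_op T) (kT : compact_op T).
Hypothesis bT : exists2 M, 0 <= M & forall x, nrm a (T x) <= M * nrm a x.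
Hypothesis injT : forall x, T x = 0 -> x = 0.
Hypothesis infU : infinite_dim.

Let orth (s : seq U) x := forall y, y \in s -> a x y = 0.
Let eigen_seq (s : seq U) := forall y, y \in s -> exists t : R, T y = t%:C *: y.

Lemma sqf_eq0_neq x : x != 0 -> 0 < sqf a x.
Proof.
move=> x0; rewrite lt_neqAle sqf_ge0// andbT eq_sym.
by apply: contra_neq x0; exact: da.
Qed.

Lemma sqf_normalize x : x != 0 -> sqf a ((nrm a x)^-1%:C *: x) = 1.
Proof.
move=> x0; rewrite sqfZ// sqnorm_real exprVn nrm_sqr// mulVf//.
by rewrite gt_eqF// sqf_eq0_neq.
Qed.

Lemma orthZ s c x : orth s x -> orth s (c *: x).
Proof. by move=> sx y /sx xy; rewrite formZl// xy mulr0. Qed.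

Lemma orth_op s x : eigen_seq s -> orth s x -> orth s (T x).
Proof.
move=> es sx y ys; have [t Ty] := es _ ys.
by rewrite sT Ty formZr// sx// mulr0.
Qed.

(** Since (T - m) (T + m) x = 0, either T x = - m x or (T + m) x is an eigenvector for m. *)
Lemma eigenvector_of_square m x s : eigen_seq s -> orth s x -> x != 0 ->
  T (T x) = (m ^+ 2)%:C *: x ->
  exists v t, [/\ orth s v, sqf a v = 1, T v = t%:C *: v & t ^+ 2 = m ^+ 2].
Proof.
move=> es sx x0 TTx; have [w0|w0] := eqVneq (T x + m%:C *: x) 0.
  exists ((nrm a x)^-1%:C *: x), (- m); split.
  - exact: orthZ.
  - exact: sqf_normalize.
  - have -> : T ((nrm a x)^-1%:C *: x) = (nrm a x)^-1%:C *: T x by rewrite linearZ.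
    have -> : T x = (- m)%:C *: x.
      by apply/eqP; rewrite rmorphN scaleNr -addr_eq0 w0.
    by rewrite !scalerA mulrC.
  - by rewrite sqrrN.
set w := T x + _ in w0.
exists ((nrm a w)^-1%:C *: w), m; split => //.
- apply: orthZ => y ys; rewrite /w formDl// (orth_op es sx)// formZl// sx//.
  by rewrite mulr0 addr0.
- exact: sqf_normalize.
- rewrite linearZ /= /w linearD linearZ /= TTx !scalerDr !scalerA rmorphXn /=.
  by rewrite addrC; congr (_ *: _ + _ *: _); ring.
Qed.

(* A cluster point q of T x_n, for x_n maximising |T x| on the unit sphere of the
   orthogonal complement of s, satisfies T (T q) = m^2 q. *)
Lemma exists_top_eigenvector s : eigen_seq s ->
  exists v t, [/\ orth s v, sqf a v = 1, T v = t%:C *: v, t != 0 &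
    forall x, orth s x -> sqf a (T x) <= t ^+ 2 * sqf a x].
Proof.
move=> es; have [M M0 bM] := bT.
pose S : set R := [set sqf a (T x) | x in [set x | orth s x /\ sqf a x = 1]].
have [x0 x0N0 x0s] := infU s.
have S0 : S !=set0.
  exists (sqf a (T ((nrm a x0)^-1%:C *: x0))); exists ((nrm a x0)^-1%:C *: x0) => //.
  by split; [exact: orthZ|exact: sqf_normalize].
have bS : has_ubound S.
  exists (M ^+ 2) => _ [x [_ x1] <-]; rewrite -nrm_sqr//.
  rewrite ler_pXn2r ?nnegrE ?nrm_ge0//; apply: (le_trans (bM x)).
  by rewrite /nrm x1 sqrtr1 mulr1.
pose m2 := sup S.
have Sle x : orth s x -> sqf a (T x) <= m2 * sqf a x.
  move=> sx; have [->|xN0] := eqVneq x 0.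
    by rewrite linear0 sqf0// mulr0.
  have : sqf a (T ((nrm a x)^-1%:C *: x)) <= m2.
    apply: ub_le_sup => //; exists ((nrm a x)^-1%:C *: x) => //.
    by split; [exact: orthZ|exact: sqf_normalize].
  rewrite linearZ /= sqfZ// sqnorm_real exprVn nrm_sqr//.
  by rewrite ler_pdivrMl ?sqf_eq0_neq// mulrC.
have m2_gt0 : 0 < m2.
  have := Sle _ x0s; apply: contraTT; rewrite -leNgt -ltNge => m20.
  rewrite (@le_lt_trans _ _ 0)//.
    by rewrite mulr_le0_ge0// sqf_ge0.
  by apply: sqf_eq0_neq; apply: contra_neq x0N0; exact: injT.
pose m := Num.sqrt m2.
have m_gt0 : 0 < m by rewrite sqrtr_gt0.
have mm : m ^+ 2 = m2 by rewrite sqr_sqrtr// ltW.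
have /choice[x xP] (n : nat) : exists x,
    [/\ orth s x, sqf a x = 1 & m2 - n.+1%:R^-1 < sqf a (T x)].
  have n0 : (0 : R) < n.+1%:R^-1 by rewrite invr_gt0.
  have [_ [x [sx x1] <-] lt] := sup_adherent n0 (conj S0 bS).
  by exists x; split.
(* As T x_n is again orthogonal to s, |T T x_n|^2 <= m2 |T x_n|^2. Expanding the square then gives
   |r_n|^2 <= m2 (m2 - |T x_n|^2). *)
pose r n := T (T (x n)) - m2%:C *: x n.
have sr n : sqf a (r n) <= m2 / n.+1%:R.
  have [sx x1 lx] := xP n.
  rewrite /r sqfB// sqfZ// sqnorm_real x1 mulr1 formZr// conjc_real sT.
  rewrite form_sqf// -rmorphM /=.
  have := Sle _ (orth_op es sx).
  have : m2 * (m2 - n.+1%:R^-1) <= m2 * sqf a (T (x n)).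
    by rewrite ler_wpM2l ?(ltW m2_gt0)// ltW.
  by rewrite mulrBr; set A := sqf a (T (T _)); set B := sqf a (T _); move: (_ / _) (_ * B) => D E; rewrite expr2; lra.
(* Compactness is applied to T x_n / m, of norm at most 1: its image under T is close to m x_n
   because r_n is small, so m x_n itself clusters at q. *)
have [n|q qcl] := kT (x := fun n => m^-1%:C *: T (x n)).
  have [sx x1 _] := xP n; have := Sle _ sx; rewrite x1 mulr1 => h.
  rewrite nrmZ// cmod_real ger0_norm ?invr_ge0 ?(ltW m_gt0)//.
  by rewrite ler_pdivrMl// mulr1 ler_wsqrtr.
have main e : 0 < e -> exists n,
    nrm a (m%:C *: x n - q) <= e /\ nrm a (r n) <= e.
  move=> e0; pose d := Num.min (m * (e / 2)) e.
  have d0 : 0 < d by rewrite lt_min e0 andbT mulr_gt0// divr_gt0.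
  pose N := (Num.truncn (m2 / d ^+ 2)).+1.
  have [n Nn nq] := qcl (e / 2) (divr_gt0 e0 (ltr0Sn _ _)) N.
  have rd : nrm a (r n) <= d.
    rewrite -(ler_pXn2r (n := 2)) ?nnegrE ?nrm_ge0// ?(ltW d0)// nrm_sqr//.
    apply: (le_trans (sr n)); rewrite ler_pdivrMr// mulrC -ler_pdivrMr ?exprn_gt0//.
    have := Num.Theory.truncnS_gt (m2 / d ^+ 2); rewrite -/N => /ltW /le_trans; apply.
    by rewrite ler_nat (leq_trans Nn).
  exists n; split; last first.
    by rewrite (le_trans rd)// ge_min lexx orbT.
  have -> : m%:C *: x n - q = - (m^-1%:C *: r n) +
      ((T \o (fun n => m^-1%:C *: T (x n))) n - q).
    have -> : (T \o (fun n => m^-1%:C *: T (x n))) n = m^-1%:C *: T (T (x n)).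
      by rewrite /= linearZ.
    rewrite (_ : r n = T (T (x n)) - m2%:C *: x n)// scalerBr opprB addrA subrK.
    by rewrite scalerA -rmorphM -mm expr2 mulKf ?gt_eqF.
  rewrite (le_trans (nrm_triangle ha _ _))// [leRHS]splitr lerD// nrmN// nrmZ//.
  rewrite cmod_real ger0_norm ?invr_ge0 ?(ltW m_gt0)// ler_pdivrMl//.
  by rewrite (le_trans rd)// ge_min lexx.
have sq : orth s q.
  move=> y ys; apply: cmod_eq0; apply/eqP; rewrite eq_le cmod_ge0 andbT.
  apply/ler_addgt0Pr => e e0; rewrite add0r.
  pose d := e / (nrm a y + 1).
  have y1 : 0 < nrm a y + 1 by rewrite ltr_wpDl// nrm_ge0.
  have [n [nq _]] := main d (divr_gt0 e0 y1).
  have [sx _ _] := xP n.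
  have -> : a q y = - a (m%:C *: x n - q) y.
    by rewrite formBl// formZl// sx// mulr0 sub0r opprK.
  rewrite cmodN (le_trans (cauchy_schwarz ha _ _))//.
  rewrite (le_trans (ler_wpM2r (nrm_ge0 _ _) nq))//.
  by rewrite /d mulrAC ler_pdivrMr// ler_wpM2l ?(ltW e0)// lerDl.
have qN0 : q != 0.
  apply/eqP => q0; have [n [+ _]] := main (m / 2) (divr_gt0 m_gt0 (ltr0Sn _ _)).
  have [_ x1 _] := xP n; rewrite q0 subr0 nrmZ// cmod_real ger0_norm ?(ltW m_gt0)//.
  by rewrite /nrm x1 sqrtr1 mulr1; lra.
have TTq : T (T q) = (m ^+ 2)%:C *: q.
  apply/eqP; rewrite -subr_eq0; apply/eqP; apply: (definite_nrm_small ha) => // e e0.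
  pose L := M ^+ 2 + m + m ^+ 2.
  have L0 : 0 < L by rewrite /L -addrA ltr_wpDl ?sqr_ge0// addr_gt0 ?exprn_gt0.
  have [n [nq nr]] := main (e / L) (divr_gt0 e0 L0).
  have -> : T (T q) - (m ^+ 2)%:C *: q = - T (T (m%:C *: x n - q)) + m%:C *: r n
      + (m ^+ 2)%:C *: (m%:C *: x n - q).
    have -> : T (T (m%:C *: x n - q)) = m%:C *: T (T (x n)) - T (T q).
      by rewrite !linearB /= !linearZ.
    rewrite (_ : r n = T (T (x n)) - m2%:C *: x n)// -mm.
    move: (T (T q)) (T (T (x n))) => Tq Tx.
    rewrite opprB !scalerBr !scalerA [_ * m%:C]mulrC.
    by rewrite subrKA subrKA.
  have -> : e = M ^+ 2 * (e / L) + m * (e / L) + m ^+ 2 * (e / L).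
    by rewrite -!mulrDl -/L mulrC divfK// gt_eqF.
  rewrite (le_trans (nrm_triangle ha _ _))// lerD//; last first.
    by rewrite nrmZ// cmod_real ger0_norm ?sqr_ge0// ler_wpM2l ?sqr_ge0.
  rewrite (le_trans (nrm_triangle ha _ _))// lerD//; last first.
    by rewrite nrmZ// cmod_real ger0_norm ?(ltW m_gt0)// ler_wpM2l ?(ltW m_gt0).
  rewrite nrmN// (le_trans (bM _))// expr2 -mulrA ler_wpM2l//.
  by rewrite (le_trans (bM _))// ler_wpM2l.
have [v [t [sv v1 Tv tm]]] := eigenvector_of_square es sq qN0 TTq.
exists v, t; split => //; last by move=> y sy; rewrite tm mm; exact: Sle.
by rewrite -sqrf_eq0 tm mm gt_eqF.
Qed.

Theorem spectral_theorem : exists (p : nat -> U) (t : nat -> R),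
  [/\ forall k, T (p k) = (t k)%:C *: p k, forall k, t k != 0,
      forall i j, a (p i) (p j) = (i == j)%:R &
      forall x, (forall k, a x (p k) = 0) -> x = 0].
Proof.
pose good (s : seq U) (vt : U * R) := [/\ orth s vt.1, sqf a vt.1 = 1,
  T vt.1 = vt.2%:C *: vt.1, vt.2 != 0 &
  forall x, orth s x -> sqf a (T x) <= vt.2 ^+ 2 * sqf a x].
(* Choice yields a total function; (0, 0) is the default on sequences that do not consist of
   eigenvectors. *)
have /choice[F FP] (s : seq U) : exists vt, eigen_seq s -> good s vt.
  have [es|nes] := pselect (eigen_seq s); last by exists (0, 0).
  by have [v [t ?]] := exists_top_eigenvector es; exists (v, t).
pose s := fix s n := if n is n.+1 then (F (s n)).1 :: s n else [::].
have es n : eigen_seq (s n).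
  elim: n => [|n IH] y /=; first by rewrite in_nil.
  rewrite inE => /orP[/eqP ->|/IH//].
  by have [_ _ ? _ _] := FP _ IH; exists (F (s n)).2.
pose p n := (F (s n)).1; pose t n := (F (s n)).2.
have sp i j : (i < j)%N -> p i \in s j.
  elim: j => // j IH; rewrite ltnS leq_eqVlt => /orP[/eqP ->|/IH ps] /=.
    exact: mem_head.
  by rewrite inE ps orbT.
have sP n x : (forall k, a x (p k) = 0) -> orth (s n) x.
  move=> xp; elim: n => [|n IH] y /=; first by rewrite in_nil.
  by rewrite inE => /orP[/eqP ->|/IH//]; exact: (xp n).
have Tp k : T (p k) = (t k)%:C *: p k by have [] := FP _ (es k).
have pp i j : a (p i) (p j) = (i == j)%:R.
  have lt i' j' : (i' < j')%N -> a (p j') (p i') = 0.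
    by move=> /sp ij; have [+ _ _ _ _] := FP _ (es j'); exact.
  case: ltngtP => [ij|/lt//|->].
    by rewrite (hermitian_formP ha (lt _ _ ij)).
  by rewrite form_sqf//; have [_ -> _ _ _] := FP _ (es j).
have t0 k : t k != 0 by have [] := FP _ (es k).
exists p, t; split=> // x xp.
have np n : nrm a (p n) = 1 by rewrite /nrm /sqf pp eqxx /= sqrtr1.
(* Otherwise the vectors [T (p k)] are orthogonal of squared length at least d, too far apart to
   cluster. Small [t k] then kills T x through the extremality of [t k] on the complement of the
   earlier eigenvectors. *)
have small d : 0 < d -> exists k, t k ^+ 2 < d.
  move=> d0; apply: contrapT => /forallNP large.
  have [n|q qcl] := kT (x := p); first by rewrite np.
  have e0 : 0 < Num.sqrt d / 2 by rewrite divr_gt0// sqrtr_gt0.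
  have [n _ nq] := qcl _ e0 0%N.
  have [k nk kq] := qcl _ e0 n.+1.
  have le : nrm a (T (p k) - T (p n)) <= Num.sqrt d.
    rewrite [leRHS]splitr.
    have -> : T (p k) - T (p n) = (T (p k) - q) - (T (p n) - q).
      by rewrite opprB addrA subrK.
    by rewrite (le_trans (nrm_triangle ha _ _))// nrmN// lerD.
  have : sqf a (T (p k) - T (p n)) <= d.
    by rewrite -nrm_sqr// -[leRHS]sqr_sqrtr ?(ltW d0)// ler_pXn2r ?nnegrE ?nrm_ge0 ?sqrtr_ge0.
  have kn : a (p k) (p n) = 0 by rewrite pp gtn_eqF.
  rewrite sqfB// !Tp formZl// formZr// kn !mulr0 subr0.
  rewrite !sqfZ// !sqnorm_real -!nrm_sqr// !np expr1n !mulr1.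
  have := large k; have := large n; move=> /negP; rewrite -leNgt => h1.
  by move=> /negP; rewrite -leNgt => h2; lra.
apply: injT; apply: da; apply/eqP; rewrite eq_le sqf_ge0// andbT.
apply/ler_addgt0Pr => e e0; rewrite add0r.
have x1 : 0 < sqf a x + 1 by rewrite ltr_wpDl// sqf_ge0.
have [k tk] := small _ (divr_gt0 e0 x1).
have [_ _ _ _ /(_ _ (sP k x xp))] := FP _ (es k).
move=> /le_trans; apply; rewrite (le_trans (ler_wpM2r (sqf_ge0 ha _) (ltW tk)))//.
by rewrite mulrAC ler_pdivrMr// ler_wpM2l ?(ltW e0)// lerDl.
Qed.

End spectral_theorem.

(** * Reid's inequality *)

(** By log-convexity the ratios of successive terms do not decrease. If the first one, q, exceeded
    r, then b n >= q^n b 0 would outgrow K r^n, by Bernoulli's inequality for q / r. *)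
Lemma log_convex_growth (R : realType) (b : nat -> R) (K r : R) :
  (forall n, 0 <= b n) -> (forall n, b n.+1 ^+ 2 <= b n * b n.+2) ->
  0 <= r -> (forall n, b n <= K * r ^+ n) -> b 1%N <= r * b 0%N.
Proof.
move=> b0 bc r0 bK; rewrite leNgt; apply/negP => lt.
have b1 : 0 < b 1%N by rewrite (le_lt_trans _ lt)// mulr_ge0.
have b00 : 0 < b 0%N.
  rewrite lt_neqAle b0 andbT; apply/eqP => b0E; have := bc 0%N.
  by rewrite -b0E mul0r leNgt exprn_gt0.
pose q := b 1%N / b 0%N.
have q0 : 0 < q by rewrite divr_gt0.
have rq : r < q by rewrite ltr_pdivlMr.
have step n : 0 < b n /\ q * b n <= b n.+1.
  elim: n => [|n [bn IH]]; first by rewrite b00 divfK ?gt_eqF.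
  have bn1 : 0 < b n.+1 by rewrite (lt_le_trans _ IH)// mulr_gt0.
  split=> //; rewrite -(ler_pM2l bn); apply: le_trans (bc n).
  by rewrite mulrA [_ * q]mulrC expr2 ler_pM2r.
have pow n : q ^+ n * b 0%N <= b n.
  elim: n => [|n IH]; first by rewrite expr0 mul1r.
  have [_ +] := step n; apply: le_trans.
  by rewrite exprS -mulrA ler_pM2l.
have [r00|rN0] := eqVneq r 0.
  have := le_trans (pow 1%N) (bK 1%N); rewrite r00 expr1 mulr0.
  by rewrite leNgt mulr_gt0.
have rp : 0 < r by rewrite lt_neqAle eq_sym rN0.
pose h := q / r - 1.
have h0 : 0 < h by rewrite subr_gt0 ltr_pdivlMr// mul1r.
have bern n : 1 + n%:R * h <= (q / r) ^+ n.
  elim: n => [|n IH]; first by rewrite mul0r addr0 expr0.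
  rewrite exprS (_ : q / r = 1 + h); last by rewrite /h addrC subrK.
  move: IH; rewrite (_ : q / r = 1 + h); last by rewrite /h addrC subrK.
  move=> IH; apply: (@le_trans _ _ ((1 + h) * (1 + n%:R * h))).
    rewrite -natr1; have : 0 <= n%:R * h * h by rewrite !mulr_ge0 ?(ltW h0).
    by move: (n%:R : R) => y ?; nra.
  by rewrite ler_wpM2l// addr_ge0// ltW.
pose n := Num.truncn (K / b 0%N / h).
have := Num.Theory.truncnS_gt (K / b 0%N / h); rewrite -/n => lt1.
have : n.+1%:R * h < K / b 0%N.
  rewrite (@lt_le_trans _ _ ((q / r) ^+ n.+1))//.
    by rewrite (lt_le_trans _ (bern _))// ltrDr.
  rewrite expr_div_n ler_pdivlMr// mulrAC ler_pdivrMr ?exprn_gt0//.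
  exact: le_trans (pow _) (bK _).
by rewrite -ltr_pdivlMr// ltNge (ltW lt1).
Qed.

Section reid_inequality.
Variables (R : realType) (U : lmodType R[i]) (a : U -> U -> R[i]).
Hypothesis ha : hermitian_form a.
Variables (T : {linear U -> U}) (p : nat -> U) (t : nat -> R).
Hypothesis Tp : forall k, T (p k) = (t k)%:C *: p k.
Hypothesis t0 : forall k, t k != 0.
Hypothesis pp : forall i j, a (p i) (p j) = (i == j)%:R.

Lemma orthonormal_coef m (c : nat -> R[i]) k : (k < m)%N ->
  a (\sum_(l < m) c l *: p l) (p k) = c k.
Proof.
move=> km; rewrite form_suml// (bigD1 (Ordinal km))//= big1.
  by rewrite formZl// pp eqxx mulr1 addr0.
move=> i /eqP/val_eqP/= ik; rewrite formZl// pp.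
by rewrite (negbTE ik) mulr0.
Qed.

Lemma orthonormal_sqf m (c : nat -> R[i]) :
  sqf a (\sum_(l < m) c l *: p l) = \sum_(l < m) sqnorm (c l).
Proof.
set x := \sum_(l < m) _ in |- *; rewrite /sqf {2}/x form_sumr// Re_sum.
apply: eq_bigr => k _.
by rewrite formZr// orthonormal_coef// mulrC mulJ_sqnorm.
Qed.

Variables (w : U -> U -> R[i]) (C : R).
Hypotheses (hw : hermitian_form w) (C0 : 0 <= C).
Hypothesis wC : forall x y, cmod (w x y) <= C * (nrm a x * nrm a (T y)).

Section finite.
Variable m : nat.

(* N represents w in the form d: d (N x, y) = w (x, y) on the span, and the sequence
   d (N^n x, N^n x) is log-convex and O(C^(2n)). *)
Let d x y : R[i] := \sum_(k < m) (`|t k|)%:C * (a x (p k) * conjc (a y (p k))).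
Let N x : U := \sum_(k < m) (w x (p k) * (`|t k|^-1)%:C) *: p k.
Let span x := x = \sum_(k < m) a x (p k) *: p k.

Let sqfd x : sqf d x = \sum_(k < m) `|t k| * sqnorm (a x (p k)).
Proof.
rewrite /sqf /d Re_sum; apply: eq_bigr => k _.
by rewrite mulJ_sqnorm ReZ.
Qed.

Let hd : hermitian_form d.
Proof.
split=> [c x y z|x y|x].
- rewrite /d mulr_sumr -big_split; apply: eq_bigr => k _ /=.
  by rewrite formDl// formZl//; ring.
- rewrite /d rmorph_sum; apply: eq_bigr => k _ /=.
  move: (a x _) (a y _) => [x1 x2] [y1 y2]; apply/eqP; rewrite eq_complex /=.
  by apply/andP; split; apply/eqP; ring.
- rewrite -/(sqf d x) sqfd; apply: sumr_ge0 => k _.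
  by rewrite mulr_ge0// sqnorm_ge0.
Qed.

Let coefN x k : (k < m)%N -> a (N x) (p k) = w x (p k) * (`|t k|^-1)%:C.
Proof. exact: (orthonormal_coef (fun k => w x (p k) * (`|t k|^-1)%:C)). Qed.

Let spanN x : span (N x).
Proof. by apply: eq_bigr => k _; rewrite coefN. Qed.

Let dN x y : span y -> d (N x) y = w x y.
Proof.
move=> sy; rewrite [in RHS]sy form_sumr//; apply: eq_bigr => k _.
rewrite coefN// formZr// mulrA [_ * (w x (p k) * _)]mulrCA -rmorphM.
by rewrite mulfV ?normr_eq0// rmorph1 mulr1 mulrC.
Qed.

(** Duality: r is chosen so that w (x, r) = |N x|^2 and |T r| = |N x|. The hypothesis [wC] at (x, r)
    then reads |N x|^2 <= C |x| |N x|. *)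
Let nrmN x : nrm a (N x) <= C * nrm a x.
Proof.
pose r := \sum_(k < m) (w x (p k) * (t k ^- 2)%:C) *: p k.
have sN : sqf a (N x) = \sum_(k < m) sqnorm (w x (p k)) / t k ^+ 2.
  rewrite (orthonormal_sqf _ (fun k => w x (p k) * (`|t k|^-1)%:C)).
  apply: eq_bigr => k _; rewrite sqnormM sqnorm_real exprVn.
  by rewrite real_normK ?num_real.
have sT : sqf a (T r) = sqf a (N x).
  have -> : T r = \sum_(k < m) (w x (p k) * ((t k)^-1)%:C) *: p k.
    rewrite /r linear_sum; apply: eq_bigr => k _.
    rewrite linearZ /= Tp scalerA -mulrA -rmorphM /=.
    by congr (_ * _%:C *: _); field.
  rewrite (orthonormal_sqf _ (fun k => w x (p k) * ((t k)^-1)%:C)) sN.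
  by apply: eq_bigr => k _; rewrite sqnormM sqnorm_real exprVn.
have wr : Re (w x r) = sqf a (N x).
  rewrite sN /r form_sumr// Re_sum; apply: eq_bigr => k _.
  rewrite formZr// conjc_Mreal mulrAC [conjc _ * _]mulrC mulJ_sqnorm.
  by rewrite -rmorphM.
have : nrm a (N x) ^+ 2 <= C * nrm a x * nrm a (N x).
  rewrite nrm_sqr// -wr (le_trans (ler_norm _))// (le_trans (Re_le_cmod _))//.
  by rewrite (le_trans (wC _ _))// mulrA {1}/nrm -/(nrm a x) /(nrm a (T r)) sT.
have := nrm_ge0 a (N x); rewrite le_eqVlt => /orP[/eqP <- _|N0].
  by rewrite mulr_ge0// nrm_ge0.
by rewrite expr2 ler_pM2r.
Qed.

Let sqfd_le x : sqf d x <= (\sum_(k < m) `|t k|) * sqf a x.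
Proof.
rewrite sqfd mulr_suml; apply: ler_sum => k _.
rewrite ler_wpM2l//; have := cauchy_schwarz_sqr ha x (p k).
by rewrite {2}/sqf pp eqxx mulr1.
Qed.

Lemma reid_inequality (c : nat -> R[i]) :
  sqf w (\sum_(k < m) c k *: p k) <= C * \sum_(k < m) `|t k| * sqnorm (c k).
Proof.
set x := \sum_(k < m) _.
have sx : span x by apply: eq_bigr => k _; rewrite orthonormal_coef.
have si n : span (iter n N x) by case: n => [//|n]; exact: spanN.
pose b n := sqf d (iter n N x).
have b0 : b 0%N = \sum_(k < m) `|t k| * sqnorm (c k).
  by rewrite /b sqfd; apply: eq_bigr => k _; rewrite /= orthonormal_coef.
(* Because w is Hermitian, N is symmetric for d: d (N y, N y) = d (N^2 y, y), and the Cauchy-Schwarz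
   inequality for d applies. *)
have bc n : b n.+1 ^+ 2 <= b n * b n.+2.
  have -> : b n.+1 = Re (d (iter n.+2 N x) (iter n N x)).
    rewrite dN// [in RHS](formC hw) ReJ -dN//.
  rewrite mulrC; apply: le_trans (cauchy_schwarz_sqr hd _ _).
  by rewrite /sqnorm lerDl sqr_ge0.
have bi n : nrm a (iter n N x) <= C ^+ n * nrm a x.
  elim: n => [|n IH]; first by rewrite expr0 mul1r.
  by rewrite (le_trans (nrmN _))// exprS -mulrA ler_wpM2l.
have bK n : b n <= ((\sum_(k < m) `|t k|) * sqf a x) * (C ^+ 2) ^+ n.
  rewrite (le_trans (sqfd_le _))// -mulrA ler_wpM2l ?sumr_ge0//.
  rewrite -!nrm_sqr// mulrC -exprM mulnC exprM -exprMn.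
  by rewrite ler_pXn2r ?nnegrE ?mulr_ge0 ?exprn_ge0 ?nrm_ge0.
have b1 := log_convex_growth (fun n => sqf_ge0 hd _) bc (sqr_ge0 C) bK.
have b00 : 0 <= b 0%N by exact: (sqf_ge0 hd).
(* w (x, x) = d (N x, x) is at most the square root of b 1 * b 0, and b 1 <= C^2 b 0. *)
rewrite -b0 /sqf -dN// (le_trans (ler_norm _))// (le_trans (Re_le_cmod _))//.
rewrite (le_trans (cauchy_schwarz hd _ _))// /nrm -sqrtrM; last exact: (sqf_ge0 hd).
have -> : C * b 0%N = Num.sqrt ((C * b 0%N) ^+ 2).
  by rewrite sqrtr_sqr ger0_norm// mulr_ge0.
rewrite ler_wsqrtr// -/(b 1%N) -/(b 0%N) exprMn [_ ^+ 2 in leRHS]expr2.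
by rewrite [b 0%N ^+ 2]expr2 mulrA ler_wpM2r// -expr2.
Qed.

End finite.
End reid_inequality.

(** * Riesz bases *)

Section biorthogonal_systems.
Variables (R : realType) (U : lmodType R[i]) (a : U -> U -> R[i]).
Hypotheses (ha : hermitian_form a) (da : definite a).

Definition lims (u : nat -> U) (l : U) : Prop :=
  forall e, 0 < e -> exists N, forall n, (N <= n)%N -> nrm a (u n - l) <= e.

Definition complete_form : Prop := forall u : nat -> U,
  (forall e, 0 < e -> exists N, forall m n, (N <= m)%N -> (N <= n)%N ->
     nrm a (u m - u n) <= e) -> exists l, lims u l.

Definition bessel (e : nat -> U) : Prop := exists2 C, 0 <= C &
  forall m (c : nat -> R[i]),
    sqf a (\sum_(k < m) c k *: e k) <= C * \sum_(k < m) sqnorm (c k).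

Definition total (g : nat -> U) : Prop :=
  forall x, (forall k, a x (g k) = 0) -> x = 0.

Definition biorthogonal (e g : nat -> U) : Prop :=
  forall i j, a (e i) (g j) = (i == j)%:R.

Lemma lims_unique u l l' : lims u l -> lims u l' -> l = l'.
Proof.
move=> ul ul'; apply/eqP; rewrite -subr_eq0; apply/eqP.
apply: (definite_nrm_small ha da) => e e0.
have [N Nl] := ul _ (divr_gt0 e0 (ltr0Sn _ 1)).
have [N' Nl'] := ul' _ (divr_gt0 e0 (ltr0Sn _ 1)).
pose n := maxn N N'.
have -> : l - l' = - (u n - l) + (u n - l').
  by rewrite opprB subrKA.
rewrite (le_trans (nrm_triangle ha _ _))// nrmN// [leRHS]splitr.
by rewrite lerD// ?Nl ?Nl'// ?leq_maxl ?leq_maxr.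
Qed.

Lemma lims_lin (c : R[i]) u v l l' : lims u l -> lims v l' ->
  lims (fun n => c *: u n + v n) (c *: l + l').
Proof.
move=> ul vl e e0.
have c1 : 0 < cmod c + 1 by rewrite ltr_wpDl// cmod_ge0.
have e2 : 0 < e / 2 by rewrite divr_gt0.
have [N Nl] := ul _ (divr_gt0 e2 c1).
have [N' Nl'] := vl _ e2.
exists (maxn N N') => n; rewrite geq_max => /andP[/Nl h1 /Nl' h2].
have -> : c *: u n + v n - (c *: l + l') = c *: (u n - l) + (v n - l').
  by rewrite scalerBr opprD addrACA.
rewrite (le_trans (nrm_triangle ha _ _))// [leRHS]splitr lerD// nrmZ//.
rewrite (le_trans (ler_wpM2l (cmod_ge0 _) h1))// mulrCA ler_piMr ?ltW//.
by rewrite ltr_pdivrMr// mul1r ltrDl.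
Qed.

Lemma lims_nrm_le u l M : lims u l -> (forall n, nrm a (u n) <= M) -> nrm a l <= M.
Proof.
move=> ul uM; apply/ler_addgt0Pr => e e0; have [N /(_ N (leqnn _)) Nl] := ul _ e0.
have -> : l = u N - (u N - l) by rewrite opprB addrC subrK.
by rewrite (le_trans (nrm_triangle ha _ _))// nrmN// lerD.
Qed.

Lemma lims_form u l z v : lims u l ->
  (exists N, forall n, (N <= n)%N -> a (u n) z = v) -> a l z = v.
Proof.
move=> ul [N0 uv]; apply/eqP; rewrite -subr_eq0; apply/eqP/cmod_eq0/eqP.
rewrite eq_le cmod_ge0 andbT; apply/ler_addgt0Pr => e e0; rewrite add0r.
have z1 : 0 < nrm a z + 1 by rewrite ltr_wpDl// nrm_ge0.
have [N Nl] := ul _ (divr_gt0 e0 z1).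
rewrite -(uv (maxn N0 N)) ?leq_maxl// -formBl// -cmodN -formNl// opprB.
rewrite (le_trans (cauchy_schwarz ha _ _))//.
rewrite (le_trans (ler_wpM2r (nrm_ge0 _ _) (Nl _ (leq_maxr _ _))))//.
by rewrite mulrAC ler_pdivrMr// ler_wpM2l ?(ltW e0)// lerDl.
Qed.

Lemma lims_form_eq u v l l' y z : lims u l -> lims v l' ->
  (forall n, a (u n) y = a (v n) z) -> a l y = a l' z.
Proof.
move=> ul vl uv; apply/eqP; rewrite -subr_eq0; apply/eqP/cmod_eq0/eqP.
rewrite eq_le cmod_ge0 andbT; apply/ler_addgt0Pr => e e0; rewrite add0r.
pose s := nrm a y + nrm a z + 1.
have s0 : 0 < s by rewrite ltr_wpDl// addr_ge0// nrm_ge0.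
have [N Nl] := ul _ (divr_gt0 e0 s0).
have [N' Nl'] := vl _ (divr_gt0 e0 s0).
pose n := maxn N N'.
have -> : a l y - a l' z = a (v n - l') z - a (u n - l) y.
  by rewrite !(formBl ha) uv opprB [RHS]addrC subrKA.
rewrite (le_trans (cmodD _ _))// cmodN.
rewrite (@le_trans _ _ (e / s * nrm a z + e / s * nrm a y))//.
  rewrite lerD// (le_trans (cauchy_schwarz ha _ _))// ler_wpM2r ?nrm_ge0//.
    by rewrite Nl'// leq_maxr.
  by rewrite Nl// leq_maxl.
rewrite -mulrDr mulrAC ler_pdivrMr// ler_wpM2l ?(ltW e0)//.
by rewrite /s addrC lerDl.
Qed.

(** The coefficient map is adjoint to the synthesis map, so both have the same bound: pair x with
    the y whose coefficients are those of x. *)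
Lemma bessel_dual e : bessel e -> exists2 C, 0 <= C &
  forall m x, \sum_(k < m) sqnorm (a x (e k)) <= C * sqf a x.
Proof.
move=> [C C0 eC]; exists C => // m x.
set S := \sum_(k < m) _.
have S0 : 0 <= S by apply: sumr_ge0 => k _; exact: sqnorm_ge0.
pose y := \sum_(k < m) a x (e k) *: e k.
have xy : a x y = S%:C.
  rewrite /y form_sumr// /S rmorph_sum; apply: eq_bigr => k _.
  by rewrite formZr// mulrC mulJ_sqnorm.
have := cauchy_schwarz_sqr ha x y; rewrite xy sqnorm_real.
have := eC m (fun k => a x (e k)); rewrite -/y -/S => h1 h2.
have h3 : S ^+ 2 <= sqf a x * (C * S).
  by rewrite (le_trans h2)// ler_wpM2l// sqf_ge0.
move: S0; rewrite le_eqVlt => /orP[/eqP <-|S0].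
  by rewrite mulr_ge0// sqf_ge0.
by move: h3; rewrite mulrCA mulrA expr2 ler_pM2r.
Qed.

Hypothesis ca : complete_form.

Lemma bessel_series_cvg e (c : nat -> R[i]) (K : R) : bessel e ->
  (forall m, \sum_(k < m) sqnorm (c k) <= K) ->
  exists l, lims (fun m => \sum_(k < m) c k *: e k) l.
Proof.
move=> [C C0 eC] cK; apply: ca => d d0.
pose s m := \sum_(k < m) sqnorm (c k).
have smono m n : (m <= n)%N -> s m <= s n.
  move=> /subnK <-; elim: (n - m)%N => [//|k IH].
  by rewrite addSn (le_trans IH)// /s big_ord_recr lerDl sqnorm_ge0.
pose S := [set s m | m in setT].
have hS : has_sup S.
  split; first by exists (s 0%N), 0%N.
  by exists K => _ [m _ <-]; exact: cK.
have C1 : 0 < C + 1 by rewrite ltr_wpDl.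
have d2 : 0 < d ^+ 2 / (C + 1) by rewrite divr_gt0// exprn_gt0.
have [_ [N _ <-] lt] := sup_adherent d2 hS.
have sN n : s n <= sup S by apply: ub_le_sup; [case: hS|exists n].
have key m n : (N <= m <= n)%N ->
    nrm a (\sum_(k < n) c k *: e k - \sum_(k < m) c k *: e k) <= d.
  move=> /andP[Nm mn].
  (* Coefficients below m are set to 0, so that a block of the series becomes a sum from 0, to which
     the Bessel inequality applies. *)
  pose c' k := if (m <= k)%N then c k else 0.
  have eqs (V : nmodType) (F : nat -> V) : \sum_(k < n) F k =
      \sum_(k < m) F k + \sum_(k < n) (if (m <= k)%N then F k else 0).
    rewrite -(big_mkord xpredT F) (big_cat_nat (n := m))//= big_mkord; congr (_ + _).
    rewrite -(big_mkord xpredT (fun k => if (m <= k)%N then F k else 0)).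
    rewrite [RHS](big_cat_nat (n := m))//= [X in _ = X + _]big_nat_cond [X in _ = X + _]big1 ?add0r.
      by apply: eq_big_nat => i /andP[-> _].
    by move=> i /andP[/andP[_ im] _]; rewrite leqNgt im.
  rewrite (eqs _ (fun k => c k *: e k)) addrC addKr.
  have -> : \sum_(k < n) (if (m <= k)%N then c k *: e k else 0)
      = \sum_(k < n) c' k *: e k.
    by apply: eq_bigr => k _; rewrite /c'; case: ifP => // _; rewrite scale0r.
  rewrite -(ler_pXn2r (n := 2)) ?nnegrE ?nrm_ge0 ?(ltW d0)// nrm_sqr//.
  rewrite (le_trans (eC _ _))//.
  have -> : \sum_(k < n) sqnorm (c' k) = s n - s m.
    rewrite /s (eqs _ (fun k => sqnorm (c k))) addrC addKr.
    apply: eq_bigr => k _; rewrite /c'; case: ifP => // _.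
    by rewrite /sqnorm /= expr0n addr0.
  have h : s n - s m <= d ^+ 2 / (C + 1).
    have := sN n; have := smono _ _ Nm; move: lt.
    by move: (s n) (s m) (s N) (d ^+ 2 / _) => x1 x2 x3 x4; lra.
  rewrite (le_trans (ler_wpM2l C0 h))// mulrCA ler_piMr ?sqr_ge0//.
  by rewrite ler_pdivrMr// mul1r lerDl.
exists N => m n Nm Nn; have [mn|nm] := leqP m n.
  by rewrite nrmB// key// Nm.
by rewrite key// Nn ltnW.
Qed.

(** Coefficients along g are square summable by [bessel_dual], hence may be used along e. Uniqueness
    of limits makes the resulting map linear. *)
Lemma coefficient_transfer (g e : nat -> U) : bessel g -> bessel e ->
  exists V : {linear U -> U},
    (forall x, lims (fun m => \sum_(k < m) a x (g k) *: e k) (V x)) /\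
    exists M, forall x, nrm a (V x) <= M * nrm a x.
Proof.
move=> bg be; have [Cg Cg0 gC] := bessel_dual bg.
have /choice[F FP] x := @bessel_series_cvg e (fun k => a x (g k)) _ be (gC ^~ x).
have linF : linear F.
  move=> c x y; apply: lims_unique (FP _) _.
  have := lims_lin c (FP x) (FP y); congr lims; apply/funext => m.
  rewrite scaler_sumr -big_split; apply: eq_bigr => k _ /=.
  by rewrite formDl// formZl// scalerDl scalerA.
pose V := HB.pack_for {linear U -> U} F (GRing.isLinear.Build _ _ _ _ F linF).
exists V; split=> //.
have [C C0 eC] := be; exists (Num.sqrt (C * Cg)) => x.
apply: (lims_nrm_le (FP x)) => n.
rewrite /nrm -sqrtrM ?mulr_ge0// ler_wsqrtr// (le_trans (eC _ (fun k => a x (g k))))//.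
by rewrite -mulrA ler_wpM2l.
Qed.

Lemma transfer_coef (g e g' : nat -> U) (V : U -> U) x k :
  (forall x, lims (fun m => \sum_(k < m) a x (g k) *: e k) (V x)) ->
  biorthogonal e g' -> a (V x) (g' k) = a x (g k).
Proof.
move=> VP eg; apply: (lims_form (VP x)); exists k.+1 => n kn.
rewrite form_suml// (bigD1 (Ordinal kn))//= big1.
  by rewrite formZl// eg eqxx mulr1 addr0.
move=> i /eqP/val_eqP/= ik; rewrite formZl// eg.
by rewrite (negbTE ik) mulr0.
Qed.

Lemma total_inj g : total g -> forall x y, (forall k, a x (g k) = a y (g k)) -> x = y.
Proof.
move=> tg x y xy; apply/eqP; rewrite -subr_eq0; apply/eqP/tg => k.
by rewrite formBl// xy subrr.
Qed.

(** V sends coefficients along b to expansions along e, and W sends coefficients along g to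
    expansions along b. That they are inverse to each other is checked on coefficients, against the
    total families b and g. *)
Lemma biorthogonal_similarity b e g :
  bessel b -> biorthogonal b b -> total b ->
  bessel e -> bessel g -> biorthogonal e g -> total g ->
  exists V W : {linear U -> U},
    [/\ (exists M, forall x, nrm a (V x) <= M * nrm a x),
        (exists M, forall x, nrm a (W x) <= M * nrm a x),
        cancel V W, cancel W V &
        [/\ forall k, V (b k) = e k, forall x k, a (V x) (g k) = a x (b k) &
            forall x k, a (W x) (b k) = a x (g k)]].
Proof.
move=> bb obb tb be bg oeg tg.
have [V [VP VM]] := coefficient_transfer bb be.
have [W [WP WM]] := coefficient_transfer bg bb.
have cV x k : a (V x) (g k) = a x (b k) by apply: transfer_coef VP oeg.
have cW x k : a (W x) (b k) = a x (g k) by apply: transfer_coef WP obb.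
exists V, W; split=> //.
- by move=> x; apply: (total_inj tb) => k; rewrite cW cV.
- by move=> x; apply: (total_inj tg) => k; rewrite cV cW.
by split=> // k; apply: (total_inj tg) => l; rewrite cV obb oeg.
Qed.

Lemma orthonormal_expansion b : bessel b -> biorthogonal b b -> total b ->
  forall x, lims (fun m => \sum_(k < m) a x (b k) *: b k) x.
Proof.
move=> bb obb tb x.
have [V [VP _]] := coefficient_transfer bb bb.
suff Vx : V x = x by have := VP x; rewrite Vx.
by apply: (total_inj tb) => k; rewrite (transfer_coef _ _ VP obb).
Qed.

End biorthogonal_systems.

(** * Eigenvectors of K J for a positive compact K and a unitary involution J *)

Section symmetrizable.
Variables (R : realType) (U : lmodType R[i]) (dot : U -> U -> R[i]).
Hypotheses (hd : hermitian_form dot) (dd : definite dot).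
Variable K : {linear U -> U}.

Definition energy x y := dot (K x) y.

Hypothesis sK : symmetric_op dot K.
Hypothesis K_ge0 : forall x, 0 <= Re (dot (K x) x).
Hypothesis dK : definite energy.
Variable M : R.
Hypotheses (M0 : 0 <= M) (bK : forall x, nrm dot (K x) <= M * nrm dot x).
(** Compactness from the weaker energy norm into the stronger norm of [dot]; it implies compactness
    for each of the two norms. *)
Hypothesis kK : forall x : nat -> U, (forall n, nrm energy (x n) <= 1) ->
  exists q, cluster_point dot (K \o x) q.
Hypothesis infU : infinite_dim dot.

Let ha : hermitian_form energy.
Proof.
split=> [c x y z|x y|x]; last exact: K_ge0.
  by rewrite /energy linearP formDl// formZl.
by rewrite /energy sK -(formC hd).
Qed.

Lemma energy_hermitian : hermitian_form energy. Proof. exact: ha. Qed.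

Lemma nrm_energy_le x : nrm energy x <= (M + 1) * nrm dot x.
Proof.
have M1 : 0 <= M + 1 by rewrite addr_ge0.
rewrite -(ler_pXn2r (n := 2)) ?nnegrE ?mulr_ge0 ?nrm_ge0// nrm_sqr//.
rewrite /sqf /energy (le_trans (ler_norm _))// (le_trans (Re_le_cmod _))//.
rewrite (le_trans (cauchy_schwarz hd _ _))//.
rewrite (le_trans (ler_wpM2r (nrm_ge0 _ _) (bK x)))// exprMn expr2 -!mulrA.
rewrite ler_pM ?mulr_ge0 ?nrm_ge0// ?lerDl// -expr2.
by rewrite ler_peMl ?sqr_ge0// lerDr.
Qed.

(** |K x|^2 is the energy product of x and K x, and the energy norm of K x is at most (M + 1) |K
    x|. *)
Lemma nrm_K_le x : nrm dot (K x) <= (M + 1) * nrm energy x.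
Proof.
have M1 : 0 <= M + 1 by rewrite addr_ge0.
have : nrm dot (K x) ^+ 2 <= (M + 1) * nrm energy x * nrm dot (K x).
  rewrite nrm_sqr// (_ : sqf dot (K x) = Re (energy x (K x)))//.
  rewrite (le_trans (ler_norm _))// (le_trans (Re_le_cmod _))//.
  rewrite (le_trans (cauchy_schwarz ha _ _))// mulrAC mulrC ler_wpM2r ?nrm_ge0//.
  exact: nrm_energy_le.
have := nrm_ge0 dot (K x); rewrite le_eqVlt => /orP[/eqP <- _|N0].
  by rewrite mulr_ge0// nrm_ge0.
by rewrite expr2 ler_pM2r.
Qed.

Lemma K_inj x : K x = 0 -> x = 0.
Proof. by move=> Kx; apply: dK; rewrite /sqf /energy Kx form0l. Qed.

Variable J : {linear U -> U}.
Hypotheses (sJ : symmetric_op dot J) (JJ : involutive J).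

Lemma nrm_involution x : nrm dot (J x) = nrm dot x.
Proof. by rewrite /nrm /sqf sJ JJ. Qed.

Variables (w : U -> U -> R[i]) (c C : R).
Hypotheses (hw : hermitian_form w) (c0 : 0 < c) (C0 : 0 <= C).
Hypothesis cw : forall x, c * sqf dot (K x) <= sqf w x.
Hypothesis wC : forall x y,
  cmod (w x y) <= C * (nrm energy x * nrm energy (J (K y))).

Theorem riesz_eigenvectors : exists (e : nat -> U) (t : nat -> R),
  [/\ forall k, t k != 0, forall k, K (J (e k)) = (t k)%:C *: e k,
      forall i j, dot (J (e i)) (e j) = (Num.sg (t i))%:C * (i == j)%:R,
      bessel dot e & forall x, (forall k, dot x (J (e k)) = 0) -> x = 0].
Proof.
pose T : {linear U -> U} := [the {linear U -> U} of J \o K].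
have TE x : T x = J (K x) by [].
have M1 : 0 <= M + 1 by rewrite addr_ge0.
have [|||||p [t [Tp t0 pp tp]]] := @spectral_theorem _ _ _ ha dK T.
- by move=> x y; rewrite /energy !TE sK -sJ.
- move=> x /kK[q qcl]; exists (J q) => e e0 N.
  have M2 : 0 < M + 1 by rewrite ltr_wpDl.
  have [n Nn nq] := qcl _ (divr_gt0 e0 M2) N; exists n => //.
  rewrite [(T \o x) n]TE -linearB (le_trans (nrm_energy_le _))// nrm_involution.
  by rewrite mulrC -ler_pdivlMr.
- exists ((M + 1) * (M + 1)); first exact: mulr_ge0.
  move=> x; rewrite TE (le_trans (nrm_energy_le _))// nrm_involution.
  by rewrite -mulrA ler_wpM2l// nrm_K_le.
- by move=> x; rewrite TE => /(congr1 J); rewrite JJ linear0; exact: K_inj.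
- move=> s; have [x x0 xs] := infU [seq K y | y <- s]; exists x => // y ys.
  by rewrite /energy sK xs// map_f.
have Tp' k : J (K (p k)) = (t k)%:C *: p k by exact: Tp.
(* This normalisation makes the products <J e_i, e_j> equal to the sign of t_i times the identity
   matrix. *)
pose r k : R := (Num.sqrt `|t k|)^-1.
have r0 k : 0 < r k by rewrite invr_gt0 sqrtr_gt0 normr_gt0.
have rr k : r k ^+ 2 * `|t k| = 1.
  by rewrite exprVn sqr_sqrtr// mulVf// normr_eq0.
pose e k := (r k)%:C *: K (p k).
have Je k : J (e k) = (r k * t k)%:C *: p k.
  by rewrite /e linearZ /= Tp' scalerA -rmorphM.
exists e, t; split => //.
- move=> k; rewrite Je linearZ /= /e scalerA -rmorphM /=.
  by rewrite mulrC.
- move=> i j; rewrite Je /e formZl// formZr// -sK -/(energy _ _) pp.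
  have [<-|ij] := eqVneq i j; last by rewrite !mulr0.
  rewrite !mulr1 conjc_real -rmorphM /=; congr (_%:C).
  have ti : t i = Num.sg (t i) * `|t i| by rewrite -numEsg.
  by rewrite -[RHS]mul1r -(rr i) {1}ti; ring.
- exists (C / c); first by rewrite divr_ge0// ltW.
  move=> m x; rewrite -(ler_pM2l c0) mulrA [c * (C / c)]mulrC divfK ?gt_eqF//.
  (* Reid's inequality is applied to the coefficients x_k r_k; its weights |t_k| cancel r_k^2,
     leaving the sum of the |x_k|^2. *)
  have -> : \sum_(k < m) x k *: e k = K (\sum_(k < m) (x k * (r k)%:C) *: p k).
    by rewrite linear_sum; apply: eq_bigr => k _; rewrite [RHS]linearZ scalerA.
  rewrite (le_trans (cw _))//.
  have := @reid_inequality _ _ _ ha T p t Tp t0 pp w C hw C0 wC m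
     (fun k => x k * (r k)%:C).
  move=> /le_trans; apply; rewrite le_eqVlt; apply/orP; left; apply/eqP.
  congr (_ * _); apply: eq_bigr => k _.
  by rewrite sqnormM sqnorm_real mulrCA [`|_| * _]mulrC rr mulr1.
(* Being orthogonal to all J e_k means that J x is orthogonal to all p_k for the energy. *)
- move=> x xe; rewrite -[x]JJ (_ : J x = 0) ?linear0//; apply: tp => k.
  have := xe k; rewrite /energy sK sJ /e linearZ /= formZr// => /eqP.
  rewrite mulf_eq0 conjc_real fmorph_eq0 gt_eqF//= => /eqP.
  exact.
Qed.

End symmetrizable.

(** * From the eigenvectors to a Riesz basis and a similar selfadjoint operator *)

Section similarity.
Variables (R : realType) (U : lmodType R[i]) (dot : {dot U for @conjc R}).

Lemma Re_dot_gt0 x : x != 0 -> 0 < Re (dot x x).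
Proof.
move=> x0; have : (0 : R[i]) < dot x x by exact: neq0_dnorm_gt0.
by rewrite ltcE => /andP[_].
Qed.

Lemma dot_hermitian : hermitian_form dot.
Proof.
split=> [c x y z|x y|x].
- by rewrite linearPl.
- by rewrite [LHS]hermC expr0 mul1r.
- have [->|x0] := eqVneq x 0; first by rewrite linear0l.
  exact/ltW/Re_dot_gt0.
Qed.

Lemma dot_definite : definite dot.
Proof.
move=> x x0; apply/eqP/negP => /negP /Re_dot_gt0.
by rewrite [X in _ < X]x0 ltxx.
Qed.

Let hd := dot_hermitian.
Let dd := dot_definite.

(** The operator is S^-1. For (v, v') in its adjoint, testing with the pair (S u, u) where u = v - S
    v' gives <u, v> = <u, S v'>, that is |u|^2 = 0. *)
Lemma bounded_op_symmetric_selfadjoint (S : {linear U -> U}) :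
  symmetric_op dot S -> (forall x, S x = 0 -> x = 0) ->
  densely_defined dot [set uv | uv.1 = S uv.2] ->
  selfadjoint dot [set uv | uv.1 = S uv.2].
Proof.
move=> sS iS Sd; split=> //.
  split=> [|c u v u' v' /= -> ->|u v v' /= uv uv'] /=; first by rewrite linear0.
    by rewrite linearP.
  by apply/eqP; rewrite -subr_eq0; apply/eqP/iS; rewrite linearB -uv -uv' subrr.
apply/seteqP; split=> -[v v'] /= h; last first.
  by move=> u u' /= ->; rewrite h sS.
apply/eqP; rewrite -subr_eq0; apply/eqP/dd.
rewrite /sqf formBr//; set u := v - S v'.
by rewrite (h (S u) u)//= -sS subrr.
Qed.

Variable K : {linear U -> U}.
Hypothesis cd : complete_form dot.
Hypothesis sK : symmetric_op dot K.
Hypothesis K_ge0 : forall x, 0 <= Re (dot (K x) x).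
Hypothesis dK : definite (energy dot K).
Variable M : R.
Hypotheses (M0 : 0 <= M) (bK : forall x, nrm dot (K x) <= M * nrm dot x).
Hypothesis kK : forall x : nat -> U, (forall n, nrm (energy dot K) (x n) <= 1) ->
  exists q, cluster_point dot (K \o x) q.
Hypothesis infU : infinite_dim dot.

Let ha : hermitian_form (energy dot K) := energy_hermitian hd sK K_ge0.

(** The case J = id and w (x, y) = <K x, K y> of [riesz_eigenvectors]: Cauchy-Schwarz for the energy
    is the required bound on w, and all signs are 1 because <e_j, e_j> >= 0. *)
Lemma exists_orthonormal_basis : exists b : nat -> U,
  [/\ biorthogonal dot b b, bessel dot b & total dot b].
Proof.
pose w x y := dot (K x) (K y).
have hw : hermitian_form w.
  split=> [c x y z|x y|x]; last exact: (sqf_ge0 hd).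
    by rewrite /w linearP formDl// formZl.
  exact: (formC hd).
have sI : symmetric_op dot (@idfun U) by [].
have II : involutive (@idfun U) by [].
have [||||e [t [t0 Ke oe be te]]] :=
  @riesz_eigenvectors _ _ dot hd K sK K_ge0 dK M M0 bK kK infU idfun sI II w 1 1 hw.
- exact: ltr01.
- exact: ler01.
- by move=> x; rewrite mul1r.
- move=> x y; rewrite mul1r; exact: (cauchy_schwarz ha x (K y)).
exists e; split=> // i j; rewrite (oe i j).
have [->|_] := eqVneq i j; last by rewrite mulr0.
have := sqf_ge0 hd (e j); rewrite /sqf (oe j j) eqxx !mulr1 /= sgr_ge0 => ti.
by rewrite gtr0_sg ?rmorph1// lt_neqAle eq_sym t0.
Qed.

Variable J : {linear U -> U}.
Hypotheses (sJ : symmetric_op dot J) (JJ : involutive J).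
Variables (w : U -> U -> R[i]) (c C : R).
Hypotheses (hw : hermitian_form w) (c0 : 0 < c) (C0 : 0 <= C).
Hypothesis cw : forall x, c * sqf dot (K x) <= sqf w x.
Hypothesis wC : forall x y, cmod (w x y) <=
  C * (nrm (energy dot K) x * nrm (energy dot K) (J (K y))).

Theorem similar_selfadjoint_riesz_basis (B : set (U * U)) :
  B = [set fg | fg.1 = K (J fg.2)] ->
  (exists A, selfadjoint dot A /\ similar_op dot B A) /\
  (exists e, riesz_basis dot e /\ forall k, eigenvector B (e k)).
Proof.
move=> BE.
have [e [t [t0 Ke oe be te]]] :=
  riesz_eigenvectors hd sK K_ge0 dK M0 bK kK infU sJ JJ hw c0 C0 cw wC.
have [b [ob bb tb]] := exists_orthonormal_basis.
have sgsg k : (Num.sg (t k))%:C * (Num.sg (t k))%:C = 1 :> R[i].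
  by rewrite -rmorphM -expr2 sqr_sg t0 rmorph1.
have sg0 k : (Num.sg (t k))%:C != 0 :> R[i].
  by rewrite fmorph_eq0 sgr_eq0.
(* The sign turns the J e_k into the family biorthogonal to the e_k. *)
pose g k := (Num.sg (t k))%:C *: J (e k).
have xg x k : dot x (g k) = (Num.sg (t k))%:C * dot x (J (e k)).
  by rewrite formZr// conjc_real.
have bg : bessel dot g.
  have [D D0 eD] := be; exists D => // m x.
  have -> : \sum_(k < m) x k *: g k = J (\sum_(k < m) (x k * (Num.sg (t k))%:C) *: e k).
    by rewrite linear_sum; apply: eq_bigr => k _; rewrite [RHS]linearZ scalerA.
  rewrite -nrm_sqr// (nrm_involution sJ JJ) nrm_sqr//.
  rewrite (le_trans (eD m (fun k => x k * (Num.sg (t k))%:C)))//.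
  rewrite ler_wpM2l// ler_sum// => k _.
  by rewrite sqnormM sqnorm_real sqr_sg t0 mulr1.
have oeg : biorthogonal dot e g.
  move=> i j; rewrite xg -sJ oe.
  by have [->|_] := eqVneq i j; rewrite ?mulr0// mulr1 sgsg.
have tg : total dot g.
  move=> x xg0; apply: te => k; have := xg0 k; rewrite xg => /eqP.
  by rewrite mulf_eq0 (negbTE (sg0 k)) => /eqP.
have [V [W [bV bW VW WV [Vb Vg Wb]]]] :=
  biorthogonal_similarity hd dd cd bb ob tb be bg oeg tg.
have exp := orthonormal_expansion hd dd cd bb ob tb.
have bi : bounded_inverses dot V W by split.
split; last first.
  exists e; split; last first.
    move=> k; split; last first.
      exists (t k)^-1%:C; rewrite BE /= !linearZ /= Ke scalerA -rmorphM.
      by rewrite mulVf// rmorph1 scale1r.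
    apply/eqP => ek; have := oeg k k.
    by rewrite ek form0l// eqxx => /esym/eqP; rewrite oner_eq0.
  exists b, V, W; split=> // [|k]; last by rewrite Vb.
  split=> // u.
  apply/cvgrPdist_le => /= d d0; have [N uN] := exp u _ d0.
  exists N => // m /= Nm; rewrite sub0r normrN ger0_norm ?sqrtr_ge0//.
  by have := uN _ Nm; rewrite nrmB.
(* S = V^-1 (K J) V is diagonal in the orthonormal basis b with the real entries t_k, hence
   symmetric; the selfadjoint operator is its inverse. *)
pose S : {linear U -> U} := [the {linear U -> U} of W \o (K \o (J \o V))].
have SE x : S x = W (K (J (V x))) by [].
have Sb x k : dot (S x) (b k) = (t k)%:C * dot x (b k).
  by rewrite SE Wb -Vg !xg sK Ke (formZr hd) conjc_real sJ mulrCA.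
have sS : symmetric_op dot S.
  move=> x y; apply: (lims_form_eq hd (exp (S x)) (exp x)) => n.
  have bS k : dot (b k) (S y) = dot (b k) y * (t k)%:C.
    by rewrite (formC hd (S y)) Sb mulrC conjc_Mreal -(formC hd).
  rewrite !(form_suml hd); apply: eq_bigr => k _; rewrite !(formZl hd) Sb bS.
  by rewrite -mulrA mulrC mulrA.
exists [set uv | uv.1 = S uv.2]; split.
  apply: bounded_op_symmetric_selfadjoint => //.
    move=> x /(congr1 V); rewrite linear0 SE WV => /(K_inj hd dK) /(congr1 J).
    by rewrite JJ linear0 => /(congr1 W); rewrite VW linear0.
  (* Partial sums of the expansion along b lie in the range of S, since b_k = S (b_k / t_k). *)
  move=> u d d0; have [N /(_ N (leqnn _)) uN] := exp u _ (divr_gt0 d0 (ltr0Sn _ 1)).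
  exists (\sum_(k < N) dot u (b k) *: b k); last first.
    have : d / 2 < d by rewrite ltr_pdivrMr// ltr_pMr// ltr1n.
    by apply: le_lt_trans; rewrite [leLHS](nrmB hd).
  exists (\sum_(k < N) (dot u (b k) * (t k)^-1%:C) *: b k) => /=.
  apply: (total_inj hd tb) => l; rewrite Sb !(form_suml hd) mulr_sumr.
  apply: eq_bigr => k _; rewrite !(formZl hd) ob.
  have [->|_] := eqVneq (k : nat) l; last by rewrite !mulr0.
  by rewrite !mulr1 mulrCA -rmorphM mulfV// rmorph1 mulr1.
exists V, W; split=> //; rewrite BE; apply/seteqP; split=> -[f h] /= E.
  by exists (W h); rewrite WV ?E.
by have [v Wf ->] := E; apply: (can_inj WV); rewrite Wf.
Qed.

End similarity.

(** * The space L2 *)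

Section L2_basics.
Variable R : realType.
Local Notation mu := (@lebesgue_measure R).
Local Notation I := (@unit_itv R).
Local Notation C := (R[i]).
Local Notation L2 := (L2 R).
Implicit Types (f g : R -> C) (u v : L2).

Definition ae_eq_unit f g := \forall t \ae mu, I t -> f t = g t.

(** Total, with value 0 when f is not square integrable, so that operators can be introduced by
    formulas on functions. *)
Definition L2mk f : L2 :=
  if pselect (f \in @csqint R) is left h then L2class (exist _ f h) else 0.

Lemma L2mkE f : square_integrable f -> ae_eq_unit (L2fun (L2mk f)) f.
Proof.
move=> /csqintP sf; rewrite /L2mk; case: pselect => // h.
exact: (L2funK (exist _ f h)).
Qed.

Lemma ae_eq_sym f g : ae_eq_unit f g -> ae_eq_unit g f.
Proof. by apply: filterS => t /[apply] ->. Qed.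

Lemma ae_eq_trans f g h : ae_eq_unit f g -> ae_eq_unit g h -> ae_eq_unit f h.
Proof. by apply: filterS2 => t fg gh It; rewrite fg// gh. Qed.

Lemma L2mk_ext f g : square_integrable f -> square_integrable g ->
  ae_eq_unit f g -> L2mk f = L2mk g.
Proof.
move=> sf sg fg; apply: L2P; apply: ae_eq_trans (L2mkE sf) _.
by apply: ae_eq_trans fg _; apply: ae_eq_sym; exact: L2mkE.
Qed.

Lemma L2funD u v : ae_eq_unit (L2fun (u + v)) (fun t => L2fun u t + L2fun v t).
Proof.
have := L2funP 1 u v; rewrite scale1r; apply: filterS => t /[apply] ->.
by rewrite mul1r.
Qed.

Lemma L2fun0 : ae_eq_unit (L2fun (0 : L2)) (fun=> 0).
Proof.
have := L2funP (-1) 0 (0 : L2); rewrite scaler0 addr0.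
by apply: filterS => t /[apply] ->; rewrite mulN1r addNr.
Qed.

Lemma L2funZ (c : C) u : ae_eq_unit (L2fun (c *: u)) (fun t => c * L2fun u t).
Proof.
have := L2funP c u 0; rewrite addr0.
by apply: filterS2 L2fun0 => t u0 /[swap] It ->//; rewrite u0// addr0.
Qed.

Lemma L2funB u v : ae_eq_unit (L2fun (u - v)) (fun t => L2fun u t - L2fun v t).
Proof.
have := L2funP (-1) v u; rewrite scaleN1r addrC.
by apply: filterS => t /[apply] ->; rewrite mulN1r addrC.
Qed.

Lemma L2dotE f g u v : square_integrable f -> square_integrable g ->
  ae_eq_unit (L2fun u) f -> ae_eq_unit (L2fun v) g ->
  L2dot u v = Cintegral (fun t => f t * conjc (g t)).
Proof.
move=> sf sg uf vg; apply: ae_eq_Cintegral.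
- exact: sqint_CintegrableM (L2fun_sqint _) (L2fun_sqint _).
- exact: sqint_CintegrableM.
- by apply: filterS2 uf vg => t uf vg It; rewrite uf// vg.
Qed.

Lemma sqf_L2 u : sqf (@L2dot R) u = (\int[mu]_(t in I) sqnorm (L2fun u t))%R.
Proof.
rewrite /sqf /L2dot /Cintegral /=; apply: eq_Rintegral => t _.
by rewrite mulJ_sqnorm.
Qed.

Lemma sqf_L2_ereal u :
  ((sqf (@L2dot R) u)%:E = \int[mu]_(t in I) (sqnorm (L2fun u t))%:E)%E.
Proof.
have [_ _ iu] := L2fun_sqint u.
rewrite sqf_L2 /Rintegral fineK//.
by apply: integrable_fin_num iu; exact: measurable_unit_itv.
Qed.

Lemma measurable_sqnorm f : measurable_fun I (Re \o f) ->
  measurable_fun I (Im \o f) -> measurable_fun I (fun t => sqnorm (f t)).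
Proof.
by move=> mR mI; apply: measurable_funD; exact: measurable_funX.
Qed.

Lemma square_integrableP f : measurable_fun I (Re \o f) ->
  measurable_fun I (Im \o f) ->
  (\int[mu]_(t in I) (sqnorm (f t))%:E < +oo)%E -> square_integrable f.
Proof.
move=> mR mI fin; split=> //; apply/integrableP; split.
  by apply/measurable_EFinP; exact: measurable_sqnorm.
under eq_integral do rewrite abse_EFin ger0_norm ?sqnorm_ge0//.
exact: fin.
Qed.

(** Linearity is asked only almost everywhere; the operator comes with its pointwise formula,
    through which it is handled afterwards. *)
Lemma lin_ae_op (F : L2 -> R -> C) :
  (forall u, square_integrable (F u)) ->
  (forall c u v, ae_eq_unit (F (c *: u + v)) (fun t => c * F u t + F v t)) ->
  {V : {linear L2 -> L2} | forall u, ae_eq_unit (L2fun (V u)) (F u)}.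
Proof.
move=> sF lF; pose V u := L2mk (F u).
have linV : linear V.
  move=> c u v; apply: L2P; apply: ae_eq_trans (L2mkE (sF _)) _.
  apply: ae_eq_trans (lF c u v) _; apply: ae_eq_sym.
  apply: filterS3 (L2funP c (V u) (V v)) (L2mkE (sF u)) (L2mkE (sF v)).
  by move=> t e1 e2 e3 It; rewrite e1// e2// e3.
exists (HB.pack_for {linear L2 -> L2} V (GRing.isLinear.Build _ _ _ _ V linV)).
by move=> u; exact: L2mkE.
Qed.

Lemma L2dot_form : hermitian_form (@L2dot R).
Proof. exact: dot_hermitian. Qed.

Lemma L2dot_definite : definite (@L2dot R).
Proof. exact: dot_definite. Qed.

Lemma cvgn_geometric_steps (x : nat -> R) (A : R) :
  (forall k, `|x k.+1 - x k| <= A * 2^-1 ^+ k) -> cvgn x.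
Proof.
move=> xA.
have cs : cvgn (series (fun k => x k.+1 - x k)).
  apply: normed_cvg; apply: (@series_le_cvg _ _ (geometric A 2^-1)).
  - by move=> n; exact: normr_ge0.
  - by move=> n; apply: le_trans (xA n).
  - exact: xA.
  - apply: is_cvg_geometric_series.
    by rewrite ger0_norm ?invr_ge0// invf_lt1// ltr1n.
suff -> : x = (fun n => series (fun k => x k.+1 - x k) n + x 0%N).
  by apply: is_cvgD => //; exact: is_cvg_cst.
apply/funext => n; rewrite seriesEnat /= telescope_sumr//.
by rewrite subrK.
Qed.

End L2_basics.

(** * Completeness of L2 *)

Section L2_complete.
Variable R : realType.
Local Notation mu := (@lebesgue_measure R).
Local Notation I := (@unit_itv R).
Local Notation C := (R[i]).
Local Notation L2 := (L2 R).

Lemma nneseries_half_lt (a : nat -> \bar R) :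
  (forall k, (0 <= a k <= (2^-1 ^+ k)%:E)%E) ->
  (\sum_(0 <= k <oo) a k < +oo)%E.
Proof.
move=> ak; apply: (@le_lt_trans _ _ 2%:E); last exact: ltry.
apply: lime_le; first by apply: is_cvg_nneseries => n _ _; have /andP[] := ak n.
apply: nearW => n; apply: (@le_trans _ _ (\sum_(0 <= k < n) (2^-1 ^+ k)%:E)%E).
  by apply: lee_sum => k _; have /andP[] := ak k.
rewrite sumEFin lee_fin big_mkord.
suff -> : \sum_(k < n) 2^-1 ^+ k = 2 - 2 * 2^-1 ^+ n :> R.
  by rewrite gerBl// mulr_ge0// exprn_ge0// invr_ge0.
elim: n => [|n IH]; first by rewrite big_ord0 expr0; lra.
by rewrite big_ord_recr /= IH exprS; lra.
Qed.

Lemma sqrt_sqnorm_le (z : C) (G : R) k : sqnorm z * 4 ^+ k <= G -> 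
  cmod z <= Num.sqrt G * 2^-1 ^+ k.
Proof.
move=> zG; have G0 : 0 <= G by rewrite (le_trans _ zG)// mulr_ge0 ?sqnorm_ge0// exprn_ge0.
have h0 : 0 <= Num.sqrt G * 2^-1 ^+ k :> R by rewrite mulr_ge0 ?sqrtr_ge0 ?exprn_ge0// invr_ge0.
rewrite -(ler_pXn2r (n := 2)) ?nnegrE ?cmod_ge0// cmod_sqr exprMn sqr_sqrtr//.
rewrite -exprM mulnC exprM (_ : 2^-1 ^+ 2 = 4^-1 :> R); last by field.
by rewrite exprVn ler_pdivlMr// exprn_gt0.
Qed.

(** The series of 4^k |v_{k+1} - v_k|^2 has integral at most the sum of the 4^k 16^-k, so its sum G
    is finite almost everywhere. There the k-th increment is at most sqrt(G) 2^-k. *)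
Lemma L2_fast_cauchy_pointwise (v : nat -> L2) :
  (forall k, nrm (@L2dot R) (v k.+1 - v k) <= 4^-1 ^+ k) ->
  \forall t \ae mu, I t -> cvgn (fun k => Re (L2fun (v k) t)) /\
                           cvgn (fun k => Im (L2fun (v k) t)).
Proof.
move=> vk; have mI := @measurable_unit_itv R.
pose g k (t : R) : \bar R := (4 ^+ k * sqnorm (L2fun (v k.+1 - v k) t))%:E.
have g0 k t : (0 <= g k t)%E.
  by rewrite lee_fin mulr_ge0 ?sqnorm_ge0// exprn_ge0.
have mg k : measurable_fun I (g k).
  apply/measurable_EFinP; apply: measurable_funM => //.
  have [mR mIm _] := L2fun_sqint (v k.+1 - v k).
  exact: measurable_sqnorm.
have ig k : (\int[mu]_(t in I) g k t)%E
    = (4 ^+ k * sqf (@L2dot R) (v k.+1 - v k))%:E.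
  rewrite EFinM sqf_L2_ereal -ge0_integralZl//.
  - by have [? ? _] := L2fun_sqint (v k.+1 - v k); apply/measurable_EFinP; exact: measurable_sqnorm.
  - by move=> t _; rewrite lee_fin sqnorm_ge0.
have Gfin : (\int[mu]_(t in I) \sum_(0 <= k <oo) g k t < +oo)%E.
  rewrite integral_nneseries//; apply: nneseries_half_lt => k.
  rewrite ig !lee_fin mulr_ge0 ?exprn_ge0 ?(sqf_ge0 (@L2dot_form R))//=.
  rewrite -(nrm_sqr (@L2dot_form R)).
  have : nrm (@L2dot R) (v k.+1 - v k) ^+ 2 <= (4^-1 ^+ k) ^+ 2.
    by rewrite ler_pXn2r ?nnegrE ?nrm_ge0 ?exprn_ge0 ?invr_ge0.
  move=> /(ler_wpM2l (exprn_ge0 k (ler0n R 4))) /le_trans; apply.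
  rewrite expr2 mulrA -exprMn mulfV// expr1n mul1r.
  by rewrite !exprVn lef_pV2 ?posrE ?exprn_gt0// lerXn2r// ?nnegrE// ler_nat.
have iG : mu.-integrable I (fun t => \sum_(0 <= k <oo) g k t)%E.
  apply/integrableP; split.
    exact: ge0_emeasurable_sum.
  under eq_integral do rewrite gee0_abs ?nneseries_ge0//.
  exact: Gfin.
have := integrable_ae mI iG.
have : \forall t \ae mu, forall k, I t ->
    L2fun (v k.+1 - v k) t = L2fun (v k.+1) t - L2fun (v k) t.
  by apply: ae_foralln => k; exact: L2funB.
apply: filterS2 => t vt /[swap] It /(_ It) Gt.
set G := (\sum_(0 <= k <oo) g k t)%E in Gt.
have step k : cmod (L2fun (v k.+1) t - L2fun (v k) t) <=
    Num.sqrt (fine G) * 2^-1 ^+ k.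
  apply: sqrt_sqnorm_le; rewrite -vt// -lee_fin fineK//.
  rewrite mulrC -/(g k t) /G (nneseries_split 0 k.+1)//.
  apply: (@le_trans _ _ (\sum_(0 <= i < 0 + k.+1) g i t)%E).
    by rewrite add0n big_nat_recr//= leeDr// sume_ge0.
  by rewrite leeDl// nneseries_ge0.
split; apply: cvgn_geometric_steps => k; apply: le_trans (step k).
  have := Re_le_cmod (L2fun (v k.+1) t - L2fun (v k) t).
  by rewrite ReD mulrN_Re.
have := Im_le_cmod (L2fun (v k.+1) t - L2fun (v k) t).
by rewrite ImD mulrN_Im.
Qed.

Lemma L2_complete : complete_form (@L2dot R).
Proof.
move=> u cu; have mI := @measurable_unit_itv R.
have hd := @L2dot_form R.
have e4 k : 0 < (4^-1 : R) ^+ k by rewrite exprn_gt0.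
have /choice[N NP] k := cu _ (e4 k).
(* The maximum puts both nk k and nk k.+1 beyond N k; the summand k makes nk k eventually exceed any
   bound. *)
pose nk k := (k + \max_(i < k.+1) N i)%N.
have Nnk k : (N k <= \max_(i < k.+1) N i)%N.
  exact: (leq_bigmax (ord_max : 'I_k.+1)).
have nkS k : (N k <= nk k.+1)%N.
  rewrite /nk big_ord_recr; apply: leq_trans (leq_addl k.+1 _).
  exact: leq_trans (Nnk k) (leq_maxl _ _).
have nkN k : (N k <= nk k)%N by exact: leq_trans (Nnk k) (leq_addl _ _).
pose v k := u (nk k).
have vk k : nrm (@L2dot R) (v k.+1 - v k) <= 4^-1 ^+ k by apply: NP.
have pw := L2_fast_cauchy_pointwise vk.
have mRv k : measurable_fun I (Re \o L2fun (v k)) by case: (L2fun_sqint (v k)).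
have mIv k : measurable_fun I (Im \o L2fun (v k)) by case: (L2fun_sqint (v k)).
(* The upper limit is defined and measurable everywhere, and is the limit wherever the latter
   exists. *)
pose f t : C := fine (limn_esup (fun k => (Re (L2fun (v k) t))%:E)) +i*
                fine (limn_esup (fun k => (Im (L2fun (v k) t))%:E)).
have mlim (h : nat -> R -> R) : (forall k, measurable_fun I (h k)) ->
    measurable_fun I (fun t => fine (limn_esup (fun k => (h k t)%:E))).
  move=> mh; apply: (measurable_comp measurableT) => //.
  by apply: measurable_fun_limn_esup => k; apply/measurable_EFinP; exact: mh.
have mRf : measurable_fun I (Re \o f) by exact: mlim.
have mIf : measurable_fun I (Im \o f) by exact: mlim.
have pwf : \forall t \ae mu, I t ->
    (Re (L2fun (v k) t) @[k --> \oo] --> Re (f t)) /\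
    (Im (L2fun (v k) t) @[k --> \oo] --> Im (f t)).
  have limE (x : nat -> R) : cvgn x ->
      x k @[k --> \oo] --> fine (limn_esup (fun k => (x k)%:E)).
    move=> cx; have : (x k)%:E @[k --> \oo] --> (limn x)%:E.
      by apply: cvg_EFin; [exact: nearW|exact: cx].
    by move=> /cvg_limn_einf_sup[_ ->].
  by apply: filterS pw => t /[apply] -[h1 h2]; split; exact: limE.
have mB m : measurable_fun I (Re \o (fun t => L2fun (u m) t - f t)) /\
    measurable_fun I (Im \o (fun t => L2fun (u m) t - f t)).
  have [mRu mIu _] := L2fun_sqint (u m); split.
    rewrite (_ : _ \o _ = (fun t => Re (L2fun (u m) t) - Re (f t))).
      exact: measurable_funB.
    by apply/funext => t /=; rewrite ReD mulrN_Re.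
  rewrite (_ : _ \o _ = (fun t => Im (L2fun (u m) t) - Im (f t))).
    exact: measurable_funB.
  by apply/funext => t /=; rewrite ImD mulrN_Im.
(* Fatou's lemma for |u_m - v_k|^2, shifted by k0 so that only late terms have to be bounded. It
   yields both the membership of f in L2 and the convergence. *)
have fatou_le m k0 (e : R) : 0 <= e ->
    (forall k, (k0 <= k)%N -> nrm (@L2dot R) (u m - v k) <= e) ->
    (\int[mu]_(t in I) (sqnorm (L2fun (u m) t - f t))%:E <= (e ^+ 2)%:E)%E.
  move=> e0 me.
  pose h k (t : R) := (sqnorm (L2fun (u m - v (k + k0)%N) t))%:E.
  have mh k : measurable_fun I (h k).
    have [mR mIm _] := L2fun_sqint (u m - v (k + k0)%N).
    by apply/measurable_EFinP; exact: measurable_sqnorm.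
  have h0 k t : I t -> (0 <= h k t)%E by rewrite lee_fin sqnorm_ge0.
  have := fatou mu mI mh h0.
  have <- : (\int[mu]_(t in I) (sqnorm (L2fun (u m) t - f t))%:E =
      \int[mu]_(t in I) limn_einf (h ^~ t))%E.
    apply: ae_eq_integral => //.
    - by have [? ?] := mB m; apply/measurable_EFinP; exact: measurable_sqnorm.
    - have -> : (fun t => limn_einf (h ^~ t)) =
          (fun t => - limn_esup (fun k => - h k t))%E.
        by apply/funext => t; rewrite (limn_esupN (h ^~ t)) oppeK.
      apply: measurableT_comp => //; apply: measurable_fun_limn_esup => k.
      exact: measurableT_comp.
    - have : \forall t \ae mu, forall k, I t ->
          L2fun (u m - v (k + k0)%N) t = L2fun (u m) t - L2fun (v (k + k0)%N) t.
        by apply: ae_foralln => k; exact: L2funB.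
      apply: filterS2 pwf => t pt ut It; have [cR cI] := pt It.
      suff /cvg_limn_einf_sup[-> _] : h k t @[k --> \oo] -->
        (sqnorm (L2fun (u m) t - f t))%:E by [].
      apply: cvg_EFin; first exact: nearW.
      have -> : fine \o (h ^~ t) = (fun k =>
          (Re (L2fun (u m) t) - Re (L2fun (v (k + k0)%N) t)) ^+ 2 +
          (Im (L2fun (u m) t) - Im (L2fun (v (k + k0)%N) t)) ^+ 2).
        by apply/funext => k; rewrite /= ut// /sqnorm ReD ImD mulrN_Re mulrN_Im.
      rewrite /sqnorm ReD ImD mulrN_Re mulrN_Im.
      have sh (x : nat -> R) (l : R) : x k @[k --> \oo] --> l ->
          x (k + k0)%N @[k --> \oo] --> l.
        by rewrite cvg_shiftn.
      have sq (c : R) (x : nat -> R) (l : R) : x k @[k --> \oo] --> l ->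
          (c - x (k + k0)%N) ^+ 2 @[k --> \oo] --> (c - l) ^+ 2.
        move=> xl; have cx : c - x (k + k0)%N @[k --> \oo] --> c - l.
          by apply: cvgB; [exact: cvg_cst|exact: (sh x l xl)].
        by rewrite expr2; under eq_fun do rewrite expr2; exact: cvgM.
      by apply: cvgD; [exact: (sq _ (fun k => Re (L2fun (v k) t)))
                      |exact: (sq _ (fun k => Im (L2fun (v k) t)))].
  move=> /le_trans; apply.
  rewrite limn_einf_lim; apply: lime_le; first exact: is_cvg_einfs.
  apply: nearW => k; apply: (@le_trans _ _ (\int[mu]_(x in I) h k x)%E).
    by apply: ereal_inf_lbound; exists k => /=.
  rewrite -sqf_L2_ereal lee_fin -(nrm_sqr hd) ler_pXn2r ?nnegrE ?nrm_ge0//.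
  by apply: me; rewrite leq_addl.
have uf e : 0 < e -> exists M, forall m, (M <= m)%N ->
    (\int[mu]_(t in I) (sqnorm (L2fun (u m) t - f t))%:E <= (e ^+ 2)%:E)%E.
  move=> e0; have [M MP] := cu _ e0; exists M => m Mm.
  apply: (fatou_le m M); first exact: ltW.
  by move=> k Mk; apply: MP => //; rewrite (leq_trans Mk)// leq_addr.
have sf : square_integrable f.
  have [M /(_ M (leqnn _)) fin] := uf 1 ltr01.
  have [mRB mIB] := mB M.
  have sB : square_integrable (fun t => L2fun (u M) t - f t).
    by apply: square_integrableP => //; apply: le_lt_trans fin _; exact: ltry.
  have -> : f = L2fun (u M) - (fun t => L2fun (u M) t - f t).
    by apply/funext => t; rewrite !fctE opprB addrC subrK.
  apply/csqintP; rewrite rpredB//; apply/csqintP => //.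
  exact: L2fun_sqint.
exists (L2mk f) => e e0; have [M MP] := uf _ e0; exists M => n Mn.
rewrite -(ler_pXn2r (n := 2)) ?nnegrE ?nrm_ge0 ?(ltW e0)// (nrm_sqr hd).
rewrite -lee_fin; apply: le_trans (MP _ Mn); rewrite sqf_L2_ereal.
rewrite le_eqVlt; apply/orP; left; apply/eqP; have [mRB mIB] := mB n.
apply: ae_eq_integral => //.
- by have [? ? _] := L2fun_sqint (u n - L2mk f); apply/measurable_EFinP; exact: measurable_sqnorm.
- by apply/measurable_EFinP; exact: measurable_sqnorm.
apply: filterS2 (L2funB (u n) (L2mk f)) (L2mkE sf) => t e1 e2 It.
by rewrite e1// e2.
Qed.

End L2_complete.

(** * Fubini's theorem on a triangle *)

Section triangle.
Variable R : realType.
Local Notation mu := (@lebesgue_measure R).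
Local Notation I := (@unit_itv R).
Local Notation mI := (@measurable_unit_itv R).

(** The kernel of the Volterra operator. *)
Definition lt1 (s t : R) : R := (s < t)%R%:R.

Lemma lt1_ge0 s t : 0 <= lt1 s t. Proof. by rewrite ler0n. Qed.

Lemma lt1_le1 s t : lt1 s t <= 1.
Proof. by rewrite /lt1; case: (s < t); rewrite ?ler01. Qed.

Lemma measurable_lt1 : measurable_fun setT
  (fun z : measurableTypeR R * measurableTypeR R => lt1 z.1 z.2).
Proof.
have mA : measurable [set z : measurableTypeR R * measurableTypeR R | z.1 < z.2].
  rewrite (_ : [set _ | _] = setT `&`
      (fun z : measurableTypeR R * measurableTypeR R => z.1 < z.2) @^-1` [set true]).
    by apply: measurable_fun_ltr.
  by rewrite setTI; apply/seteqP; split => z.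
rewrite (_ : (fun z => _) = \1_[set z : measurableTypeR R * measurableTypeR R | z.1 < z.2]).
  exact: measurable_indic.
apply/funext => z; rewrite /lt1 indicE; congr (nat_of_bool _)%:R.
by apply/idP/idP; rewrite inE.
Qed.

Lemma measurable_lt1l t : measurable_fun setT (fun s : measurableTypeR R => lt1 s t).
Proof.
exact: (measurableT_comp measurable_lt1 (measurable_pair2 (t : measurableTypeR R))).
Qed.

Lemma measurable_lt1r s : measurable_fun setT (fun t : measurableTypeR R => lt1 s t).
Proof.
exact: (measurableT_comp measurable_lt1 (measurable_pair1 (s : measurableTypeR R))).
Qed.

Lemma integrable_bounded_factor (p h : R -> R) (B : R) :
  mu.-integrable I (EFin \o p) -> measurable_fun I h ->
  (forall t, I t -> `|h t| <= B) -> mu.-integrable I (EFin \o (fun t => p t * h t)).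
Proof.
move=> ip mh hB.
apply: (le_integrable mI _ _ (integrableZl mI B ip)).
  apply/measurable_EFinP; apply: measurable_funM => //.
  by apply/measurable_EFinP; exact: (measurable_int mu).
move=> t It; rewrite /= lee_fin !normrM [leRHS]mulrC ler_wpM2l//.
by rewrite (le_trans (hB _ It))// ler_norm.
Qed.

Lemma norm_lt1 s t : `|lt1 s t| <= 1.
Proof. by rewrite ger0_norm ?lt1_ge0// lt1_le1. Qed.

(** The integrand is dominated by |p (s)| |q (t)|, which is integrable on the square; extending p
    and q by 0 moves everything to the product measure on the plane. *)
Lemma fubini_triangle (p q : R -> R) :
  mu.-integrable I (EFin \o p) -> mu.-integrable I (EFin \o q) ->
  (\int[mu]_(t in I) ((\int[mu]_(s in I) (p s * lt1 s t)) * q t) =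
   \int[mu]_(s in I) (p s * (\int[mu]_(t in I) (lt1 s t * q t))))%R.
Proof.
move=> ip iq.
pose P := p \_ I; pose Q := q \_ I.
have iP : mu.-integrable setT (EFin \o P).
  by have := (integrable_mkcond _ mI).1 ip; rewrite restrict_EFin.
have iQ : mu.-integrable setT (EFin \o Q).
  by have := (integrable_mkcond _ mI).1 iq; rewrite restrict_EFin.
have mP : measurable_fun setT P by apply/measurable_EFinP; exact: (measurable_int mu).
have mQ : measurable_fun setT Q by apply/measurable_EFinP; exact: (measurable_int mu).
pose F (z : measurableTypeR R * measurableTypeR R) : \bar R :=
  (P z.1 * lt1 z.1 z.2 * Q z.2)%:E.
have mF : measurable_fun setT F.
  apply/measurable_EFinP; apply: measurable_funM; last first.
    by apply: (measurableT_comp mQ); exact: measurable_snd.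
  apply: measurable_funM; last exact: measurable_lt1.
  by apply: (measurableT_comp mP); exact: measurable_fst.
have iPl t : mu.-integrable setT (EFin \o (fun s => P s * lt1 s t)).
  apply: (le_integrable measurableT _ _ iP).
    apply/measurable_EFinP; apply: measurable_funM => //; exact: measurable_lt1l.
  by move=> s _; rewrite /= lee_fin normrM ler_piMr//; exact: norm_lt1.
have iQl s : mu.-integrable setT (EFin \o (fun t => lt1 s t * Q t)).
  apply: (le_integrable measurableT _ _ iQ).
    apply/measurable_EFinP; apply: measurable_funM => //; exact: measurable_lt1r.
  by move=> t _; rewrite /= lee_fin normrM ler_piMl//; exact: norm_lt1.
pose qq := (\int[mu]_y `|(Q y)%:E|)%E.
have qq_fin : (qq < +oo)%E by have /integrableP[] := iQ.
have qq0 : (0 <= qq)%E by apply: integral_ge0.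
have iF : (mu \x mu)%E.-integrable setT F.
  apply/integrable12ltyP => //.
  apply: (@le_lt_trans _ _ (\int[mu]_x (`|(P x)%:E| * qq))%E).
    apply: ge0_le_integral => //.
    - by move=> x _; apply: integral_ge0.
    - apply: (measurable_fun_fubini_tonelli_F (abse \o F)).
        exact: measurableT_comp.
      by move=> z; exact: abse_ge0.
    - apply: emeasurable_funM => //; apply: measurableT_comp => //.
      exact/measurable_EFinP.
    - move=> x _; rewrite /qq -ge0_integralZl//; last first.
        by apply: measurableT_comp => //; exact/measurable_EFinP.
      apply: ge0_le_integral => //.
      + apply: measurableT_comp => //.
        exact: (measurableT_comp mF (measurable_pair1 (x : measurableTypeR R))).
      + apply: emeasurable_funM => //; apply: measurableT_comp => //.
        exact/measurable_EFinP.
      + move=> y _; rewrite /F /= -EFinM lee_fin !normrM -mulrA.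
        by rewrite ler_wpM2l// ler_piMl// norm_lt1.
  rewrite ge0_integralZr//; last first.
    by apply: measurableT_comp => //; exact/measurable_EFinP.
  rewrite lte_mul_pinfty// ?integral_ge0// ge0_fin_numE ?integral_ge0//.
  by have /integrableP[] := iP.
have restr (h : R -> R) (k : R -> R) : (\int[mu]_x (h x * (k \_ I) x)%:E =
    \int[mu]_(x in I) (h x * k x)%:E)%E.
  rewrite [RHS]integral_mkcond; apply: eq_integral => x _.
  by rewrite !patchE; case: ifP => // _; rewrite mulr0.
have inner1 s : (\int[mu]_t F (s, t) =
    (P s * (\int[mu]_(t in I) (lt1 s t * q t))%R)%:E)%E.
  rewrite EFinM /Rintegral fineK; last first.
    by rewrite -restr; exact: integrable_fin_num (iQl s).
  rewrite -restr -integralZl//; last exact: iQl.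
  by apply: eq_integral => t _; rewrite /F /= -EFinM mulrA.
have inner2 t : (\int[mu]_s F (s, t) =
    ((\int[mu]_(s in I) (p s * lt1 s t))%R * Q t)%:E)%E.
  have restr' : (\int[mu]_s (P s * lt1 s t)%:E =
      \int[mu]_(s in I) (p s * lt1 s t)%:E)%E.
    under eq_integral do rewrite mulrC.
    by rewrite restr; apply: eq_integral => s _; rewrite mulrC.
  rewrite mulrC EFinM /Rintegral fineK; last first.
    by rewrite -restr'; exact: integrable_fin_num (iPl t).
  rewrite -restr' -integralZl//; last exact: iPl.
  by apply: eq_integral => s _; rewrite /F /= -EFinM mulrC.
have := Fubini iF.
under eq_integral do rewrite inner1.
under [in RHS]eq_integral do rewrite inner2.
move=> H; rewrite /Rintegral; congr fine.
rewrite -[LHS]restr -/Q -H.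
under eq_integral do rewrite mulrC.
by rewrite restr; apply: eq_integral => s _; rewrite mulrC.
Qed.

End triangle.

(** * The Volterra operator and its adjoint *)

Section primitive.
Variable R : realType.
Local Notation mu := (@lebesgue_measure R).
Local Notation I := (@unit_itv R).
Local Notation C := (R[i]).
Local Notation L2 := (L2 R).
Implicit Types (u v : L2) (f g : R -> C).
Let hd := @L2dot_form R.
Local Hint Resolve measurable_unit_itv : core.

Lemma unit_itv_measure : mu I = 1%E.
Proof. by rewrite /unit_itv lebesgue_measure_itv/= lte_fin ltr01 sube0. Qed.

Lemma integral_cst_unit (r : R) : (\int[mu]_(t in I) cst r%:E t = r%:E)%E.
Proof.
rewrite integral_cst// -[RHS]mule1; congr (_ * _)%E; exact: unit_itv_measure.
Qed.

Lemma sqint_bounded f (B : R) : measurable_fun I (Re \o f) ->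
  measurable_fun I (Im \o f) -> (forall t, I t -> sqnorm (f t) <= B) ->
  square_integrable f.
Proof.
move=> mR mIm fB; apply: square_integrableP => //.
apply: (@le_lt_trans _ _ (\int[mu]_(t in I) (cst B%:E t))%E).
  apply: ge0_le_integral => //.
  - by move=> t _; rewrite lee_fin sqnorm_ge0.
  - by apply/measurable_EFinP; exact: measurable_sqnorm.
by rewrite integral_cst_unit ltry.
Qed.

Lemma sqint_cst (c : C) : square_integrable (fun=> c).
Proof. by apply: (@sqint_bounded _ (sqnorm c)) => //; exact: measurable_cst. Qed.

Definition one : L2 := L2mk (fun=> 1).

Lemma oneE : ae_eq_unit (L2fun one) (fun=> 1).
Proof. exact/L2mkE/sqint_cst. Qed.

Definition indf (x : R) : R -> C := fun s => (lt1 s x)%:C.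
Definition ind x : L2 := L2mk (indf x).

Lemma sqint_indf x : square_integrable (indf x).
Proof.
apply: (@sqint_bounded _ 1).
- apply: measurable_funTS; exact: measurable_lt1l.
- exact: measurable_cst.
- by move=> t _; rewrite sqnorm_real expr_le1// ?lt1_ge0 ?lt1_le1.
Qed.

Lemma indE x : ae_eq_unit (L2fun (ind x)) (indf x).
Proof. exact/L2mkE/sqint_indf. Qed.

Lemma ind_ge1 x : 1 <= x -> ind x = one.
Proof.
move=> x1; apply: L2mk_ext; [exact: sqint_indf|exact: sqint_cst|].
apply: aeW => t; rewrite /unit_itv/= in_itv/= => /andP[_ t1].
by rewrite /indf /lt1 (lt_le_trans t1 x1).
Qed.

Lemma ind_le0 x : x <= 0 -> ind x = 0.
Proof.
move=> x0; apply: L2P; apply: ae_eq_trans (indE x) _; apply: ae_eq_sym.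
apply: filterS (L2fun0 R) => t /[swap] It -> //; move: It.
rewrite /unit_itv/= in_itv/= => /andP[t0 _]; rewrite /indf /lt1 ltNge.
by rewrite (le_trans x0)// ltW.
Qed.

Lemma sqf_indB x y : sqf (@L2dot R) (ind x - ind y) <= `|x - y|.
Proof.
wlog yx : x y / y <= x.
  move=> H; have [/H//|/ltW/H] := leP y x.
  by rewrite distrC -(sqfN hd) opprB.
rewrite -lee_fin sqf_L2_ereal.
have -> : (\int[mu]_(t in I) (sqnorm (L2fun (ind x - ind y) t))%:E =
    \int[mu]_(t in I) (\1_(`[y, x[%classic : set R) t)%:E)%E.
  apply: ae_eq_integral => //.
  - have [mR mIm _] := L2fun_sqint (ind x - ind y).
    by apply/measurable_EFinP; exact: measurable_sqnorm.
  - by apply/measurable_EFinP; apply: measurable_indic; exact: measurable_itv.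
  - apply: filterS3 (L2funB (ind x) (ind y)) (indE x) (indE y) => t e1 e2 e3 It.
    rewrite e1// e2// e3// /indf -rmorphB sqnorm_real; congr (_%:E).
    rewrite indicE /lt1 mem_setE in_itv/=.
    have [yt|ty] := leP y t; have [tx|xt] := ltP t x => /=; rewrite ?subr0 ?expr1n//.
    + by rewrite expr0n.
    + by rewrite subrr expr0n.
    + by have := le_lt_trans (le_trans yx xt) ty; rewrite ltxx.
rewrite integral_indic//.
apply: (@le_trans _ _ (mu `[y, x[%classic)).
  apply: le_measure; rewrite ?inE; [|exact: measurable_itv|exact: subIsetl].
  by apply: measurableI => //; exact: measurable_itv.
rewrite lebesgue_measure_itv/= lte_fin; case: ifPn => _; last by rewrite lee_fin.
by rewrite -EFinB lee_fin ler_norm.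
Qed.

(** The primitive of u vanishing at 0, defined on the whole line and constant outside ]0, 1[. As an
    inner product it inherits its Hölder estimate from the Cauchy-Schwarz inequality. *)
Definition prim u x : C := L2dot u (ind x).

Lemma prim_lin (c : C) u v x : prim (c *: u + v) x = c * prim u x + prim v x.
Proof. by rewrite /prim formDl// formZl. Qed.

Lemma prim_ge1 u x : 1 <= x -> prim u x = L2dot u one.
Proof. by move=> x1; rewrite /prim ind_ge1. Qed.

Lemma prim_le0 u x : x <= 0 -> prim u x = 0.
Proof. by move=> x0; rewrite /prim ind_le0// form0r. Qed.

Lemma prim_holder u x y :
  cmod (prim u x - prim u y) <= nrm (@L2dot R) u * Num.sqrt `|x - y|.
Proof.
rewrite /prim -formBr// (le_trans (cauchy_schwarz hd _ _))//.
by rewrite ler_wpM2l ?nrm_ge0// ler_wsqrtr// sqf_indB.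
Qed.

Lemma cmod_prim_le u x : cmod (prim u x) <= nrm (@L2dot R) u.
Proof.
have [x0|x0] := leP x 0; first by rewrite prim_le0// cmod0 nrm_ge0.
wlog x1 : x x0 / x <= 1.
  move=> H; have [/(H _ x0)//|x1] := leP x 1.
  by rewrite prim_ge1 ?(ltW x1)// -(prim_ge1 u (lexx 1)); apply: H.
have := prim_holder u x 0; rewrite (prim_le0 u (lexx 0)) !subr0 => /le_trans; apply.
rewrite ler_piMr ?nrm_ge0// ger0_norm ?(ltW x0)// -[leRHS]sqrtr1.
exact: ler_wsqrtr.
Qed.

Lemma holder_continuous (h : R -> R) (A : R) :
  (forall x y, `|h x - h y| <= A * Num.sqrt `|x - y|) -> continuous h.
Proof.
move=> hA x; apply/cvgrPdist_le => /= e e0.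
have A0 : 0 <= A.
  by have := hA 1 0; rewrite subr0 normr1 sqrtr1 mulr1; apply: le_trans.
have A1 : 0 < A + 1 by rewrite ltr_wpDl.
have d0 : 0 < (e / (A + 1)) ^+ 2 by rewrite exprn_gt0// divr_gt0.
near=> t; rewrite (le_trans (hA _ _))//.
apply: (@le_trans _ _ (A * (e / (A + 1)))); last first.
  by rewrite mulrCA ler_piMr ?(ltW e0)// ler_pdivrMr// mul1r lerDl.
rewrite ler_wpM2l//.
have -> : e / (A + 1) = Num.sqrt ((e / (A + 1)) ^+ 2).
  by rewrite sqrtr_sqr ger0_norm// divr_ge0 ?ltW.
apply: ler_wsqrtr; near: t; apply/nbhs_ballP.
by exists ((e / (A + 1)) ^+ 2) => //= t; rewrite /ball/= => /ltW.
Unshelve. all: by end_near. Qed.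

Lemma continuous_Re_prim u : continuous (fun x => Re (prim u x)).
Proof.
apply: (@holder_continuous _ (nrm (@L2dot R) u)) => x y.
by rewrite -mulrN_Re -ReD (le_trans (Re_le_cmod _))// prim_holder.
Qed.

Lemma continuous_Im_prim u : continuous (fun x => Im (prim u x)).
Proof.
apply: (@holder_continuous _ (nrm (@L2dot R) u)) => x y.
by rewrite -mulrN_Im -ImD (le_trans (Im_le_cmod _))// prim_holder.
Qed.

Lemma sqint_prim u : square_integrable (prim u).
Proof.
apply: (@sqint_bounded _ (nrm (@L2dot R) u ^+ 2)).
- by apply: measurable_funTS; apply: continuous_measurable_fun; exact: continuous_Re_prim.
- by apply: measurable_funTS; apply: continuous_measurable_fun; exact: continuous_Im_prim.
- by move=> t _; rewrite -cmod_sqr ler_pXn2r ?nnegrE ?cmod_ge0 ?nrm_ge0// cmod_prim_le.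
Qed.

Lemma ae_eq_unitW f g : (forall t, f t = g t) -> ae_eq_unit f g.
Proof. by move=> fg; apply: aeW => t _. Qed.

Definition Vop : {linear L2 -> L2} := sval (lin_ae_op sqint_prim
  (fun c u v => ae_eq_unitW (prim_lin c u v))).

Lemma VopE u : ae_eq_unit (L2fun (Vop u)) (prim u).
Proof. exact: (svalP (lin_ae_op _ _)). Qed.

(** For x in [0, 1] this is the integral of u from x to 1. *)
Definition coprim u x : C := L2dot u one - prim u x.

Lemma sqint_lin (c : C) f g : square_integrable f -> square_integrable g ->
  square_integrable (fun t => c * f t + g t).
Proof.
move=> /csqintP sf /csqintP sg; apply/csqintP.
exact: (rpredD (rpredZ c sf) sg).
Qed.

Lemma sqint_coprim u : square_integrable (coprim u).
Proof.
have -> : coprim u = (fun t => -1 * prim u t + L2dot u one).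
  by apply/funext => t; rewrite mulN1r addrC.
exact: sqint_lin (sqint_prim u) (sqint_cst _).
Qed.

Lemma coprim_lin (c : C) u v x :
  coprim (c *: u + v) x = c * coprim u x + coprim v x.
Proof.
rewrite /coprim prim_lin formDl// formZl// mulrBr opprD.
by rewrite addrACA.
Qed.

Definition Vadj : {linear L2 -> L2} := sval (lin_ae_op sqint_coprim
  (fun c u v => ae_eq_unitW (coprim_lin c u v))).

Lemma VadjE u : ae_eq_unit (L2fun (Vadj u)) (coprim u).
Proof. exact: (svalP (lin_ae_op _ _)). Qed.

Lemma Vadj_Vop u : Vadj u = L2dot u one *: one - Vop u.
Proof.
apply: L2P; apply: ae_eq_trans (VadjE u) _; apply: ae_eq_sym.
apply: ae_eq_trans (L2funB _ _) _.
apply: filterS3 (L2funZ (L2dot u one) one) oneE (VopE u) => t e1 e2 e3 It.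
by rewrite e1// e2// e3// mulr1.
Qed.

Lemma nrm_le_sup u f (B : R) : 0 <= B -> ae_eq_unit (L2fun u) f ->
  (forall t, I t -> cmod (f t) <= B) -> nrm (@L2dot R) u <= B.
Proof.
move=> B0 uf fB; rewrite -(ler_pXn2r (n := 2)) ?nnegrE ?nrm_ge0// nrm_sqr//.
rewrite -lee_fin sqf_L2_ereal.
apply: (@le_trans _ _ (\int[mu]_(t in I) (cst (B ^+ 2)%:E t))%E); last first.
  by rewrite integral_cst_unit.
have [mR mIm _] := L2fun_sqint u.
apply: ae_ge0_le_integral => //.
- by move=> t _; rewrite lee_fin sqnorm_ge0.
- by apply/measurable_EFinP; exact: measurable_sqnorm.
- by move=> t _ /=; rewrite lee_fin sqr_ge0.
- apply: filterS uf => t /[swap] It -> //.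
  by rewrite /= lee_fin -cmod_sqr ler_pXn2r ?nnegrE ?cmod_ge0// fB.
Qed.

Lemma nrm_Vop u : nrm (@L2dot R) (Vop u) <= nrm (@L2dot R) u.
Proof.
by apply: (nrm_le_sup _ (VopE u)); [exact: nrm_ge0|move=> t _; exact: cmod_prim_le].
Qed.

Lemma Re_prim u x : Re (prim u x) = (\int[mu]_(s in I) (Re (L2fun u s) * lt1 s x))%R.
Proof.
rewrite /prim (L2dotE (L2fun_sqint u) (sqint_indf x) _ (indE x)); last exact: aeW.
by apply: eq_Rintegral => s _; rewrite conjc_real ReM /= mulr0 subr0.
Qed.

Lemma Im_prim u x : Im (prim u x) = (\int[mu]_(s in I) (Im (L2fun u s) * lt1 s x))%R.
Proof.
rewrite /prim (L2dotE (L2fun_sqint u) (sqint_indf x) _ (indE x)); last exact: aeW.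
by apply: eq_Rintegral => s _; rewrite conjc_real ImM /= mulr0 add0r.
Qed.

Lemma sqint_integrable f : square_integrable f ->
  mu.-integrable I (EFin \o (fun t => Re (f t))) /\
  mu.-integrable I (EFin \o (fun t => Im (f t))).
Proof.
move=> sf; have [] := sqint_CintegrableM sf (sqint_cst 1).
by under eq_fun do rewrite conjc1 mulr1; under [in X in _ -> X]eq_fun do rewrite conjc1 mulr1.
Qed.

End primitive.

Arguments one {R}.
Arguments Vop {R}.
Arguments Vadj {R}.

(** * Change of variables under a dilation of the line *)

Section scaling.
Variable R : realType.
Local Notation mu := (@lebesgue_measure R).
Variable c : R.
Hypothesis c0 : 0 < c.

Let phi (x : measurableTypeR R) : measurableTypeR R := c * x.

Lemma measurable_scale : measurable_fun setT phi.
Proof. exact: measurable_funM. Qed.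

Let image_mu : {measure set (measurableTypeR R) -> \bar R} :=
  measure_function_pushforward__canonical__measure_function_Measure mu measurable_scale.

Let nu := mscale (NngNum (ltW c0)) image_mu.

(** The rescaled image measure agrees with Lebesgue measure on half-open intervals, hence everywhere
    by uniqueness. *)
Lemma lebesgue_measure_scale A : measurable A ->
  (mu A = c%:E * mu (phi @^-1` A))%E.
Proof.
move=> mA; rewrite (lebesgue_measure_unique (mu := nu))//.
move=> _ [[a b] _ <-].
transitivity (c%:E * mu (phi @^-1` `]a, b]%classic))%E; last by [].
have -> : phi @^-1` `]a, b]%classic = `]a / c, b / c]%classic.
  apply/seteqP; split => x /=; rewrite !in_itv/= /phi;
    by rewrite ltr_pdivrMr// ler_pdivlMr// mulrC.
rewrite !lebesgue_measure_itv/= !lte_fin ltr_pM2r ?invr_gt0//.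
case: ifPn => _; last by rewrite mule0.
by rewrite -!EFinB -EFinM -mulrBl mulrCA mulfV ?gt_eqF// mulr1.
Qed.

Lemma negligible_scale (P : R -> Prop) :
  (\forall t \ae mu, P t) -> \forall t \ae mu, P (c * t).
Proof.
move=> [A [mA A0 PA]]; exists (phi @^-1` A); split.
- by rewrite -[X in measurable X]setTI; exact: measurable_scale.
- have := lebesgue_measure_scale mA; rewrite A0 => /esym/eqP.
  by rewrite mule_eq0 eqe gt_eqF//= => /eqP.
- by move=> t /= Pt; apply: PA.
Qed.

Lemma ge0_integral_scale (f : R -> \bar R) : measurable_fun setT f ->
  (forall x, 0 <= f x)%E ->
  (\int[mu]_x f x = c%:E * \int[mu]_x f (c * x)%R)%E.
Proof.
move=> mf f0.
transitivity (\int[nu]_x f x)%E.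
  apply: eq_measure_integral => A mA _.
  first [exact: (lebesgue_measure_scale mA)|exact: (esym (lebesgue_measure_scale mA))].
rewrite ge0_integral_mscale//; congr (_ * _)%E.
rewrite [LHS](ge0_integral_pushforward measurable_scale)//.
Qed.

Lemma integrable_scale_integral (f : R -> R) :
  mu.-integrable setT (EFin \o f) ->
  (\int[mu]_x f x = c * \int[mu]_x f (c * x))%R.
Proof.
move=> intf; have mf : measurable_fun setT (EFin \o f) by exact: (measurable_int mu).
have mfp := measurable_funepos mf; have mfn := measurable_funeneg mf.
have Hp := ge0_integral_scale mfp (fun=> funepos_ge0 _ _).
have Hn := ge0_integral_scale mfn (fun=> funeneg_ge0 _ _).
have fp : (\int[mu]_x (EFin \o f)^\+ x \is a fin_num)%E.
  exact/integrable_fin_num/integrable_funepos.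
have fn : (\int[mu]_x (EFin \o f)^\- x \is a fin_num)%E.
  exact/integrable_fin_num/integrable_funeneg.
have fin_c (y : \bar R) : (0 <= y)%E -> (c%:E * y \is a fin_num)%E -> (y \is a fin_num)%E.
  by case: y => [y|_|]//; rewrite gt0_muley ?lte_fin.
rewrite Hp in fp; rewrite Hn in fn.
have fp' : (\int[mu]_x (EFin \o f)^\+ (c * x)%R)%E \is a fin_num.
  by apply: fin_c fp; apply: integral_ge0 => x _.
have fn' : (\int[mu]_x (EFin \o f)^\- (c * x)%R)%E \is a fin_num.
  by apply: fin_c fn; apply: integral_ge0 => x _.
rewrite /Rintegral [in LHS]integralE Hp Hn -muleBr//; last first.
  by first [exact: fin_num_adde_defr|exact: fin_num_adde_defl].
rewrite fineM//; last by rewrite fin_numB fp' fn'.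
congr (_ * fine _); rewrite [RHS]integralE.
by congr (_ - _)%E; apply: eq_integral => x _; rewrite ?funeposE ?funenegE.
Qed.

End scaling.

Section volterra_adjoint.
Variable R : realType.
Local Notation mu := (@lebesgue_measure R).
Local Notation I := (@unit_itv R).
Local Notation C := (R[i]).
Local Notation L2 := (L2 R).
Local Hint Resolve measurable_unit_itv : core.
Implicit Types (u v : L2).
Let hd := @L2dot_form R.

(** The two sides differ only at s = x. *)
Lemma lt1_flip_ae (x : R) : \forall s \ae (@lebesgue_measure R), 1 - lt1 s x = lt1 x s.
Proof.
exists [set x]; split; [exact: measurable_set1|exact: lebesgue_measure_set1|].
move=> s /= sx; apply/eqP; apply: contra_notT sx; rewrite /lt1.
by case: ltgtP => // _ _; rewrite ?subrr ?subr0.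
Qed.

Lemma Re_coprim v x :
  Re (coprim v x) = (\int[mu]_(s in I) (lt1 x s * Re (L2fun v s)))%R.
Proof.
have [iR _] := sqint_integrable (L2fun_sqint v).
have mRe : measurable_fun I (fun s => Re (L2fun v s)).
  by have [] := L2fun_sqint v.
have ml y : measurable_fun I (fun s => lt1 s y).
  apply: measurable_funTS; exact: measurable_lt1l.
have mr y : measurable_fun I (fun s => lt1 y s).
  apply: measurable_funTS; exact: measurable_lt1r.
have ib y : mu.-integrable I (EFin \o (fun s => Re (L2fun v s) * lt1 s y)).
  by apply: (integrable_bounded_factor (B := 1) iR) => // t _; exact: norm_lt1.
rewrite /coprim ReD mulrN_Re -(prim_ge1 v (lexx 1)) !Re_prim -RintegralB//.
congr fine; apply: ae_eq_integral => //.
- apply/measurable_EFinP; apply: measurable_funB; apply: measurable_funM => //.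
- by apply/measurable_EFinP; exact: measurable_funM.
- move: (lt1_flip_ae x); apply: filterS; first exact: (ae_filter_ringOfSetsType mu).
  move=> s sx Is; congr (_%:E).
  rewrite -mulrBr -sx mulrC; congr ((_ - _) * _).
  by move: Is; rewrite /unit_itv/= in_itv/= => /andP[_ s1]; rewrite /lt1 s1.
Qed.

Lemma Im_coprim v x :
  Im (coprim v x) = (\int[mu]_(s in I) (lt1 x s * Im (L2fun v s)))%R.
Proof.
have [_ iR] := sqint_integrable (L2fun_sqint v).
have mRe : measurable_fun I (fun s => Im (L2fun v s)).
  by have [] := L2fun_sqint v.
have ml y : measurable_fun I (fun s => lt1 s y).
  apply: measurable_funTS; exact: measurable_lt1l.
have mr y : measurable_fun I (fun s => lt1 y s).
  apply: measurable_funTS; exact: measurable_lt1r.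
have ib y : mu.-integrable I (EFin \o (fun s => Im (L2fun v s) * lt1 s y)).
  by apply: (integrable_bounded_factor (B := 1) iR) => // t _; exact: norm_lt1.
rewrite /coprim ImD mulrN_Im -(prim_ge1 v (lexx 1)) !Im_prim -RintegralB//.
congr fine; apply: ae_eq_integral => //.
- apply/measurable_EFinP; apply: measurable_funB; apply: measurable_funM => //.
- by apply/measurable_EFinP; exact: measurable_funM.
- move: (lt1_flip_ae x); apply: filterS; first exact: (ae_filter_ringOfSetsType mu).
  move=> s sx Is; congr (_%:E).
  rewrite -mulrBr -sx mulrC; congr ((_ - _) * _).
  by move: Is; rewrite /unit_itv/= in_itv/= => /andP[_ s1]; rewrite /lt1 s1.
Qed.

(** [fubini_triangle], once for each of the four products of real and imaginary parts. *)
Lemma Vop_adjoint u v : L2dot (Vop u) v = L2dot u (Vadj v).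
Proof.
have [iuR iuI] := sqint_integrable (L2fun_sqint u).
have [ivR ivI] := sqint_integrable (L2fun_sqint v).
have [muR muI _] := L2fun_sqint u; have [mvR mvI _] := L2fun_sqint v.
have [mpR mpI _] := sqint_prim u; have [mcR mcI _] := sqint_coprim v.
have bp x : cmod (prim u x) <= nrm (@L2dot R) u by exact: cmod_prim_le.
have bc x : cmod (coprim v x) <= nrm (@L2dot R) v + nrm (@L2dot R) v.
  rewrite /coprim -(prim_ge1 v (lexx 1)).
  by rewrite (le_trans (cmodD _ _))// cmodN lerD ?cmod_prim_le.
have ip (p h : R -> R) B : mu.-integrable I (EFin \o p) -> measurable_fun I h ->
    (forall t, `|h t| <= B) -> mu.-integrable I (EFin \o (fun t => h t * p t)).
  move=> ip mh hB; under eq_fun do rewrite /= mulrC.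
  by apply: (integrable_bounded_factor (B := B) ip).
have ip' (p h : R -> R) B : mu.-integrable I (EFin \o p) -> measurable_fun I h ->
    (forall t, `|h t| <= B) -> mu.-integrable I (EFin \o (fun t => p t * h t)).
  by move=> ip1 mh hB; apply: (integrable_bounded_factor (B := B) ip1).
have bpR x : `|Re (prim u x)| <= nrm (@L2dot R) u := le_trans (Re_le_cmod _) (bp x).
have bpI x : `|Im (prim u x)| <= nrm (@L2dot R) u := le_trans (Im_le_cmod _) (bp x).
have bcR x := le_trans (Re_le_cmod _) (bc x).
have bcI x := le_trans (Im_le_cmod _) (bc x).
have FR q : mu.-integrable I (EFin \o q) ->
    (\int[mu]_(t in I) (Re (prim u t) * q t) =
     \int[mu]_(s in I) (Re (L2fun u s) * (\int[mu]_(t in I) (lt1 s t * q t))))%R.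
  move=> iq; rewrite -(fubini_triangle iuR iq).
  by apply: eq_Rintegral => t _; rewrite Re_prim.
have FI q : mu.-integrable I (EFin \o q) ->
    (\int[mu]_(t in I) (Im (prim u t) * q t) =
     \int[mu]_(s in I) (Im (L2fun u s) * (\int[mu]_(t in I) (lt1 s t * q t))))%R.
  move=> iq; rewrite -(fubini_triangle iuI iq).
  by apply: eq_Rintegral => t _; rewrite Im_prim.
rewrite (L2dotE (sqint_prim u) (L2fun_sqint v) (VopE u) (ae_eq_unitW (fun=> erefl))).
rewrite (L2dotE (L2fun_sqint u) (sqint_coprim v) (ae_eq_unitW (fun=> erefl)) (VadjE v)).
rewrite /Cintegral; congr (_ +i* _).
  transitivity (\int[mu]_(t in I) (Re (prim u t) * Re (L2fun v t) +
                                  Im (prim u t) * Im (L2fun v t)))%R.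
    by apply: eq_Rintegral => t _; rewrite ReM ReJ ImJ mulrN opprK.
  transitivity (\int[mu]_(t in I) (Re (L2fun u t) * Re (coprim v t) +
                                  Im (L2fun u t) * Im (coprim v t)))%R; last first.
    by apply: eq_Rintegral => t _; rewrite ReM ReJ ImJ mulrN opprK.
  rewrite (RintegralD _ (ip _ _ _ ivR mpR bpR) (ip _ _ _ ivI mpI bpI))//.
  rewrite (RintegralD _ (ip' _ _ _ iuR mcR bcR) (ip' _ _ _ iuI mcI bcI))//.
  rewrite (FR _ ivR) (FI _ ivI).
  by congr (_ + _); apply: eq_Rintegral => t _; congr (_ * _);
    [exact: (esym (Re_coprim v t))|exact: (esym (Im_coprim v t))].
transitivity (\int[mu]_(t in I) (Im (prim u t) * Re (L2fun v t) -
                                Re (prim u t) * Im (L2fun v t)))%R.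
  by apply: eq_Rintegral => t _; rewrite ImM ReJ ImJ mulrN addrC.
transitivity (\int[mu]_(t in I) (Im (L2fun u t) * Re (coprim v t) -
                                Re (L2fun u t) * Im (coprim v t)))%R; last first.
  by apply: eq_Rintegral => t _; rewrite ImM ReJ ImJ mulrN addrC.
rewrite (RintegralB _ (ip _ _ _ ivR mpI bpI) (ip _ _ _ ivI mpR bpR))//.
rewrite (RintegralB _ (ip' _ _ _ iuI mcR bcR) (ip' _ _ _ iuR mcI bcI))//.
rewrite (FI _ ivR) (FR _ ivI).
by congr (_ - _); apply: eq_Rintegral => t _; congr (_ * _);
    [exact: (esym (Re_coprim v t))|exact: (esym (Im_coprim v t))].
Qed.

Lemma Rintegral_lt1 (x : R) : 0 <= x <= 1 -> (\int[mu]_(t in I) lt1 t x)%R = x.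
Proof.
move=> /andP[x0 x1]; rewrite /Rintegral.
transitivity (fine (\int[mu]_(t in I) (\1_(`]0, x[%classic : set R) t)%:E)).
  congr fine; apply: eq_integral => t; rewrite inE /unit_itv/= in_itv/= => /andP[t0 t1].
  by rewrite indicE mem_setE in_itv/= t0.
rewrite integral_indic// setIidl; last first.
  by move=> t; rewrite /unit_itv/= !in_itv/= => /andP[-> /lt_le_trans]; exact.
suff E : mu `]0, x[%classic = x%:E by exact: (congr1 fine E).
rewrite lebesgue_measure_itv/= lte_fin; case: ifPn => [_|]; first by rewrite sube0.
by rewrite -leNgt => x0'; congr EFin; apply/eqP; rewrite eq_le x0 x0'.
Qed.

Lemma prim_ind (x y : R) : 0 <= x <= 1 -> 0 <= y <= 1 ->
  prim (ind x) y = (Num.min x y)%:C.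
Proof.
move=> x01 y01.
rewrite /prim (L2dotE (sqint_indf x) (sqint_indf y) (indE x) (indE y)).
have E t : indf x t * conjc (indf y t) = (lt1 t (Num.min x y))%:C.
  by rewrite /indf conjc_real -rmorphM /lt1 lt_min /=; case: (t < x); case: (t < y);
    rewrite ?mul1r ?mul0r.
rewrite (funext E) /Cintegral; congr (_ +i* _).
  by apply: Rintegral_lt1; move: x01 y01; case: (leP x y).
by rewrite Rintegral_cst// mul0r.
Qed.

Lemma prim_one (y : R) : 0 <= y <= 1 -> prim one y = y%:C.
Proof.
move=> y01; rewrite -(ind_ge1 (lexx 1)) prim_ind ?ler01 ?lexx//.
by case/andP: y01 => _ y1; rewrite minEle leNgt; case: ltgtP y1 => // ->.
Qed.

End volterra_adjoint.

(** * Dilations *)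

Section dilation.
Variable R : realType.
Local Notation mu := (@lebesgue_measure R).
Local Notation I := (@unit_itv R).
Local Notation C := (R[i]).
Local Notation L2 := (L2 R).
Local Hint Resolve measurable_unit_itv : core.
Implicit Types (u v : L2) (f g : R -> C).
Let hd := @L2dot_form R.

Lemma sqint_le f g : measurable_fun I (Re \o f) -> measurable_fun I (Im \o f) ->
  square_integrable g -> (forall t, I t -> sqnorm (f t) <= sqnorm (g t)) ->
  square_integrable f.
Proof.
move=> mR mIm [mgR mgI /integrableP[_ ig]] fg; apply: square_integrableP => //.
apply: le_lt_trans ig; apply: ge0_le_integral => //.
- by move=> t _; rewrite lee_fin sqnorm_ge0.
- by apply/measurable_EFinP; exact: measurable_sqnorm.
- by apply: measurableT_comp => //; apply/measurable_EFinP; exact: measurable_sqnorm.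
- by move=> t It; rewrite lee_fin ger0_norm ?sqnorm_ge0// fg.
Qed.

Definition linear_weight (u : L2) : R -> C := fun t => (1 - t)%:C * L2fun u t.

Lemma sqint_linear_weight u : square_integrable (linear_weight u).
Proof.
have [mR mIm _] := L2fun_sqint u.
have m1 : measurable_fun I (fun t : R => 1 - t) by exact: measurable_funB.
apply: sqint_le (L2fun_sqint u) _.
- rewrite (_ : _ \o _ = (fun t => (1 - t) * Re (L2fun u t))).
    exact: measurable_funM.
  by apply/funext => t; rewrite /= ReZ.
- rewrite (_ : _ \o _ = (fun t => (1 - t) * Im (L2fun u t))).
    exact: measurable_funM.
  by apply/funext => t; rewrite /= ImZ.
- move=> t; rewrite /unit_itv/= in_itv/= => /andP[t0 t1].
  rewrite /linear_weight sqnormM sqnorm_real ler_piMl ?sqnorm_ge0//.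
  by rewrite expr_le1// ?gerBl ?subr_ge0 ltW.
Qed.

Lemma linear_weight_lin (c : C) u v :
  ae_eq_unit (linear_weight (c *: u + v))
             (fun t => c * linear_weight u t + linear_weight v t).
Proof.
apply: filterS (L2funP c u v) => t /[apply].
by rewrite /linear_weight => ->; rewrite mulrDr mulrCA.
Qed.

Definition Mop : {linear L2 -> L2} :=
  sval (lin_ae_op sqint_linear_weight linear_weight_lin).

Lemma MopE u : ae_eq_unit (L2fun (Mop u)) (linear_weight u).
Proof. exact: (svalP (lin_ae_op _ _)). Qed.

Lemma Mop_adjoint u v : L2dot (Mop u) v = L2dot u (Mop v).
Proof.
rewrite (L2dotE (sqint_linear_weight u) (L2fun_sqint v) (MopE u) (ae_eq_unitW (fun=> erefl))).
rewrite (L2dotE (L2fun_sqint u) (sqint_linear_weight v) (ae_eq_unitW (fun=> erefl)) (MopE v)).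
congr Cintegral; apply/funext => t; rewrite /linear_weight.
by rewrite [(1 - t)%:C * L2fun v t]mulrC conjc_Mreal [RHS]mulrA [RHS]mulrC mulrA.
Qed.

Lemma nrm_Mop u : nrm (@L2dot R) (Mop u) <= nrm (@L2dot R) u.
Proof.
rewrite /nrm ler_wsqrtr// -lee_fin !sqf_L2_ereal.
have [mR mIm _] := L2fun_sqint u; have [mR' mIm' _] := L2fun_sqint (Mop u).
apply: ae_ge0_le_integral => //.
- by move=> t _; rewrite lee_fin sqnorm_ge0.
- by apply/measurable_EFinP; exact: measurable_sqnorm.
- by move=> t _; rewrite lee_fin sqnorm_ge0.
- by apply/measurable_EFinP; exact: measurable_sqnorm.
apply: filterS (MopE u) => t /[swap] It -> //.
move: It; rewrite /unit_itv/= in_itv/= => /andP[t0 t1].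
rewrite lee_fin /linear_weight sqnormM sqnorm_real ler_piMl ?sqnorm_ge0//.
by rewrite expr_le1// ?gerBl ?subr_ge0 ltW.
Qed.

(** On t < x write 1 - t = (1 - x) + (x - t); the positive part of x - t is the image under [Vadj]
    of the indicator. *)
Lemma Mop_ind (x : R) : 0 <= x <= 1 ->
  Mop (ind x) = (1 - x)%:C *: ind x + Vadj (ind x).
Proof.
move=> x01; apply: L2P; apply: ae_eq_trans (MopE _) _; apply: ae_eq_sym.
apply: ae_eq_trans (L2funP _ _ _) _.
apply: filterS2 (indE x) (VadjE (ind x)) => t e1 e2 It.
rewrite /linear_weight e1// e2// /coprim -(prim_ge1 _ (lexx 1)).
move: It; rewrite /unit_itv/= in_itv/= => /andP[t0 t1].
rewrite !prim_ind ?ler01 ?lexx ?(ltW t0) ?(ltW t1)//.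
rewrite /indf -!rmorphM -rmorphB -rmorphD /=; congr (_%:C).
have -> : Num.min x 1 = x by move: x01 => /andP[_ x1]; rewrite minEle x1.
by rewrite /lt1; case: (leP x t) => h; rewrite /=; ring.
Qed.

(** Integration by parts against 1 - t, without derivatives: [Mop] and [Vop] are moved onto the
    indicator. *)
Lemma prim_Mop u (x : R) : 0 <= x <= 1 ->
  prim (Mop u) x = (1 - x)%:C * prim u x + prim (Vop u) x.
Proof.
move=> x01; rewrite /prim Mop_adjoint Mop_ind// formDr// formZr// conjc_real.
by rewrite Vop_adjoint.
Qed.

Lemma Vop_Mop u : Vop (Mop u) = Mop (Vop u) + Vop (Vop u).
Proof.
apply: L2P; apply: ae_eq_trans (VopE _) _; apply: ae_eq_sym.
apply: ae_eq_trans (L2funD _ _) _.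
apply: filterS3 (MopE (Vop u)) (VopE (Vop u)) (VopE u) => t e1 e2 e3 It.
rewrite e1// e2// /linear_weight e3// prim_Mop//.
by move: It; rewrite /unit_itv/= in_itv/= => /andP[t0 t1]; rewrite !ltW.
Qed.

Definition zext f : R -> C := fun x => if x \in `]0, 1[ then f x else 0.

Lemma zextE f x : I x -> zext f x = f x.
Proof. by rewrite /unit_itv /zext /= => ->. Qed.

Lemma Re_zext f : Re \o zext f = (Re \o f) \_ I.
Proof.
apply/funext => x; rewrite patchE /zext /= mem_setE; case: ifPn => //.
Qed.

Lemma Im_zext f : Im \o zext f = (Im \o f) \_ I.
Proof.
apply/funext => x; rewrite patchE /zext /= mem_setE; case: ifPn => //.
Qed.

Lemma measurable_zext f : square_integrable f ->
  measurable_fun setT (Re \o zext f) /\ measurable_fun setT (Im \o zext f).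
Proof.
move=> [mR mIm _]; rewrite Re_zext Im_zext.
by split; apply/(measurable_restrictT _ (@measurable_unit_itv R)).
Qed.

Lemma sqnorm_zext f x : (sqnorm (zext f x))%:E = ((fun t => (sqnorm (f t))%:E) \_ I) x.
Proof.
rewrite patchE /zext mem_setE; case: ifPn => // _.
by rewrite /sqnorm /= expr0n /= addr0.
Qed.

Lemma integral_zext_scale f (c : R) : 0 < c -> square_integrable f ->
  (\int[mu]_(x in I) (sqnorm (zext f (c * x)))%:E <=
   (c^-1)%:E * \int[mu]_(x in I) (sqnorm (f x))%:E)%E.
Proof.
move=> c0 sf; have [mR mIm] := measurable_zext sf.
have mz : measurable_fun setT (fun x => (sqnorm (zext f x))%:E).
  by apply/measurable_EFinP; apply: measurable_funD; exact: measurable_funX.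
have -> : (\int[mu]_(x in I) (sqnorm (f x))%:E = \int[mu]_x (sqnorm (zext f x))%:E)%E.
  by rewrite integral_mkcond; apply: eq_integral => x _; rewrite sqnorm_zext.
have z0 x : (0 <= (sqnorm (zext f x))%:E)%E by rewrite lee_fin sqnorm_ge0.
rewrite (ge0_integral_scale c0 mz z0) muleA -EFinM mulVf ?gt_eqF// mul1e.
apply: ge0_subset_integral => //.
have := measurableT_comp mz (measurable_scale c).
exact.
Qed.

Variable c : R.
Hypothesis c0 : 0 < c.

(** For c > 1 the zero extension supplies the values at points where c x >= 1. *)
Definition dil u : R -> C := fun x => zext (L2fun u) (c * x).

Lemma sqint_dil u : square_integrable (dil u).
Proof.
have [mR mIm] := measurable_zext (L2fun_sqint u).
apply: square_integrableP.
- by apply: measurable_funTS; exact: (measurableT_comp mR (measurable_scale c)).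
- by apply: measurable_funTS; exact: (measurableT_comp mIm (measurable_scale c)).
apply: le_lt_trans (integral_zext_scale c0 (L2fun_sqint u)) _.
by rewrite -sqf_L2_ereal -EFinM ltry.
Qed.

Lemma dil_lin (k : C) u v :
  ae_eq_unit (dil (k *: u + v)) (fun t => k * dil u t + dil v t).
Proof.
have := negligible_scale c0 (L2funP k u v).
apply: filterS; first exact: (ae_filter_ringOfSetsType mu).
move=> t; rewrite /dil /zext => H It.
have := H; rewrite /unit_itv/= => H'; case: ifPn => [/H'//|_].
by rewrite mulr0 addr0.
Qed.

Definition Dil : {linear L2 -> L2} := sval (lin_ae_op sqint_dil dil_lin).

Lemma DilE u : ae_eq_unit (L2fun (Dil u)) (dil u).
Proof. exact: (svalP (lin_ae_op _ _)). Qed.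

Lemma sqf_Dil u : sqf (@L2dot R) (Dil u) <= c^-1 * sqf (@L2dot R) u.
Proof.
rewrite -lee_fin EFinM !sqf_L2_ereal.
apply: le_trans (integral_zext_scale c0 (L2fun_sqint u)).
have [mR mIm _] := L2fun_sqint (Dil u); have [mR' mIm' _] := sqint_dil u.
rewrite le_eqVlt; apply/orP; left; apply/eqP; apply: ae_eq_integral => //.
- by apply/measurable_EFinP; exact: measurable_sqnorm.
- by apply/measurable_EFinP; exact: (measurable_sqnorm (f := dil u)).
by apply: filterS (DilE u) => t /[apply] ->.
Qed.

End dilation.

Arguments Mop {R}.

(** * Commutation of dilations with multiplication and integration *)

Section dilation_relations.
Variable R : realType.
Local Notation mu := (@lebesgue_measure R).
Local Notation I := (@unit_itv R).
Local Notation C := (R[i]).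
Local Notation L2 := (L2 R).
Local Hint Resolve measurable_unit_itv : core.
Implicit Types (u v : L2) (f g : R -> C).
Let hd := @L2dot_form R.

Lemma itv01E (x : R) : (x \in `]0, 1[) = (0 < x) && (x < 1).
Proof. by rewrite in_itv. Qed.

Lemma Rintegral_zext (h k : R -> R) : (forall x, I x -> h x = k x) ->
  (forall x, ~ I x -> h x = 0) -> (\int[mu]_(x in I) k x = \int[mu]_x h x)%R.
Proof.
move=> hk h0; rewrite Rintegral_mkcond; apply: eq_Rintegral => x _.
by rewrite patchE; case: ifPn => [/set_mem/hk//|/negP nI]; rewrite h0// => /mem_set.
Qed.

Lemma zext_out f x : ~ I x -> zext f x = 0.
Proof. by rewrite /zext /unit_itv /= => /negP/negbTE ->. Qed.

Lemma integrable_zext (h k : R -> R) : (forall x, I x -> h x = k x) ->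
  (forall x, ~ I x -> h x = 0) -> mu.-integrable I (EFin \o k) ->
  mu.-integrable setT (EFin \o h).
Proof.
move=> hk h0 /(integrable_mkcond _ (@measurable_unit_itv R)); congr integrable.
apply/funext => x; rewrite patchE.
by case: ifPn => [/set_mem/hk/= ->//|/negP nI]; rewrite /= h0// => /mem_set.
Qed.

Section one_scale.
Variable c : R.
Hypothesis c0 : 0 < c.
Hypothesis ci0 : 0 < c^-1.

Lemma Dil_adjoint u v :
  L2dot (Dil c0 u) v = (c^-1)%:C * L2dot u (Dil ci0 v).
Proof.
set f := L2fun u; set g := L2fun v.
(* One integrand on the whole line: restricted to I it is k, and after y = c x it is l, so the zero
   extensions absorb the difference between the two domains. *)
pose H y := zext f y * conjc (zext g (c^-1 * y)).
pose k y := f y * conjc (dil c^-1 v y).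
pose l y := dil c u y * conjc (g y).
have [ikR ikI] : Cintegrable k.
  exact: sqint_CintegrableM (L2fun_sqint u) (sqint_dil ci0 v).
have Hk x : I x -> H x = k x by move=> Ix; rewrite /H zextE.
have Hl x : I x -> H (c * x) = l x.
  by move=> Ix; rewrite /H /l /dil mulrA mulVf ?gt_eqF// mul1r (zextE g).
have Hk0 x : ~ I x -> H x = 0 by move=> Ix; rewrite /H zext_out// mul0r.
have Hl0 x : ~ I x -> H (c * x) = 0.
  by move=> Ix; rewrite /H mulrA mulVf ?gt_eqF// mul1r (zext_out _ Ix) conjc0 mulr0.
rewrite (L2dotE (sqint_dil c0 u) (L2fun_sqint v) (DilE c0 u) (ae_eq_unitW (fun=> erefl))).
rewrite (L2dotE (L2fun_sqint u) (sqint_dil ci0 v) (ae_eq_unitW (fun=> erefl)) (DilE ci0 v)).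
rewrite -/k -/l.
have key (p : C -> R) : p 0 = 0 -> mu.-integrable I (EFin \o (p \o k)) ->
    (\int[mu]_(x in I) p (l x) = c^-1 * \int[mu]_(x in I) p (k x))%R.
  move=> p0 ip.
  have iH : mu.-integrable setT (EFin \o (p \o H)).
    by apply: integrable_zext ip => x Ix /=; [rewrite Hk|rewrite Hk0].
  rewrite [X in _ = _ * X](@Rintegral_zext (p \o H) (p \o k)) => [|x Ix|x Ix] /=; [|by rewrite Hk|by rewrite Hk0].
  rewrite (integrable_scale_integral c0 iH) mulrA mulVf ?gt_eqF// mul1r.
  by apply: Rintegral_zext => x Ix /=; [rewrite Hl|rewrite Hl0].
have E1 := key Re erefl ikR; have E2 := key Im erefl ikI.
rewrite /Cintegral E1 E2; apply/eqP; rewrite eq_complex ReZ ImZ /=.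
by rewrite !eqxx.
Qed.

End one_scale.

(** For x > 1 the zero extension could cut at 1 / c instead of x / c. *)
Lemma Dil_ind (c : R) (c0 : 0 < c) (x : R) : x <= 1 -> Dil c0 (ind x) = ind (c^-1 * x).
Proof.
move=> x1; apply: L2P; apply: ae_eq_trans (DilE _ _) _; apply: ae_eq_sym.
apply: ae_eq_trans (indE _) _.
have := negligible_scale c0 (indE x).
apply: filterS; first exact: (ae_filter_ringOfSetsType mu).
move=> t H; rewrite /unit_itv/= in_itv/= => /andP[t0 t1].
rewrite /dil /zext itv01E (mulr_gt0 c0 t0) andTb.
have ltE : (t < c^-1 * x) = (c * t < x) by rewrite mulrC ltr_pdivlMr// mulrC.
rewrite /indf {1}/lt1 ltE; case: ifPn => [ct1|ct1].
  by rewrite H// /unit_itv/= in_itv/= mulr_gt0.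
case: (ltP (c * t) x) => // ctx.
by move: ct1; rewrite (lt_le_trans ctx x1).
Qed.

Lemma prim_Dil (c : R) (c0 : 0 < c) u (x : R) : x <= 1 ->
  prim (Dil c0 u) x = (c^-1)%:C * prim u (c * x).
Proof.
move=> x1; have ci0 : 0 < c^-1 by rewrite invr_gt0.
by rewrite /prim (Dil_adjoint c0 ci0) (Dil_ind _ x1) invrK.
Qed.

Section relations.
Variable s : R.
Hypothesis s1 : 1 <= s.
Let s0 : 0 < s. Proof. exact: lt_le_trans s1. Qed.
Let si0 : 0 < s^-1. Proof. by rewrite invr_gt0. Qed.

(* (Eop u) x = u (x / s) and (Sop u) x = u (s x), extended by 0 for x >= 1 / s. *)
Definition Eop := Dil si0.
Definition Sop := Dil s0.

Lemma Sop_adjoint u v : L2dot (Sop u) v = (s^-1)%:C * L2dot u (Eop v).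
Proof. exact: Dil_adjoint. Qed.

Lemma divs_unit x : I x -> I (s^-1 * x).
Proof.
rewrite /unit_itv/= !in_itv/= => /andP[x0 x1]; rewrite mulr_gt0//=.
by rewrite (le_lt_trans _ x1)// ler_piMl ?(ltW x0)// invf_le1.
Qed.

Lemma Vop_Eop u : Vop (Eop u) = s%:C *: Eop (Vop u).
Proof.
apply: L2P; apply: ae_eq_trans (VopE _) _; apply: ae_eq_sym.
apply: ae_eq_trans (L2funZ _ _) _.
have := DilE si0 (Vop u); have := negligible_scale si0 (VopE u).
apply: filterS2; first exact: (ae_filter_ringOfSetsType mu).
move=> t e1 e2 It; rewrite e2// /dil zextE; last exact: divs_unit.
rewrite e1; last exact: divs_unit.
have t1 : t <= 1 by move: It; rewrite /unit_itv/= in_itv/= => /andP[_ /ltW].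
by rewrite (prim_Dil si0 u t1) invrK.
Qed.

(** The right side is a bounded operator applied to [Vop u]: thus the adjoint of D, which is [Mop]
    after [Eop] up to 1 / s, acts boundedly on primitives. *)
Lemma Vop_Mop_Eop u :
  Vop (Mop (Eop u)) = s%:C *: (Mop (Eop (Vop u)) + Vop (Eop (Vop u))).
Proof.
by rewrite Vop_Mop Vop_Eop !linearZ /= -scalerDr.
Qed.

(** Beyond 1 both primitives are constant, and the boundary factor is the positive part of 1 - x. It
    is meant for the points s t, which may exceed 1. *)
Lemma prim_Mop_ge0 u x : 0 <= x ->
  prim (Mop u) x = (lt1 x 1 * (1 - x))%:C * prim u x + prim (Vop u) x.
Proof.
move=> x0; rewrite /lt1; case: ltP => x1.
  by rewrite mul1r prim_Mop// x0 ltW.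
rewrite mul0r rmorph0 mul0r add0r !prim_ge1//.
rewrite -!(prim_ge1 _ (lexx 1)) prim_Mop ?lexx ?ler01//.
by rewrite subrr rmorph0 mul0r add0r.
Qed.

(** The same for D itself: by [prim_Dil] it is integration by parts up to the point s t. *)
Lemma Vop_Sop_Mop u : Vop (Sop (Mop u)) =
  (s^-1)%:C *: Sop (Mop (Vop u)) + Vop (Sop (Vop u)).
Proof.
apply: L2P; apply: ae_eq_trans (VopE _) _; apply: ae_eq_sym.
apply: ae_eq_trans (L2funP _ _ _) _.
have h1 := VopE (Sop (Vop u)); have h2 := DilE s0 (Mop (Vop u)).
have h3 := negligible_scale s0 (MopE (Vop u)).
have h4 := negligible_scale s0 (VopE u).
have h34 : \forall t \ae (@lebesgue_measure R), I (s * t) ->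
    L2fun (Mop (Vop u)) (s * t) = (1 - s * t)%:C * prim u (s * t).
  move: h3 h4; apply: filterS2; first exact: (ae_filter_ringOfSetsType mu).
  by move=> t e3 e4 It; rewrite e3// /linear_weight e4.
move: h1 h2 h34; apply: filterS3.
move=> t e1 e2 e34 It; rewrite e1// e2//.
have [t0 t1] : 0 < t /\ t < 1.
  by move: It; rewrite /unit_itv/= in_itv/= => /andP[].
rewrite !(prim_Dil _ _ (ltW t1)) (prim_Mop_ge0 _ (mulr_ge0 (ltW s0) (ltW t0))).
rewrite mulrDr; congr (_ * _ + _).
rewrite /dil /zext itv01E (mulr_gt0 s0 t0) andTb /lt1; case: ifPn => st.
  by rewrite mul1r e34// /unit_itv/= in_itv/= mulr_gt0.
by rewrite mul0r rmorph0 mul0r.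
Qed.

Lemma Eop_one : Eop one = one.
Proof.
apply: L2P; apply: ae_eq_trans (DilE _ _) _; apply: ae_eq_sym.
have := oneE R; have := negligible_scale si0 (oneE R).
apply: filterS2; first exact: (ae_filter_ringOfSetsType mu).
move=> t e1 e2 It; rewrite e2// /dil zextE; last exact: divs_unit.
by rewrite e1//; exact: divs_unit.
Qed.

Lemma prim_one_ge0 (y : R) : 0 <= y -> prim one y = (Num.min y 1)%:C.
Proof.
move=> y0; case: leP => y1; first by rewrite prim_one// y0.
by rewrite prim_ge1 ?(ltW y1)// -(prim_ge1 _ (lexx 1)) prim_one// ler01 lexx.
Qed.

Lemma Mop_Vop_one : Mop one + Vop one = one :> L2.
Proof.
apply: L2P; apply: ae_eq_trans (L2funD _ _) _.
apply: filterS3 (MopE one) (VopE one) (oneE R) => t e1 e2 e3 It.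
rewrite e1// e2// /linear_weight e3// mulr1 prim_one.
  by rewrite -rmorphD subrK.
by move: It; rewrite /unit_itv/= in_itv/= => /andP[t0 t1]; rewrite !ltW.
Qed.

(** Pointwise, max (1 - s t, 0) + min (s t, 1) = 1, divided by s. This and [Mop_Vop_one] say how
    constants, hence vertex derivatives, pass through D and its adjoint. *)
Lemma Sop_Mop_one :
  (s^-1)%:C *: Sop (Mop one) + Vop (Sop one) = (s^-1)%:C *: one :> L2.
Proof.
apply: L2P; apply: ae_eq_trans (L2funP _ _ _) _; apply: ae_eq_sym.
apply: ae_eq_trans (L2funZ _ _) _; apply: ae_eq_sym.
have h34 : \forall t \ae (@lebesgue_measure R), I (s * t) ->
    L2fun (Mop one) (s * t) = (1 - s * t)%:C.
  have := negligible_scale s0 (MopE one); have := negligible_scale s0 (oneE R).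
  apply: filterS2; first exact: (ae_filter_ringOfSetsType mu).
  by move=> t e1 e2 It; rewrite e2// /linear_weight e1// mulr1.
have h12 : ae_eq_unit (fun t => L2fun (Vop (Sop one)) t - (s^-1)%:C * L2fun one t)
    (fun t => (s^-1)%:C * (Num.min (s * t) 1)%:C - (s^-1)%:C).
  apply: filterS2 (VopE (Sop one)) (oneE R) => t e1 e2 It; rewrite e1// e2// mulr1.
  have [t0 t1] : 0 < t /\ t < 1 by move: It; rewrite /unit_itv/= in_itv/= => /andP[].
  by rewrite (prim_Dil _ _ (ltW t1)) (prim_one_ge0 (mulr_ge0 (ltW s0) (ltW t0))).
move: h12 h34 (DilE s0 (Mop one)); apply: filterS3.
move=> t e1 e2 e3 It; apply/eqP; rewrite -subr_eq0 -addrA e1// e3//.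
have [t0 t1] : 0 < t /\ t < 1 by move: It; rewrite /unit_itv/= in_itv/= => /andP[].
rewrite /dil /zext itv01E (mulr_gt0 s0 t0) andTb; case: ifPn => st.
  have Ist : I (s * t) by rewrite /unit_itv/= itv01E (mulr_gt0 s0 t0).
  by rewrite (e2 Ist) minEle (ltW st) rmorphB rmorph1 mulrBr mulr1 subrKA subrr.
by rewrite mulr0 add0r minElt (negbTE st) mulr1 subrr.
Qed.

End relations.
End dilation_relations.

(** * Almost everywhere equality and equicontinuity *)

Section continuity_facts.
Variable R : realType.
Local Notation mu := (@lebesgue_measure R).
Local Notation I := (@unit_itv R).

Lemma continuous_ae0 (d : R -> R) : {within `[0, 1], continuous d} ->
  (\forall t \ae mu, I t -> d t = 0) -> forall x, 0 <= x <= 1 -> d x = 0.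
Proof.
move=> cd [N [mN N0 dN]] x x01; apply/eqP; apply/negPn/negP => dx0.
have x01' : `[0, 1]%classic x by rewrite /= in_itv/=.
have dx : 0 < `|d x| by rewrite normr_gt0.
have /subspace_continuousP/(_ _ x01')/cvgrPdist_lt/(_ _ dx) := cd.
rewrite near_withinE => /nbhs_ballP[e /= e0 be].
move: x01 => /andP[x0 x1].
(* Clipping to [0, 1] keeps an interval of positive length even when x is an end point. *)
pose l := Num.max 0 (x - e); pose r := Num.min 1 (x + e).
have lr : l < r.
  rewrite /l /r lt_min !gt_max ltr01 /=; apply/andP; split.
    by rewrite ltrBlDr (le_lt_trans x1)// ltrDl.
  by rewrite ltr_wpDl//= ltrBlDr -addrA ltrDl addr_gt0.
have sub : `]l, r[%classic `<=` N.
  move=> t /=; rewrite in_itv/= => /andP[]; rewrite /l /r gt_max lt_min.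
  move=> /andP[t0 xt] /andP[t1 tx]; apply: dN => /= H.
  have tI : I t by rewrite /unit_itv/= in_itv/= t0.
  suff : `|d x - d t| < `|d x| by rewrite (H tI) subr0 ltxx.
  apply: (be t); rewrite /ball/= ?in_itv/= ?(ltW t0) ?(ltW t1)//.
  by rewrite ltr_norml; apply/andP; split; lra.
have : (mu `]l, r[%classic <= mu N)%E.
  by apply: le_measure; rewrite ?inE//; exact: measurable_itv.
rewrite [X in (_ <= X)%E]N0 lebesgue_measure_itv/= lte_fin lr -EFinB lee_fin.
by rewrite subr_le0 leNgt lr.
Qed.

Lemma ultra_lim (U : set_system nat) (u : nat -> R) (B : R) : UltraFilter U ->
  (forall n, `|u n| <= B) -> exists l : R, u @ U --> l.
Proof.
move=> uU uB.
have pU : ProperFilter U by exact: ultra_proper.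
have FB : (u @ U) `[- B, B]%classic.
  suff : U (u @^-1` `[- B, B]%classic) by [].
  by apply: filterE => n /=; rewrite in_itv/= -ler_norml uB.
have [l [_ cl]] := @segment_compact R (- B) B (u @ U) _ FB.
exists l => A Al; have [//|nA] := in_ultra_setVsetC (u @^-1` A) uU.
by have [y [nAy Ay]] := cl (~` A) A nA Al.
Qed.

(** Arzelà-Ascoli along an ultrafilter: pointwise limits exist at once, and the common Hölder bound
    reduces uniformity on [0, 1] to a finite grid. *)
Lemma ultra_holder (U : set_system nat) (w : nat -> R -> R) (B A : R) :
  UltraFilter U -> (forall n x, `|w n x| <= B) ->
  (forall n x y, `|w n x - w n y| <= A * Num.sqrt `|x - y|) ->
  exists g : R -> R, [/\ forall x y, `|g x - g y| <= A * Num.sqrt `|x - y|,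
    forall x, `|g x| <= B &
    forall e, 0 < e -> U [set n | forall x, 0 <= x <= 1 -> `|w n x - g x| <= e]].
Proof.
move=> uU wB wA; have pU : ProperFilter U by exact: ultra_proper.
have /choice[g gP] x := ultra_lim uU (wB ^~ x).
have A0 : 0 <= A.
  by have := wA 0%N 1 0; rewrite subr0 normr1 sqrtr1 mulr1; apply: le_trans.
have near_g x e : 0 < e -> U [set n | `|g x - w n x| <= e].
  by move=> e0; have /cvgrPdist_le/(_ _ e0) := gP x.
have gA x y : `|g x - g y| <= A * Num.sqrt `|x - y|.
  apply/ler_addgt0Pr => e e0.
  have e2 : 0 < e / 2 by rewrite divr_gt0.
  have [n [/= h1 h2]] := filter_ex (filterI (near_g x _ e2) (near_g y _ e2)).
  have -> : g x - g y = (w n x - w n y) + ((g x - w n x) - (g y - w n y)) by lra.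
  rewrite (le_trans (ler_normD _ _))// lerD//.
  by rewrite (le_trans (ler_normB _ _))// [leRHS]splitr lerD.
have gB x : `|g x| <= B.
  apply/ler_addgt0Pr => e e0; have [n /= h1] := filter_ex (near_g x _ e0).
  have -> : g x = w n x + (g x - w n x) by lra.
  by rewrite (le_trans (ler_normD _ _))// lerD.
exists g; split => // e e0.
have e3 : 0 < e / 3 by rewrite divr_gt0.
have A1 : 0 < A + 1 by rewrite ltr_wpDl.
(* Points at distance at most d have values within A sqrt(d) <= e / 3; the grid of step 1 / N < d is
   thus fine enough. *)
pose d := (e / 3 / (A + 1)) ^+ 2.
have d0 : 0 < d by rewrite exprn_gt0// divr_gt0.
pose N := (Num.truncn d^-1).+1.
have Nd : N%:R^-1 < d.
  rewrite invf_plt ?posrE// ?ltr0n//; exact: Num.Theory.truncnS_gt.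
have N0 : (0 : R) < N%:R by rewrite ltr0n.
have : U [set n | forall k : 'I_N.+1, `|g (k%:R / N%:R) - w n (k%:R / N%:R)| <= e / 3].
  by apply: (@filter_forall _ _
    (fun (k : 'I_N.+1) n => `|g (k%:R / N%:R) - w n (k%:R / N%:R)| <= e / 3)) => k; exact: near_g.
apply: filterS => n /= nk x /andP[x0 x1].
have kN : (Num.truncn (x * N%:R) < N.+1)%N.
  rewrite ltnS -(ler_nat R).
  have /andP[h _] := Num.Theory.truncn_itv (mulr_ge0 x0 (ltW N0)).
  by rewrite (le_trans h)// ler_piMl// ltW.
have /= := nk (Ordinal kN).
set y : R := _ / N%:R => gy.
have xy : A * Num.sqrt `|x - y| <= e / 3.
  have /andP[h1 h2] := Num.Theory.truncn_itv (mulr_ge0 x0 (ltW N0)).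
  have yx : y <= x by rewrite /y ler_pdivrMr.
  have xyN : x - y <= d.
    apply: le_trans (ltW Nd); rewrite lerBlDr -(ler_pM2r N0).
    by rewrite mulrDl mulVf ?gt_eqF// /y divfK ?gt_eqF// addrC natr1 ltW.
  rewrite ger0_norm ?subr_ge0//.
  rewrite (le_trans (ler_wpM2l A0 (ler_wsqrtr xyN)))// /d sqrtr_sqr ger0_norm; last first.
    by rewrite divr_ge0 ?ltW.
  by rewrite mulrCA ler_piMr ?(ltW e3)// ler_pdivrMr// mul1r lerDl.
have -> : w n x - g x = (w n x - w n y) + ((g y - g x) - (g y - w n y)) by lra.
rewrite (le_trans (ler_normD _ _))// (_ : e = e / 3 + (e / 3 + e / 3)); last by lra.
rewrite lerD ?(le_trans (wA _ _ _))// (le_trans (ler_normB _ _))// lerD//.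
by rewrite distrC (le_trans (gA _ _)).
Qed.

End continuity_facts.

(** * Injectivity and compactness of the Volterra operator *)

Section volterra_facts.
Variable R : realType.
Local Notation mu := (@lebesgue_measure R).
Local Notation I := (@unit_itv R).
Local Notation C := (R[i]).
Local Notation L2 := (L2 R).
Local Hint Resolve measurable_unit_itv : core.
Implicit Types (u v : L2) (f g : R -> C).
Let hd := @L2dot_form R.

(** Lebesgue differentiation: p is almost everywhere the derivative of its primitive, which is
    constant here. *)
Lemma ae0_of_primitive (p : R -> R) : mu.-integrable I (EFin \o p) ->
  (forall x, \int[mu]_(s in I) (p s * lt1 s x) = 0)%R ->
  \forall t \ae mu, I t -> p t = 0.
Proof.
move=> ip p0; pose f := p \_ I.
have i_f : mu.-integrable setT (EFin \o f).
  by have := (integrable_mkcond _ (@measurable_unit_itv R)).1 ip; rewrite restrict_EFin.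
have ify y : mu.-integrable `]-oo, y] (EFin \o f).
  by apply: integrableS i_f.
have lf : locally_integrable setT f by exact: (integrable_locally (@measurable_unit_itv R) ip).
have := FTC1Ny ify lf; cbv zeta.
have -> : (fun x : R => \int[mu]_(t in `]-oo, x]) f t)%R = cst 0.
  apply/funext => x; rewrite -Rintegral_itv_bndo_bndc; last first.
    by apply: integrableS i_f.
  rewrite -[RHS](p0 x) [LHS]Rintegral_mkcond [RHS]Rintegral_mkcond.
  apply: eq_Rintegral => t _; rewrite !patchE /f /lt1 patchE mem_setE in_itv/=.
  by case: ifPn => tx; case: ifPn => // _; rewrite ?mulr1 ?mulr0.
apply: filterS; first exact: (ae_filter_ringOfSetsType mu).
move=> t [_ +] It.
by rewrite derive1_cst /f patchE mem_set.
Qed.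

Lemma prim_unique u f : {within `[0, 1], continuous (fun t => Re (f t))} ->
  {within `[0, 1], continuous (fun t => Im (f t))} ->
  forall g, {within `[0, 1], continuous (fun t => Re (g t))} ->
  {within `[0, 1], continuous (fun t => Im (g t))} ->
  ae_eq_unit f g -> forall x, 0 <= x <= 1 -> f x = g x.
Proof.
move=> fR fI g gR gI fg x x01.
apply/eqP; rewrite eq_complex -subr_eq0 -[X in _ && X]subr_eq0; apply/andP.
split; apply/eqP.
  apply: (@continuous_ae0 R (fun t => Re (f t) - Re (g t))) => //.
    by move=> y; apply: cvgB; [exact: fR|exact: gR].
  by apply: filterS fg => t /[apply] ->; rewrite subrr.
apply: (@continuous_ae0 R (fun t => Im (f t) - Im (g t))) => //.
  by move=> y; apply: cvgB; [exact: fI|exact: gI].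
by apply: filterS fg => t /[apply] ->; rewrite subrr.
Qed.

Lemma Vop_inj u : Vop u = 0 -> u = 0.
Proof.
move=> Vu0.
have p01 x : 0 <= x <= 1 -> prim u x = 0.
  apply: (@prim_unique u (prim u) _ _ (fun=> 0)).
  - by apply: continuous_subspaceT; exact: continuous_Re_prim.
  - by apply: continuous_subspaceT; exact: continuous_Im_prim.
  - by apply: continuous_subspaceT => y; exact: cvg_cst.
  - by apply: continuous_subspaceT => y; exact: cvg_cst.
  apply: ae_eq_trans (ae_eq_sym (VopE u)) _; rewrite Vu0; exact: L2fun0.
have p0 x : prim u x = 0.
  have [x0|x0] := leP x 0; first exact: prim_le0.
  have [x1|x1] := leP x 1; first by apply: p01; rewrite x1 ltW.
  by rewrite prim_ge1 ?(ltW x1)// -(prim_ge1 _ (lexx 1)) p01// ler01 lexx.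
have [iR iI] := sqint_integrable (L2fun_sqint u).
have R0 : \forall t \ae mu, I t -> Re (L2fun u t) = 0.
  by apply: (ae0_of_primitive iR) => x; rewrite -Re_prim p0.
have I0 : \forall t \ae mu, I t -> Im (L2fun u t) = 0.
  by apply: (ae0_of_primitive iI) => x; rewrite -Im_prim p0.
apply: L2P; apply: ae_eq_trans (ae_eq_sym (L2fun0 R)).
apply: filterS2 R0 I0 => t h1 h2 It; apply/eqP.
by rewrite eq_complex h1// h2// !eqxx.
Qed.

(** The ultrafilter is a parameter, so that a single one serves all edges of the graph. *)
Lemma Vadj_compact (U : set_system nat) (h : nat -> L2) : UltraFilter U ->
  (forall n, nrm (@L2dot R) (h n) <= 1) ->
  exists q, forall e, 0 < e -> U [set n | nrm (@L2dot R) (Vadj (h n) - q) <= e].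
Proof.
move=> uU h1; have pU : ProperFilter U by exact: ultra_proper.
have cB n x : cmod (coprim (h n) x) <= 2.
  rewrite /coprim -(prim_ge1 _ (lexx 1)) (le_trans (cmodD _ _))// cmodN.
  rewrite (_ : 2 = 1 + 1)// lerD//; exact: le_trans (cmod_prim_le _ _) (h1 n).
have cA n x y : cmod (coprim (h n) x - coprim (h n) y) <= 1 * Num.sqrt `|x - y|.
  have -> : coprim (h n) x - coprim (h n) y = - (prim (h n) x - prim (h n) y).
    by rewrite /coprim !opprB [LHS]addrC addrA subrK.
  rewrite cmodN (le_trans (prim_holder _ _ _))// ler_wpM2r ?sqrtr_ge0//.
have ReB z w : Re (z - w) = Re z - Re w :> R by rewrite ReD mulrN_Re.
have ImB z w : Im (z - w) = Im z - Im w :> R by rewrite ImD mulrN_Im.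
have [||gR [gRA gRB gRu]] := @ultra_holder R U (fun n x => Re (coprim (h n) x)) 2 1 uU.
- by move=> n x; exact: le_trans (Re_le_cmod _) (cB n x).
- by move=> n x y; rewrite -ReB; exact: le_trans (Re_le_cmod _) (cA n x y).
have [||gI [gIA gIB gIu]] := @ultra_holder R U (fun n x => Im (coprim (h n) x)) 2 1 uU.
- by move=> n x; exact: le_trans (Im_le_cmod _) (cB n x).
- by move=> n x y; rewrite -ImB; exact: le_trans (Im_le_cmod _) (cA n x y).
pose g x : C := gR x +i* gI x.
have sg : square_integrable g.
  apply: (@sqint_bounded _ _ (2 ^+ 2 + 2 ^+ 2)).
  - apply: measurable_funTS; apply: continuous_measurable_fun.
    exact: (holder_continuous gRA).
  - apply: measurable_funTS; apply: continuous_measurable_fun.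
    exact: (holder_continuous gIA).
  - move=> t _; rewrite /sqnorm /= -[gR t ^+ 2]real_normK ?num_real// -[gI t ^+ 2]real_normK ?num_real//.
    by apply: lerD; rewrite ler_pXn2r ?nnegrE ?gRB ?gIB.
exists (L2mk g) => e e0.
have e2 : 0 < e / 2 by rewrite divr_gt0.
apply: filterS2 (gRu _ e2) (gIu _ e2) => n nR nI.
apply: (@nrm_le_sup _ _ (fun t => coprim (h n) t - g t)); first exact: ltW.
  apply: ae_eq_trans (L2funB _ _) _.
  by apply: filterS2 (VadjE (h n)) (L2mkE sg) => t h2 h3 It; rewrite h2// h3.
move=> t; rewrite /unit_itv/= in_itv/= => /andP[t0 t1].
have t01 : 0 <= t <= 1 by rewrite !ltW.
rewrite [X in cmod X]complexE (le_trans (cmodD _ _))// [leRHS]splitr cmodM.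
rewrite !cmod_real (_ : cmod 'i%C = 1) ?mul1r; last first.
  by rewrite /cmod /sqnorm /= expr0n expr1n add0r sqrtr1.
by rewrite ReB ImB lerD ?nR ?nI.
Qed.

End volterra_facts.

(** * Weak derivatives *)

Section weak_derivatives.
Variable R : realType.
Local Notation mu := (@lebesgue_measure R).
Local Notation I := (@unit_itv R).
Local Notation C := (R[i]).
Local Notation L2 := (L2 R).
Local Hint Resolve measurable_unit_itv : core.
Implicit Types (u v w : L2) (f g : R -> C) (phi q : R -> R).
Let hd := @L2dot_form R.

Definition rL2 q : L2 := L2mk (fun t => (q t)%:C).

Lemma sqint_rL2 q (B : R) : continuous q -> (forall t, I t -> `|q t| <= B) ->
  square_integrable (fun t => (q t)%:C).
Proof.
move=> cq qB; apply: (@sqint_bounded _ _ (B ^+ 2)).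
- by apply: measurable_funTS; apply: continuous_measurable_fun.
- exact: measurable_cst.
- move=> t It; rewrite sqnorm_real -real_normK ?num_real//.
  by rewrite ler_pXn2r ?nnegrE// ?qB// (le_trans _ (qB _ It)).
Qed.

Lemma continuous_bounded_unit q : continuous q ->
  exists B, forall t, I t -> `|q t| <= B.
Proof.
move=> cq; have cn : {within `[0, 1], continuous (fun t => `|q t|)}.
  apply: continuous_subspaceT => t; apply: continuous_comp; [exact: cq|exact: norm_continuous].
have [c _ cP] := @EVT_max R (fun t => `|q t|) 0 1 ler01 cn.
exists `|q c| => t; rewrite /unit_itv/= in_itv/= => /andP[t0 t1].
by apply: cP; rewrite in_itv/= !ltW.
Qed.

Lemma rL2E q : continuous q -> ae_eq_unit (L2fun (rL2 q)) (fun t => (q t)%:C).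
Proof.
by move=> cq; have [B qB] := continuous_bounded_unit cq; exact: L2mkE (sqint_rL2 cq qB).
Qed.

Lemma L2dot_rL2 u q : continuous q ->
  L2dot u (rL2 q) = Cintegral (fun t => L2fun u t * (q t)%:C).
Proof.
move=> cq; have [B qB] := continuous_bounded_unit cq.
rewrite (L2dotE (L2fun_sqint u) (sqint_rL2 cq qB) (ae_eq_unitW (fun=> erefl)) (rL2E cq)).
by congr Cintegral; apply/funext => t; rewrite conjc_real.
Qed.

Lemma test_continuous phi : test_function phi -> continuous phi.
Proof.
move=> [dphi _ _] x; apply: differentiable_continuous.
exact/derivable1_diffP/dphi.
Qed.

Lemma test_out phi x : test_function phi -> ~ I x -> phi x = 0.
Proof.
move=> [_ _ [a [b [a0 b1 ab]]]] xI; apply: ab; apply: contra_notN xI.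
rewrite /unit_itv/= !in_itv/= => /andP[ax xb].
by rewrite (lt_le_trans a0 ax) (le_lt_trans xb b1).
Qed.

Lemma weak_derivative_dot u v : weak_derivative u v <->
  forall phi, test_function phi ->
    L2dot u (rL2 (derive1 phi)) = - L2dot v (rL2 phi).
Proof.
split=> H phi tp; have := H phi tp; have cp := test_continuous tp.
  by case: tp => _ cp' _; rewrite (L2dot_rL2 u cp') (L2dot_rL2 v cp).
by case: tp => _ cp' _; rewrite (L2dot_rL2 u cp') (L2dot_rL2 v cp).
Qed.

Lemma prim_test phi x : test_function phi -> 0 <= x <= 1 ->
  prim (rL2 (derive1 phi)) x = (phi x)%:C.
Proof.
move=> tp /andP[x0 x1]; have cp := test_continuous tp; have [dp cp' _] := tp.
have [x00|x00] := eqVneq x 0.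
  rewrite x00 prim_le0// test_out// /unit_itv/= in_itv/= ltxx.
  by [].
have {x00}x0 : 0 < x by rewrite lt_neqAle eq_sym x00.
have [B qB] := continuous_bounded_unit cp'.
rewrite /prim (L2dotE (sqint_rL2 cp' qB) (sqint_indf x) (rL2E cp') (indE x)).
have pE t : (derive1 phi t)%:C * conjc (indf x t) = (derive1 phi t * lt1 t x)%:C.
  by rewrite /indf conjc_real rmorphM.
rewrite /Cintegral /real_complex_def; congr (_ +i* _); last first.
  rewrite (@eq_Rintegral _ _ _ _ _ (cst 0)); first by rewrite Rintegral_cst// mul0r.
  by move=> t _; rewrite pE.
transitivity (\int[mu]_(t in I) (derive1 phi t * lt1 t x))%R.
  by apply: eq_Rintegral => t _; rewrite pE.
have := @continuous_FTC2 R (derive1 phi) phi 0 x x0.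
have sub : `[0, x] `<=` (setT : set R) by [].
move=> /(_ _ _ _)H.
have : (\int[mu]_(t in `[0%R, x]) (derive1 phi t)%:E = (phi x)%:E - (phi 0)%:E)%E.
  apply: H; first exact: continuous_subspaceT.
  - split; first by move=> y _; exact: dp.
    + by apply: cvg_at_right_filter; exact: cp.
    + by apply: cvg_at_left_filter; exact: cp.
  - by [].
rewrite (test_out (x := 0) tp) ?sube0; last first.
  by rewrite /unit_itv/= in_itv/= ltxx.
move=> /(congr1 fine) /= <-; rewrite [RHS]/(Rintegral mu _ (derive1 phi)).
have ip : mu.-integrable `[0, x] (EFin \o derive1 phi).
  apply: continuous_compact_integrable; first exact: segment_compact.
  exact: continuous_subspaceT.
transitivity (Rintegral mu `]0, x] (derive1 phi)); last first.
  apply: Rintegral_itv_obnd_cbnd.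
  by apply: integrableS ip => //; exact: subset_itv_oc_cc.
transitivity (Rintegral mu `]0, x[ (derive1 phi)); last first.
  apply: Rintegral_itv_bndo_bndc.
  by apply: integrableS ip => //; exact: subset_itv_oo_cc.
rewrite [LHS]Rintegral_mkcond [RHS]Rintegral_mkcond; apply: eq_Rintegral => t _.
rewrite !patchE !mem_setE /unit_itv !in_itv/= /lt1.
have [t0|t0]//= := ltP 0 t; have [tx|tx] := ltP t x; rewrite ?mulr1 ?mulr0.
  by rewrite (lt_le_trans tx x1).
by rewrite if_same.
Qed.

Lemma dot_one_test phi : test_function phi -> L2dot (rL2 (derive1 phi)) one = 0.
Proof.
move=> tp; rewrite -(prim_ge1 _ (lexx 1)) prim_test// ?ler01 ?lexx//.
by rewrite test_out// /unit_itv/= in_itv/= ltxx andbF.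
Qed.

Lemma Vop_test phi : test_function phi -> Vop (rL2 (derive1 phi)) = rL2 phi.
Proof.
move=> tp; apply: L2P; apply: ae_eq_trans (VopE _) _; apply: ae_eq_sym.
apply: ae_eq_trans (rL2E (test_continuous tp)) _; apply: aeW => t It.
by rewrite prim_test//; move: It; rewrite /unit_itv/= in_itv/= => /andP[? ?]; rewrite !ltW.
Qed.

Lemma Vadj_adjoint u v : L2dot (Vadj u) v = L2dot u (Vop v).
Proof. by rewrite (formC hd) -Vop_adjoint -(formC hd). Qed.

(** A test function has a derivative of mean 0, so [Vadj] sends this derivative to minus the test
    function. *)
Lemma weak_derivative_Vop v (c : C) : weak_derivative (Vop v + c *: one) v.
Proof.
apply/weak_derivative_dot => phi tp.
rewrite formDl// formZl// (hermitian_formP hd (dot_one_test tp)) mulr0 addr0.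
by rewrite Vop_adjoint Vadj_Vop dot_one_test// scale0r sub0r formNr// Vop_test.
Qed.

Lemma weak_derivativeB u v u' v' : weak_derivative u u' -> weak_derivative v v' ->
  weak_derivative (u - v) (u' - v').
Proof.
move=> /weak_derivative_dot du /weak_derivative_dot dv.
apply/weak_derivative_dot => phi tp.
by rewrite !(formBl hd) (du _ tp) (dv _ tp) opprB opprK addrC.
Qed.

(** As q is continuous on the line and vanishes off I, the primitive is differentiable at 0 and 1 as
    well; it serves as the P that is rescaled below. *)
Lemma primitive_is_derive q : continuous q -> (forall t, ~ I t -> q t = 0) ->
  mu.-integrable I (EFin \o q) ->
  forall y : R, is_derive y (1 : R) (fun y : R => \int[mu]_(s in I) (q s * lt1 s y))%R (q y).
Proof.
move=> cq q0 iq y.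
have iqT : mu.-integrable setT (EFin \o q) by apply: integrable_zext iq.
have iqy z : mu.-integrable `]-oo, z] (EFin \o q) by apply: integrableS iqT.
have -> : (fun y => \int[mu]_(s in I) (q s * lt1 s y))%R =
    (fun y => \int[mu]_(t in `]-oo, y]) q t)%R.
  apply/funext => z; rewrite -Rintegral_itv_bndo_bndc; last first.
    by apply: integrableS iqT.
  rewrite [LHS]Rintegral_mkcond [RHS]Rintegral_mkcond.
  apply: eq_Rintegral => t _; rewrite !patchE !mem_setE !in_itv/= /lt1.
  rewrite /= -[point]/(0 : R).
  have [It|nIt] := boolP (0 < t < 1); first by case: (t < z); rewrite ?mulr1 ?mulr0.
  by rewrite (q0 t) ?if_same// /unit_itv/= in_itv/=; exact/negP.
have y1 : y < y + 1 by rewrite ltrDl.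
have [||dF <-] := @continuous_FTC1 R q -oo%O y (y + 1) y1 (iqy _).
- by rewrite ltNyr.
- exact: cq.
- by rewrite derive1E; exact: derivableP.
Qed.

Section rescaled.
Variables (q P : R -> R) (a : R).
Hypotheses (cq : continuous q) (dP : forall y : R, is_derive y (1 : R) P (q y)).
Hypothesis P0 : forall y, ~ I y -> P y = 0.
Hypotheses (a0 : 0 < a) (a2 : a <= 4^-1).

Let k := 1 - 2 * a.
Let k0 : 0 < k. Proof. by rewrite /k; have := a2; lra. Qed.

(* Moves the support of P from [0, 1] to [a, 1 - a], so as to get test functions. *)
Definition rescaled : R -> R := fun x => k * P (k^-1 * (x - a)).

(** The outer factor k cancels the one from the chain rule: the derivative is q at a point close to
    x. *)
Lemma rescaled_derive (x : R) : is_derive x (1 : R) rescaled (q (k^-1 * (x - a))).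
Proof.
have dg : is_derive x (1 : R) (fun x : R => k^-1 * (x - a)) k^-1.
  have h : is_derive x (1 : R) (fun x : R => x - a) 1.
    by have := is_deriveB (is_derive_id x (1 : R)) (is_derive_cst a x (1 : R)); rewrite subr0.
  have := is_deriveZ k^-1 h.
  by rewrite /GRing.scale/= mulr1.
have := is_deriveZ k (@is_derive1_comp R P (fun x : R => k^-1 * (x - a)) x _ _ (dP (k^-1 * (x - a))) dg).
rewrite /GRing.scale/= mulrCA mulfV ?gt_eqF// mulr1.
exact.
Qed.

Lemma rescaled_derive1 : derive1 rescaled = (fun x => q (k^-1 * (x - a))).
Proof.
apply/funext => x; rewrite derive1E; have := rescaled_derive x.
by move=> ?; rewrite derive_val.
Qed.

Lemma rescaled_test : test_function rescaled.
Proof.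
split.
- by move=> x; have [] := rescaled_derive x.
- rewrite rescaled_derive1 => x; apply: continuous_comp; last exact: cq.
  apply: cvgM; first exact: cvg_cst.
  by apply: cvgB; [exact: cvg_id|exact: cvg_cst].
- exists a, (1 - a); split=> //; first by rewrite gtrBl.
  move=> x; rewrite in_itv/= /rescaled => xa; rewrite P0 ?mulr0//.
  rewrite /unit_itv/= in_itv/= pmulr_rgt0 ?invr_gt0// subr_gt0 mulrC ltr_pdivrMr//.
  rewrite mul1r /k => /andP[h1 h2]; move: xa; rewrite (ltW h1)/= => /negP; apply.
  by lra.
Qed.

Lemma rescaled_arg_dist x : I x -> `|k^-1 * (x - a) - x| <= 2 * a.
Proof.
rewrite /unit_itv/= in_itv/= => /andP[x0 x1].
have -> : k^-1 * (x - a) - x = k^-1 * (a * (2 * x - 1)).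
  by rewrite /k; field; rewrite gt_eqF.
rewrite !normrM (ger0_norm (ltW a0)) ger0_norm ?invr_ge0 ?(ltW k0)//.
rewrite mulrC ler_pdivrMr//.
have : `|2 * x - 1| <= 1 by rewrite ler_norml; apply/andP; split; move: x0 x1; lra.
have k2 : 1 <= 2 * k by rewrite /k; have := a2; lra.
move=> h; apply: (@le_trans _ _ (a * 1)); first by rewrite ler_wpM2l ?(ltW a0).
by rewrite mulr1 mulrAC -[leLHS]mul1r ler_wpM2r ?(ltW a0).
Qed.

End rescaled.
End weak_derivatives.

Section two_dimensional_span.
Variables (R : realType) (U : lmodType R[i]) (a : U -> U -> R[i]).
Hypotheses (ha : hermitian_form a) (da : definite a).

Lemma orthogonal_remainder x y : exists c : R[i], a (x - c *: y) y = 0.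
Proof.
have [->|y0] := eqVneq y 0; first by exists 0; rewrite form0r.
have s0 : sqf a y != 0 by apply: contra_neq y0 => /da.
have s0C : a y y != 0.
  by apply: contra_neq s0 => e; rewrite /sqf e.
by exists (a x y / a y y); rewrite (formBl ha) (formZl ha) divfK// subrr.
Qed.

(** Gram-Schmidt: the remainder h of x is orthogonal to y and z, hence by hypothesis to x, hence to
    itself. *)
Lemma orthogonal_span2 x y z :
  (forall h, a h y = 0 -> a h z = 0 -> a x h = 0) ->
  exists c d : R[i], x = c *: y + d *: z.
Proof.
move=> H; have [e ey] := orthogonal_remainder z y.
set z' := z - e *: y in ey.
have [d dz] := orthogonal_remainder x z'.
have [c cy] := orthogonal_remainder (x - d *: z') y.
set h := x - d *: z' - c *: y in cy.
have yz : a y z' = 0 by rewrite (formC ha) ey conjc0.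
have hz' : a h z' = 0.
  by rewrite /h (formBl ha) dz (formZl ha) yz mulr0 subrr.
have hz : a h z = 0.
  have -> : z = z' + e *: y by rewrite subrK.
  by rewrite (formDr ha) (formZr ha) hz' cy mulr0 addr0.
have hx : a h h = 0.
  by rewrite {1}/h !(formBl ha) !(formZl ha) (H h cy hz) ![a _ h](formC ha) hz' cy conjc0 !mulr0 !subr0.
have h0 : h = 0 by apply: da; rewrite /sqf hx.
exists (c - d * e), d.
apply/eqP; rewrite -subr_eq0; apply/eqP; rewrite -[RHS]h0 /h /z'.
rewrite scalerBl scalerBr scalerA -[RHS]addrA -opprD; congr (x - _).
by rewrite [LHS]addrC addrA addrAC.
Qed.
End two_dimensional_span.

(** * The du Bois-Reymond lemma *)

Section du_bois_reymond.
Variable R : realType.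
Local Notation mu := (@lebesgue_measure R).
Local Notation I := (@unit_itv R).
Local Notation C := (R[i]).
Local Notation L2 := (L2 R).
Local Hint Resolve measurable_unit_itv : core.
Implicit Types (u v w : L2) (phi q : R -> R).
Let hd := @L2dot_form R.
Let dd := @L2dot_definite R.

(** P need not have compact support in ]0, 1[, but its rescalings do, and their derivatives differ
    from q by at most A sqrt(2 a) on I. *)
Lemma orthogonal_derivative w q (P : R -> R) (A : R) :
  (forall phi, test_function phi -> L2dot w (rL2 (derive1 phi)) = 0) ->
  (forall x y, `|q x - q y| <= A * Num.sqrt `|x - y|) ->
  (forall y : R, is_derive y (1 : R) P (q y)) -> (forall y, ~ I y -> P y = 0) ->
  L2dot w (rL2 q) = 0.
Proof.
move=> wt qA dP P0; have cq := holder_continuous qA.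
have A0 : 0 <= A.
  by have := qA 1 0; rewrite subr0 normr1 sqrtr1 mulr1; apply: le_trans.
have key (a : R) : 0 < a -> a <= 4^-1 ->
    cmod (L2dot w (rL2 q)) <= nrm (@L2dot R) w * (A * Num.sqrt (2 * a)).
  move=> a0 a4; have tP := rescaled_test cq dP P0 a0 a4.
  have := wt _ tP; rewrite (rescaled_derive1 dP a4) => w0.
  set qa := fun x => q _ in w0.
  have cqa : continuous qa.
    by rewrite /qa -(rescaled_derive1 dP a4); case: tP.
  have -> : L2dot w (rL2 q) = L2dot w (rL2 q - rL2 qa).
    by rewrite (formBr hd) w0 subr0.
  apply: le_trans (cauchy_schwarz hd _ _) _; rewrite ler_wpM2l ?nrm_ge0//.
  apply: (@nrm_le_sup _ _ (fun t => (q t - qa t)%:C)).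
  - by rewrite mulr_ge0 ?sqrtr_ge0.
  - apply: ae_eq_trans (L2funB _ _) _.
    by apply: filterS2 (rL2E cq) (rL2E cqa) => t e1 e2 It; rewrite e1// e2// -rmorphB.
  - move=> t It; rewrite cmod_real /qa; apply: le_trans (qA _ _) _.
    rewrite ler_wpM2l// ler_wsqrtr// distrC.
    exact: rescaled_arg_dist.
apply: cmod_eq0; apply/eqP; rewrite eq_le cmod_ge0 andbT leNgt; apply/negP.
set m := cmod _ => m0.
set N := nrm (@L2dot R) w * A.
have N0 : 0 <= N by rewrite mulr_ge0 ?nrm_ge0.
have N1 : 0 < N + 1 by rewrite ltr_wpDl.
(* With a = b^2 / 2 the error N sqrt(2 a) is N b <= m / 2, contradicting m > 0; the bound 1/2 on b
   gives a <= 1/4. *)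
pose b := Num.min 2^-1 (m / (2 * (N + 1))).
have b0 : 0 < b by rewrite lt_min invr_gt0 ltr0n /= divr_gt0 ?mulr_gt0.
have b2 : b <= 2^-1 by rewrite ge_min lexx.
have bm : b <= m / (2 * (N + 1)) by rewrite ge_min lexx orbT.
have /key : 0 < b ^+ 2 / 2 by rewrite divr_gt0 ?exprn_gt0.
have b4 : b ^+ 2 / 2 <= 4^-1 by rewrite expr2; nra.
move=> /(_ b4); rewrite (_ : 2 * (b ^+ 2 / 2) = b ^+ 2); last by field.
rewrite sqrtr_sqr gtr0_norm// mulrA -/N -/m.
move: bm; rewrite ler_pdivlMr ?mulr_gt0// => bm h.
have : N * b <= b * (2 * (N + 1)) / 2 by nra.
by move: m0 bm h; lra.
Qed.

Lemma Vop_Re_Im u :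
  Vop u = rL2 (fun x => Re (prim u x)) + (0 +i* 1) *: rL2 (fun x => Im (prim u x)).
Proof.
apply: L2P; apply: ae_eq_trans (VopE u) _; apply: ae_eq_sym.
apply: ae_eq_trans (L2funD _ _) _.
apply: filterS3 (L2funZ (0 +i* 1) (rL2 (fun x => Im (prim u x)))) (rL2E (@continuous_Re_prim R u)) (rL2E (@continuous_Im_prim R u)).
move=> t e1 e2 e3 It; rewrite e1// e2// e3//.
by apply/eqP; rewrite eq_complex ReD ImD ReM ImM /=; apply/andP; split; apply/eqP; ring.
Qed.

Lemma prim_const0 u (c : C) : Vop u = c *: one -> u = 0.
Proof.
move=> uc; apply: Vop_inj.
have p01 : prim u 0 = c.
  apply: (@prim_unique _ u (prim u) _ _ (fun=> c)).
  - by apply: continuous_subspaceT; exact: continuous_Re_prim.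
  - by apply: continuous_subspaceT; exact: continuous_Im_prim.
  - by apply: continuous_subspaceT => x; exact: cvg_cst.
  - by apply: continuous_subspaceT => x; exact: cvg_cst.
  - apply: ae_eq_trans (ae_eq_sym (VopE u)) _; rewrite uc.
    by apply: filterS2 (L2funZ c one) (oneE R) => t e1 e2 It; rewrite e1// e2// mulr1.
  - by rewrite lexx ler01.
by rewrite uc -p01 prim_le0// scale0r.
Qed.

(** Let w = u - [Vop v]. If h is orthogonal to 1 and to [Vadj one], then the second primitive of h
    vanishes at 0 and 1, so w is orthogonal to its derivative [Vop h], and [Vadj w] to h. Hence
    [Vadj w] is in the span of 1 and [Vadj one], and injectivity leaves w constant. *)
Lemma du_bois_reymond u v :
  weak_derivative u v -> exists c : C, u = Vop v + c *: one.
Proof.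
move=> uv; set w := u - Vop v.
have wt phi : test_function phi -> L2dot w (rL2 (derive1 phi)) = 0.
  have := weak_derivativeB uv (weak_derivative_Vop v 0).
  rewrite scale0r addr0 subrr => /weak_derivative_dot H /H ->.
  by rewrite (form0l hd) oppr0.
have wV h : L2dot h one = 0 -> L2dot h (Vadj one) = 0 -> L2dot (Vadj w) h = 0.
  move=> h1 h2; rewrite Vadj_adjoint Vop_Re_Im (formDr hd) (formZr hd).
  have Vh1 : L2dot (Vop h) one = 0 by rewrite Vop_adjoint.
  have p0 g y : L2dot g one = 0 -> ~ I y -> prim g y = 0.
    move=> g0; rewrite /unit_itv/= in_itv/= => /negP; rewrite negb_and -!leNgt.
    by case/orP => [/prim_le0->//|/prim_ge1->].
  have [iR iI] := sqint_integrable (sqint_prim h).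
  have [iR' iI'] := sqint_integrable (L2fun_sqint (Vop h)).
  have dR (y : R) : is_derive y (1 : R) (fun y => Re (prim (Vop h) y)) (Re (prim h y)).
    rewrite (_ : (fun y => _) = (fun y : R => \int[mu]_(s in I) (Re (prim h s) * lt1 s y))%R).
      apply: primitive_is_derive => //; first exact: continuous_Re_prim.
      by move=> t It; rewrite p0.
    apply/funext => z; rewrite [in LHS]/prim.
    rewrite (L2dotE (sqint_prim h) (sqint_indf z) (VopE h) (indE z)).
    by apply: eq_Rintegral => s _; rewrite conjc_real ReM /= mulr0 subr0.
  have dI (y : R) : is_derive y (1 : R) (fun y => Im (prim (Vop h) y)) (Im (prim h y)).
    rewrite (_ : (fun y => _) = (fun y : R => \int[mu]_(s in I) (Im (prim h s) * lt1 s y))%R).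
      apply: primitive_is_derive => //; first exact: continuous_Im_prim.
      by move=> t It; rewrite p0.
    apply/funext => z; rewrite [in LHS]/prim.
    rewrite (L2dotE (sqint_prim h) (sqint_indf z) (VopE h) (indE z)).
    by apply: eq_Rintegral => s _; rewrite conjc_real ImM /= mulr0 add0r.
  rewrite (orthogonal_derivative (A := nrm (@L2dot R) h) wt _ dR).
  - rewrite (orthogonal_derivative (A := nrm (@L2dot R) h) wt _ dI) ?mulr0 ?addr0//.
    + move=> x y; rewrite -mulrN_Im -ImD.
      exact: le_trans (Im_le_cmod _) (prim_holder _ _ _).
    + by move=> y Iy; rewrite p0.
  - move=> x y; rewrite -mulrN_Re -ReD.
    exact: le_trans (Re_le_cmod _) (prim_holder _ _ _).
  - by move=> y Iy; rewrite p0.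
have [c [d cd]] := orthogonal_span2 hd dd wV.
exists d; apply/eqP; rewrite addrC -subr_eq -/w; apply/eqP.
have z0 : w - d *: one = 0.
  have zc : Vadj (w - d *: one) = c *: one by rewrite linearB linearZ /= cd addrK.
  apply: (@prim_const0 _ (L2dot (w - d *: one) one - c)).
  by rewrite scalerBl -zc Vadj_Vop opprB [RHS]addrC subrK.
by apply/eqP; rewrite -subr_eq0 z0.
Qed.

End du_bois_reymond.

Section infinite_dimension.
Variables (R : realType) (U : lmodType R[i]) (a : U -> U -> R[i]).
Hypotheses (ha : hermitian_form a).

(** Some nontrivial combination of m + 1 of the e_k satisfies the m linear conditions. *)
Lemma orthogonal_infinite_dim (e : nat -> U) :
  (forall i j, i != j -> a (e i) (e j) = 0) -> (forall i, a (e i) (e i) != 0) ->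
  infinite_dim a.
Proof.
move=> eo e1 s; pose m := size s.
pose A : 'M[R[i]]_(m.+1, m) := \matrix_(i, j) a (e i) s`_j.
have kA : kermx A != 0.
  by rewrite -mxrank_eq0 mxrank_ker -lt0n subn_gt0 ltnS rank_leq_col.
have [i ri0] : exists i, row i (kermx A) != 0.
  apply/existsP; apply: contraNT kA; rewrite negb_exists => /forallP r0.
  by apply/eqP/row_matrixP => i; rewrite row0; apply/eqP; rewrite -[_ == _]negbK.
set c := row i (kermx A) in ri0.
have cA : c *m A = 0 by apply/sub_kermxP; exact: row_sub.
exists (\sum_(k < m.+1) c 0 k *: e k).
  apply: contra_neq ri0 => c0; apply/rowP => k; rewrite [RHS]mxE.
  have := congr1 (fun x => a x (e k)) c0; rewrite (form0l ha) (form_suml ha).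
  rewrite (bigD1 k)//= big1 => [|l lk]; last by rewrite (formZl ha) eo ?mulr0.
  rewrite addr0 (formZl ha) => /eqP; rewrite mulf_eq0 (negbTE (e1 _)) orbF.
  by move/eqP.
move=> y ys; have yj : (index y s < m)%N by rewrite /m index_mem.
have := congr1 (fun B : 'rV[R[i]]_m => B 0 (Ordinal yj)) cA; rewrite [LHS]mxE [RHS]mxE => <-.
rewrite (form_suml ha); apply: eq_bigr => k _.
by rewrite (formZl ha) [A _ _]mxE /= nth_index.
Qed.
End infinite_dimension.

(** * The inverse of the definite Kirchhoff Laplacian *)

Section star.
Variables (R : realType) (n : nat).
Local Notation C := (R[i]).
Local Notation L2 := (L2 R).
Local Notation L2G := (L2G R n).
Implicit Types (u v w : L2) (f g h p q : L2G).
Let hd := @L2dot_form R.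

Lemma L2Gdot_form : hermitian_form (@L2Gdot R n).
Proof. exact: (dot_hermitian (@L2Gdot R n)). Qed.

Lemma L2Gdot_definite : definite (@L2Gdot R n).
Proof. by move=> f; exact: (@dot_definite R L2G (@L2Gdot R n)). Qed.

Let hg := L2Gdot_form.
Let dg := L2Gdot_definite.

Lemma sqf_L2G f : sqf (@L2Gdot R n) f = \sum_j sqf (@L2dot R) (f j).
Proof. by rewrite /sqf Re_sum. Qed.

Lemma nrm_edge_le f j : nrm (@L2dot R) (f j) <= nrm (@L2Gdot R n) f.
Proof.
rewrite /nrm ler_wsqrtr// sqf_L2G (bigD1 j)//= lerDl.
by apply: sumr_ge0 => i _; exact: sqf_ge0.
Qed.

Lemma nrm_L2G_le f : nrm (@L2Gdot R n) f <= \sum_j nrm (@L2dot R) (f j).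
Proof.
rewrite -(ler_pXn2r (n := 2)) ?nnegrE ?nrm_ge0 ?sumr_ge0//; last first.
  by move=> j _; exact: nrm_ge0.
rewrite (nrm_sqr hg) sqf_L2G expr2 mulr_suml; apply: ler_sum => j _.
rewrite -(nrm_sqr hd) expr2 ler_wpM2l ?nrm_ge0// (bigD1 j)//= lerDl.
by apply: sumr_ge0 => i _; exact: nrm_ge0.
Qed.

Lemma L2G_complete : complete_form (@L2Gdot R n).
Proof.
move=> f cf.
have lim j : exists l, lims (@L2dot R) (fun k => f k j) l.
  apply: (@L2_complete R) => e e0; have [N fN] := cf e e0; exists N => k l Nk Nl.
  apply: le_trans (fN _ _ Nk Nl).
  by have := nrm_edge_le (f k - f l) j; rewrite !ffunE.
have /choice [l ll] := lim.
exists [ffun j => l j] => e e0.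
have e1 : 0 < e / n.+1%:R by rewrite divr_gt0.
have /choice [N NP] j := ll j _ e1.
exists (\max_j N j)%N => k Nk; apply: le_trans (nrm_L2G_le _) _.
apply: (@le_trans _ _ (\sum_(j < n) (e / n.+1%:R))).
  apply: ler_sum => j _; rewrite !ffunE; apply: NP.
  by apply: leq_trans Nk; exact: leq_bigmax.
rewrite sumr_const card_ord -[_ *+ n]mulr_natr mulrAC ler_pdivrMr ?ltr0n//.
by rewrite ler_wpM2l ?(ltW e0)// ler_nat.
Qed.

Section edgewise.
Variable T : {linear L2 -> L2}.
Definition edgewise f : L2G := [ffun j => T (f j)].

Lemma edgewise_linear : linear edgewise.
Proof. by move=> c f g; apply/ffunP => j; rewrite !ffunE linearP. Qed.
HB.instance Definition _ :=
  GRing.isLinear.Build C L2G L2G *:%R edgewise edgewise_linear.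

End edgewise.

Lemma edgewise_adjoint (S T : {linear L2 -> L2}) f g :
  (forall u v, L2dot (S u) v = L2dot u (T v)) ->
  L2Gdot (edgewise S f) g = L2Gdot f (edgewise T g).
Proof. by move=> ST; apply: eq_bigr => j _; rewrite !ffunE ST. Qed.

(* [- Vadj (h j)] has derivative [h j], so the functions [Vadj (h j)], which vanish
   at 1, agree at the central vertex iff [h] is balanced; dually, the excesses of
   [edgewise Vop p] are the derivatives of [Kop p] at the vertex, and add up to 0. *)
Definition flux h j : C := L2dot (h j) one.

Definition balanced h := forall i j, flux h i = flux h j.

Definition excess h j : C := flux h j - n%:R^-1 * \sum_i flux h i.

Definition balance h : L2G := [ffun j => h j - excess h j *: one].

Lemma excess_linear (c : C) f g j : excess (c *: f + g) j = c * excess f j + excess g j.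
Proof.
have fl i : flux (c *: f + g) i = c * flux f i + flux g i.
  by rewrite /flux !ffunE (formDl hd) (formZl hd).
rewrite /excess fl (eq_bigr _ (fun i _ => fl i)) big_split -mulr_sumr /=.
by rewrite mulrDr mulrBr mulrCA opprD addrACA.
Qed.

Lemma balance_linear : linear balance.
Proof.
move=> c f g; apply/ffunP => j; rewrite !ffunE excess_linear.
by rewrite scalerDl scalerBr scalerA opprD addrACA.
Qed.
HB.instance Definition _ :=
  GRing.isLinear.Build C L2G L2G *:%R balance balance_linear.

Hypothesis n_gt0 : (0 < n)%N.

Let nC0 : n%:R != 0 :> C.
Proof. by rewrite pnatr_eq0 -lt0n. Qed.

Lemma dot_one_one : L2dot one one = 1 :> C.
Proof. by rewrite -(prim_ge1 _ (lexx 1)) prim_one// ler01 lexx. Qed.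

Lemma excess_sum h : \sum_j excess h j = 0.
Proof.
rewrite /excess sumrB sumr_const card_ord -[_ *+ n]mulr_natl mulrA mulfV// mul1r.
exact: subrr.
Qed.

Lemma flux_balance h j : flux (balance h) j = n%:R^-1 * \sum_i flux h i.
Proof.
rewrite /flux ffunE (formBl hd) (formZl hd) dot_one_one mulr1 /excess opprB.
by rewrite addrC subrK.
Qed.

Lemma balance_balanced h : balanced (balance h).
Proof. by move=> i j; rewrite !flux_balance. Qed.

Lemma balanced_excess h j : balanced h -> excess h j = 0.
Proof.
move=> bh; rewrite /excess (eq_bigr (fun=> flux h j)); last by move=> i _; exact: bh.
by rewrite sumr_const card_ord -(mulr_natl (flux h j)) mulKf// subrr.
Qed.

Lemma balance_id h : balanced h -> balance h = h.
Proof.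
by move=> bh; apply/ffunP => j; rewrite ffunE balanced_excess// scale0r subr0.
Qed.

Lemma balanceE h : h = balance h + [ffun j => excess h j *: one].
Proof. by apply/ffunP => j; rewrite !ffunE subrK. Qed.

(** [balance] is the orthogonal projection onto balanced functions: it removes constants on the
    edges with sum 0, which a balanced f pairs with its common flux. *)
Lemma balanced_dot_balance f g : balanced f -> L2Gdot f (balance g) = L2Gdot f g.
Proof.
move=> bf; rewrite [in RHS](balanceE g) (formDr hg).
rewrite [X in _ = _ + X](_ : _ = 0) ?addr0//.
have j0 : 'I_n by exact: Ordinal n_gt0.
rewrite /L2Gdot (eq_bigr (fun j => flux f j0 * conjc (excess g j))).
  by rewrite -mulr_sumr -rmorph_sum excess_sum rmorph0 mulr0.
by move=> j _; rewrite ffunE (formZr hd) mulrC (bf j0 j).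
Qed.

Lemma nrm_balance h : nrm (@L2Gdot R n) (balance h) <= nrm (@L2Gdot R n) h.
Proof.
have [->|b0] := eqVneq (nrm (@L2Gdot R n) (balance h)) 0; first exact: nrm_ge0.
have b1 : 0 < nrm (@L2Gdot R n) (balance h) by rewrite lt_neqAle eq_sym b0 nrm_ge0.
rewrite -(ler_pM2l b1) -expr2 (nrm_sqr hg) /sqf.
rewrite (balanced_dot_balance _ (balance_balanced h)).
by apply: le_trans (ler_norm _) _; apply: le_trans (Re_le_cmod _) (cauchy_schwarz hg _ _).
Qed.

Lemma nrm_edgewise (T : {linear L2 -> L2}) (M : R) f : 0 <= M ->
  (forall u, nrm (@L2dot R) (T u) <= M * nrm (@L2dot R) u) ->
  nrm (@L2Gdot R n) (edgewise T f) <= M * nrm (@L2Gdot R n) f.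
Proof.
move=> M0 TM; rewrite -(ler_pXn2r (n := 2)) ?nnegrE ?mulr_ge0 ?nrm_ge0//.
rewrite exprMn !(nrm_sqr hg) !sqf_L2G mulr_sumr; apply: ler_sum => j _.
by rewrite ffunE -!(nrm_sqr hd) -exprMn ler_pXn2r ?nnegrE ?mulr_ge0 ?nrm_ge0.
Qed.

(** The inverse Laplacian factored through an orthogonal projection; symmetry, positivity and the
    energy [Kop_energy] follow from this shape. *)
Definition Kop : {linear L2G -> L2G} :=
  [the {linear L2G -> L2G} of edgewise Vadj \o (balance \o edgewise Vop)].

Lemma Kop_energy p q : energy (@L2Gdot R n) Kop p q =
  L2Gdot (balance (edgewise Vop p)) (balance (edgewise Vop q)).
Proof.
rewrite /energy (edgewise_adjoint _ _ (@Vadj_adjoint R)).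
by rewrite (balanced_dot_balance _ (balance_balanced _)).
Qed.

Lemma nrm_Kop_energy p : nrm (energy (@L2Gdot R n) Kop) p =
  nrm (@L2Gdot R n) (balance (edgewise Vop p)).
Proof. by rewrite /nrm /sqf Kop_energy. Qed.

Lemma Kop_symmetric : symmetric_op (@L2Gdot R n) Kop.
Proof.
move=> p q; rewrite -[LHS]/(energy _ Kop p q) [RHS](formC hg).
rewrite -[X in _ = conjc X]/(energy (@L2Gdot R n) Kop q p) !Kop_energy.
exact: (formC hg).
Qed.

Lemma Kop_ge0 p : 0 <= Re (L2Gdot (Kop p) p).
Proof.
by rewrite -[L2Gdot _ _]/(energy (@L2Gdot R n) Kop p p) Kop_energy; exact: (sqf_ge0 hg).
Qed.

Lemma Kop_definite : definite (energy (@L2Gdot R n) Kop).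
Proof.
move=> p; rewrite /sqf Kop_energy => /dg b0; apply/ffunP => j; rewrite [RHS]ffunE.
apply: (@prim_const0 _ _ (excess (edgewise Vop p) j)).
have := congr1 (fun f : L2G => f j) b0; rewrite !ffunE => /eqP.
by rewrite subr_eq0 => /eqP.
Qed.

Lemma nrm_Vadj u : nrm (@L2dot R) (Vadj u) <= 1 * nrm (@L2dot R) u.
Proof.
rewrite mul1r; apply: (nrm_le_sup _ (VadjE u)); first exact: nrm_ge0.
move=> t /=; rewrite /unit_itv/= in_itv/= => /andP[t0 t1].
rewrite /coprim -(prim_ge1 _ (lexx 1)); apply: le_trans (prim_holder _ _ _) _.
rewrite ler_piMr ?nrm_ge0// -[leRHS]sqrtr1 ler_wsqrtr// ger0_norm.
  by rewrite gerBl ltW.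
by rewrite subr_ge0 ltW.
Qed.

Lemma nrm_Kop p : nrm (@L2Gdot R n) (Kop p) <= 1 * nrm (@L2Gdot R n) p.
Proof.
apply: le_trans (nrm_edgewise _ ler01 nrm_Vadj) _; rewrite ler_wpM2l//.
apply: le_trans (nrm_balance _) _; rewrite -[leRHS]mul1r.
by apply: nrm_edgewise => // u; rewrite mul1r nrm_Vop.
Qed.

(** The energy norm is the norm of the argument of the outer [Vadj], so its compactness on each edge
    suffices. *)
Lemma Kop_compact (x : nat -> L2G) :
  (forall k, nrm (energy (@L2Gdot R n) Kop) (x k) <= 1) ->
  exists q, cluster_point (@L2Gdot R n) (Kop \o x) q.
Proof.
move=> x1; have [U [uU subU]] := @ultraFilterLemma nat \oo _.
pose h k := balance (edgewise Vop (x k)).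
have h1 k j : nrm (@L2dot R) (h k j) <= 1.
  by apply: le_trans (nrm_edge_le _ _) _; rewrite -nrm_Kop_energy.
have /choice [q qP] j := Vadj_compact uU (fun k => h1 k j).
exists [ffun j => q j] => e e0 N.
have e1 : 0 < e / n.+1%:R by rewrite divr_gt0.
have pU : ProperFilter U by exact: ultra_proper.
have UN : U [set k | (N <= k)%N] by apply: subU; exists N.
have Uq : U [set k | forall j, nrm (@L2dot R) (Vadj (h k j) - q j) <= e / n.+1%:R].
  exact: (@filter_forall _ 'I_n _ U _ (fun j => qP j _ e1)).
have [k [Nk kq]] := filter_ex (filterI UN Uq).
exists k => //; apply: le_trans (nrm_L2G_le _) _.
apply: (@le_trans _ _ (\sum_(j < n) (e / n.+1%:R))).
  by apply: ler_sum => j _; have := kq j; rewrite !ffunE.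
rewrite sumr_const card_ord -[_ *+ n]mulr_natr mulrAC ler_pdivrMr ?ltr0n//.
by rewrite ler_wpM2l ?(ltW e0)// ler_nat.
Qed.

Lemma dot_ind (x y : R) : 0 <= x <= 1 -> 0 <= y <= 1 ->
  L2dot (ind x) (ind y) = (Num.min x y)%:C.
Proof. exact: prim_ind. Qed.

Lemma L2G_infinite_dim : infinite_dim (@L2Gdot R n).
Proof.
pose j0 : 'I_n := Ordinal n_gt0.
pose b k : R := k.+1%:R^-1.
have b01 k : 0 <= b k <= 1.
  by rewrite invr_ge0 ler0n /= invf_le1 ?ltr0n// ler1n.
have bS k l : (k <= l)%N -> b l <= b k.
  by move=> kl; rewrite lef_pV2 ?posrE ?ltr0n// ler_nat.
(* Indicators of the disjoint intervals [1 / (k + 2), 1 / (k + 1)[ on a single edge. *)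
pose e k : L2G := [ffun j => if j == j0 then ind (b k) - ind (b k.+1) else 0].
have eE k l : L2Gdot (e k) (e l) =
    (Num.min (b k) (b l) - Num.min (b k) (b l.+1) -
     (Num.min (b k.+1) (b l) - Num.min (b k.+1) (b l.+1)))%:C.
  rewrite /L2Gdot (bigD1 j0)//= big1 => [|j /negbTE jj]; last first.
    by rewrite !ffunE jj (form0l hd).
  by rewrite addr0 !ffunE eqxx (formBl hd) !(formBr hd) !dot_ind// !rmorphB.
have lt_e k l : (k < l)%N -> L2Gdot (e k) (e l) = 0.
  move=> kl; rewrite eE !min_r ?bS ?(ltnW kl) ?(leqW kl) ?(leqW (ltnW kl))//.
  by rewrite !subrr.
refine (@orthogonal_infinite_dim _ _ _ hg e _ _) => [k l|k].
  rewrite neq_ltn => /orP[|] kl; first exact: lt_e.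
  by rewrite (formC hg) lt_e// conjc0.
rewrite eE minxx (min_l (bS _ _ (leqnSn k))) (min_r (bS _ _ (leqnSn k))) minxx subrr subr0.
have : b k.+1 < b k by rewrite ltf_pV2 ?posrE ?ltr0n// ltr_nat.
rewrite -subr_gt0 => /lt0r_neq0; apply: contra_neq => h.
by have := congr1 Re h.
Qed.

End star.

(** * The coupled form *)

Section finite_sums.
Variables (R : realType) (U : lmodType R[i]) (a : U -> U -> R[i]).
Hypotheses (ha : hermitian_form a).

Lemma sqf_sum_le m (F : 'I_m -> U) :
  sqf a (\sum_i F i) <= m%:R * \sum_i sqf a (F i).
Proof.
rewrite -(nrm_sqr ha); set x := fun i => nrm a (F i).
have x0 i : 0 <= x i by exact: nrm_ge0.
apply: (@le_trans _ _ ((\sum_i x i) ^+ 2)).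
  by rewrite ler_pXn2r ?nnegrE ?nrm_ge0 ?sumr_ge0// nrm_sum_le.
have -> : \sum_i sqf a (F i) = \sum_i x i ^+ 2.
  by apply: eq_bigr => i _; rewrite -(nrm_sqr ha).
set S := \sum_i x i ^+ 2.
(* Compared termwise with 2 x_i x_j, whose double sum is twice the square of the sum. *)
have E : \sum_i \sum_j (x i ^+ 2 + x j ^+ 2) = 2 * (m%:R * S).
  rewrite (eq_bigr (fun i => m%:R * x i ^+ 2 + S)) => [|i _]; last first.
    by rewrite big_split sumr_const card_ord /= mulr_natl.
  rewrite big_split -mulr_sumr -/S sumr_const card_ord /= -(mulr_natl S).
  by ring.
rewrite -(ler_pM2l (ltr0Sn R 1)) -E expr2 mulr_suml mulr_sumr.
apply: ler_sum => i _; rewrite !mulr_sumr; apply: ler_sum => j _.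
by have := sqr_ge0 (x i - x j); nra.
Qed.
End finite_sums.

Section coupling.
Variables (R : realType) (np nm : nat).
Hypotheses (np_gt0 : (0 < np)%N) (nm_gt0 : (0 < nm)%N).
Local Notation n := (np + nm)%N.
Local Notation C := (R[i]).
Local Notation L2 := (L2 R).
Local Notation L2G := (L2G R n).
Implicit Types (u v w : L2) (f g h p q : L2G).
Let hd := @L2dot_form R.
Let hg := @L2Gdot_form R n.

Definition edge_sign (j : 'I_n) : C := if (j < np)%N then 1 else -1.

Definition flip f : L2G := [ffun j => edge_sign j *: f j].

Lemma flip_linear : linear flip.
Proof.
by move=> c f g; apply/ffunP => j; rewrite !ffunE scalerDr !scalerA mulrC.
Qed.
HB.instance Definition _ :=
  GRing.isLinear.Build C L2G L2G *:%R flip flip_linear.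

Lemma edge_sign_lshift (i : 'I_np) : edge_sign (lshift nm i) = 1.
Proof. by rewrite /edge_sign /= ltn_ord. Qed.

Lemma edge_sign_rshift (i : 'I_nm) : edge_sign (rshift np i) = -1.
Proof. by rewrite /edge_sign /= ltnNge leq_addr. Qed.

Lemma conj_edge_sign j : conjc (edge_sign j) = edge_sign j.
Proof. by rewrite /edge_sign; case: ifP => _; rewrite ?rmorphN rmorph1. Qed.

Lemma flip_involutive : involutive flip.
Proof.
move=> f; apply/ffunP => j; rewrite !ffunE scalerA /edge_sign.
by case: ifP; rewrite ?mulrNN mulr1 scale1r.
Qed.

Lemma flip_symmetric : symmetric_op (@L2Gdot R n) flip.
Proof.
move=> f g; apply: eq_bigr => j _.
by rewrite !ffunE (formZl hd) (formZr hd) conj_edge_sign.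
Qed.

Definition plus_sum f : L2 := \sum_(i < np) f (lshift nm i).
Definition minus_sum f : L2 := \sum_(i < nm) f (rshift np i).

Lemma plus_sum_linear : linear plus_sum.
Proof.
move=> c f g; rewrite /plus_sum scaler_sumr -big_split; apply: eq_bigr => i _.
by rewrite !ffunE.
Qed.
HB.instance Definition _ :=
  GRing.isLinear.Build C L2G L2 *:%R plus_sum plus_sum_linear.

Lemma minus_sum_linear : linear minus_sum.
Proof.
move=> c f g; rewrite /minus_sum scaler_sumr -big_split; apply: eq_bigr => i _.
by rewrite !ffunE.
Qed.
HB.instance Definition _ :=
  GRing.isLinear.Build C L2G L2 *:%R minus_sum minus_sum_linear.

Lemma plus_sum_edgewise (T : {linear L2 -> L2}) f :
  plus_sum (edgewise T f) = T (plus_sum f).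
Proof. by rewrite /plus_sum linear_sum; apply: eq_bigr => i _; rewrite ffunE. Qed.

Lemma minus_sum_edgewise (T : {linear L2 -> L2}) f :
  minus_sum (edgewise T f) = T (minus_sum f).
Proof. by rewrite /minus_sum linear_sum; apply: eq_bigr => i _; rewrite ffunE. Qed.

Lemma plus_sum_flip f : plus_sum (flip f) = plus_sum f.
Proof. by apply: eq_bigr => i _; rewrite ffunE edge_sign_lshift scale1r. Qed.

Lemma minus_sum_flip f : minus_sum (flip f) = - minus_sum f.
Proof.
rewrite /minus_sum -sumrN; apply: eq_bigr => i _.
by rewrite ffunE edge_sign_rshift scaleN1r.
Qed.

Lemma nrm_plus_sum f : nrm (@L2dot R) (plus_sum f) <= np%:R * nrm (@L2Gdot R n) f.
Proof.
apply: le_trans (nrm_sum_le hd _ _ _) _.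
apply: (@le_trans _ _ (\sum_(i < np) nrm (@L2Gdot R n) f)).
  by apply: ler_sum => i _; exact: nrm_edge_le.
by rewrite sumr_const card_ord mulr_natl.
Qed.

Lemma nrm_minus_sum f : nrm (@L2dot R) (minus_sum f) <= nm%:R * nrm (@L2Gdot R n) f.
Proof.
apply: le_trans (nrm_sum_le hd _ _ _) _.
apply: (@le_trans _ _ (\sum_(i < nm) nrm (@L2Gdot R n) f)).
  by apply: ler_sum => i _; exact: nrm_edge_le.
by rewrite sumr_const card_ord mulr_natl.
Qed.

Lemma nrm_flip f : nrm (@L2Gdot R n) (flip f) = nrm (@L2Gdot R n) f.
Proof. by rewrite /nrm /sqf flip_symmetric flip_involutive. Qed.

(* For this s one has np / s = 1 / 4, and gam below solves 2 + gam (nm + np / s) = 0. *)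
Let s : R := (4 * np)%:R.

Let s1 : 1 <= s.
Proof. by rewrite /s ler1n muln_gt0. Qed.

Let s0 : 0 < s. Proof. exact: lt_le_trans ltr01 s1. Qed.

Let si1 : s^-1 <= 1. Proof. by rewrite invf_le1. Qed.

Let si0 : 0 <= s^-1. Proof. by rewrite invr_ge0 ltW. Qed.

Let Smul u : L2 := Sop s1 (Mop u).
(** P and Q are the bounded operators through which the adjoint of D = [Smul], respectively D, act
    on primitives: V D' = P V and V D = Q V, where V = [Vop] and D' is the adjoint. *)
Let P u : L2 := Mop (Eop s1 u) + Vop (Eop s1 u).
Let Q u : L2 := (s^-1)%:C *: Sop s1 (Mop u) + Vop (Sop s1 u).

Let P_D u v : P (u + v) = P u + P v.
Proof. by rewrite /P !linearD /= addrACA. Qed.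

Let L2_linZ (T : {linear L2 -> L2}) (c : C) u : T (c *: u) = c *: T u.
Proof. exact: linearZ. Qed.

Let P_Z (c : C) u : P (c *: u) = c *: P u.
Proof. by rewrite /P !linearZ /= scalerDr. Qed.

Let Q_D u v : Q (u + v) = Q u + Q v.
Proof. by rewrite /Q !linearD /= addrACA. Qed.

Let Q_Z (c : C) u : Q (c *: u) = c *: Q u.
Proof.
rewrite /Q (L2_linZ Mop) !(L2_linZ (Sop s1)) (L2_linZ Vop) scalerDr !scalerA.
by congr (_ *: _ + _); exact: mulrC.
Qed.

Let P_one : P one = one.
Proof. by rewrite /P Eop_one Mop_Vop_one. Qed.

Let Q_one : Q one = (s^-1)%:C *: one.
Proof. exact: Sop_Mop_one. Qed.

Let Smul_Vadj u v : L2dot (Smul (Vadj u)) v = L2dot u (P (Vop v)).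
Proof.
rewrite /Smul Sop_adjoint Mop_adjoint Vadj_adjoint Vop_Mop_Eop (formZr hd).
by rewrite conjc_real mulrA -rmorphM mulVf ?gt_eqF// rmorph1 mul1r.
Qed.

Let Vadj_Smul u v : L2dot (Vadj u) (Smul v) = L2dot u (Q (Vop v)).
Proof. by rewrite Vadj_adjoint /Smul Vop_Sop_Mop. Qed.

Let nrm_Sop u : nrm (@L2dot R) (Sop s1 u) <= nrm (@L2dot R) u.
Proof.
rewrite /nrm ler_wsqrtr//; apply: le_trans (sqf_Dil _ _) _.
by rewrite ler_piMl ?(sqf_ge0 hd).
Qed.

Let sqf_Smul u : sqf (@L2dot R) (Smul u) <= s^-1 * sqf (@L2dot R) u.
Proof.
apply: le_trans (sqf_Dil _ _) _; rewrite ler_wpM2l// -!(nrm_sqr hd).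
by rewrite ler_pXn2r ?nnegrE ?nrm_ge0// nrm_Mop.
Qed.

Let nrm_Eop u : nrm (@L2dot R) (Eop s1 u) <= s * nrm (@L2dot R) u.
Proof.
rewrite -(ler_pXn2r (n := 2)) ?nnegrE ?mulr_ge0 ?nrm_ge0 ?(ltW s0)//.
rewrite exprMn !(nrm_sqr hd); apply: le_trans (sqf_Dil _ _) _.
by rewrite invrK ler_wpM2r ?(sqf_ge0 hd)// expr2 ler_peMl ?(ltW s0).
Qed.

Let nrm_P u : nrm (@L2dot R) (P u) <= 2 * s * nrm (@L2dot R) u.
Proof.
apply: le_trans (nrm_triangle hd _ _) _.
rewrite -mulrA mulr_natl mulr2n; apply: lerD.
  exact: le_trans (nrm_Mop _) (nrm_Eop _).
exact: le_trans (nrm_Vop _) (nrm_Eop _).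
Qed.

Let nrm_Q u : nrm (@L2dot R) (Q u) <= 2 * nrm (@L2dot R) u.
Proof.
apply: le_trans (nrm_triangle hd _ _) _.
rewrite mulr_natl mulr2n; apply: lerD; last exact: le_trans (nrm_Vop _) (nrm_Sop _).
rewrite (nrmZ hd) cmod_real ger0_norm// -[leRHS]mul1r ler_pM ?nrm_ge0//.
exact: le_trans (nrm_Sop _) (nrm_Mop _).
Qed.

Let gam : R := - (8 / (4 * nm%:R + 1)).

Definition coupled f g : C := L2Gdot f g +
  gam%:C * (L2dot (Smul (minus_sum f)) (plus_sum g) +
            L2dot (plus_sum f) (Smul (minus_sum g))).

Lemma coupled_linear (c : C) f f' g :
  coupled (c *: f + f') g = c * coupled f g + coupled f' g.
Proof.
rewrite /coupled /Smul !linearP /= (formDl hg) (formZl hg) !(formDl hd) !(formZl hd).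
by move: gam%:C (L2Gdot _ _) (L2Gdot _ _) (L2dot _ _) (L2dot _ _) (L2dot _ _) (L2dot _ _) => *; ring.
Qed.

Lemma coupledC f g : coupled g f = conjc (coupled f g).
Proof.
have cE (x y z : C) : conjc (x + gam%:C * (y + z)) = conjc x + gam%:C * (conjc z + conjc y).
  case: x y z => [x1 x2] [y1 y2] [z1 z2]; apply/eqP; rewrite eq_complex /=.
  by apply/andP; split; apply/eqP; ring.
rewrite /coupled cE -(formC hg) -!(formC hd).
exact: erefl.
Qed.

(** x and y are the squared norms on the positive and negative edges. After multiplication by 4 nm +
    1 the coupling is - 16 r with r <= a b; the factor 1 / s in [sqf_Smul] makes it small enough to
    leave x + y. *)
Lemma coupled_coercive f :
  (4 * nm%:R + 1)^-1 * sqf (@L2Gdot R n) f <= Re (coupled f f).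
Proof.
pose x := \sum_(i < np) sqf (@L2dot R) (f (lshift nm i)).
pose y := \sum_(i < nm) sqf (@L2dot R) (f (rshift np i)).
have x0 : 0 <= x by apply: sumr_ge0 => i _; exact: sqf_ge0.
have y0 : 0 <= y by apply: sumr_ge0 => i _; exact: sqf_ge0.
have fE : sqf (@L2Gdot R n) f = x + y by rewrite sqf_L2G big_split_ord.
pose a := nrm (@L2dot R) (Smul (minus_sum f)).
pose b := nrm (@L2dot R) (plus_sum f).
have a0 : 0 <= a by exact: nrm_ge0.
have b0 : 0 <= b by exact: nrm_ge0.
pose r := Re (L2dot (Smul (minus_sum f)) (plus_sum f)).
have rab : r <= a * b.
  apply: le_trans (ler_norm _) _; apply: le_trans (Re_le_cmod _) _.
  exact: cauchy_schwarz.
have ay : 4 * np%:R * a ^+ 2 <= nm%:R * y.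
  rewrite -natrM -/s -ler_pdivlMl// /a (nrm_sqr hd).
  apply: le_trans (sqf_Smul _) _; rewrite ler_wpM2l//; exact: sqf_sum_le.
have bx : b ^+ 2 <= np%:R * x by rewrite /b (nrm_sqr hd); exact: sqf_sum_le.
have np1 : 1 <= np%:R :> R by rewrite ler1n.
have nm1 : 1 <= nm%:R :> R by rewrite ler1n.
have -> : Re (coupled f f) = x + y + gam * (2 * r).
  rewrite /coupled ReD ReZ ReD -/r -[Re (L2Gdot _ _)]/(sqf _ f) fE.
  by rewrite [L2dot (plus_sum f) _](formC hd) ReJ -/r mulr_natl mulr2n.
(* From (2 np a - b)^2 >= 0 with the bounds [ay] and [bx], divided by np. *)
have ab : 16 * (a * b) <= 4 * nm%:R * y + 4 * x.
  have h := sqr_ge0 (2 * np%:R * a - b).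
  have np0 : 0 < np%:R :> R by exact: lt_le_trans np1.
  have : np%:R * (4 * (a * b)) <= np%:R * (nm%:R * y + x).
    have := ler_wpM2l (ltW np0) ay.
    by move: h bx; set N := np%:R; lra.
  by rewrite ler_pM2l//; lra.
have k0 : 0 < 4 * nm%:R + 1 :> R by rewrite addr_gt0// mulr_gt0// (lt_le_trans ltr01).
rewrite fE -(ler_pM2l k0) mulVKf ?gt_eqF// mulrDr.
have -> : (4 * nm%:R + 1) * (gam * (2 * r)) = - (16 * r).
  by rewrite /gam; field; rewrite gt_eqF.
have : x <= nm%:R * x by rewrite ler_peMl.
by move: rab ab; lra.
Qed.

Lemma coupled_form : hermitian_form (fun p q => coupled (Kop R n p) (Kop R n q)).
Proof.
split=> [c x y z|x y|x]; first by rewrite linearP coupled_linear.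
  exact: coupledC.
apply: le_trans (coupled_coercive _); apply: mulr_ge0; last exact: (sqf_ge0 hg).
by rewrite invr_ge0 addr_ge0// mulr_ge0.
Qed.

(** The right side involves q only through g, whose norm is the energy norm of q. The excesses of
    [Vop q] enter with m times the conjugate of dp: 2 from <.,.>, nm from P one = one and np / s
    from Q one = one / s, the last two weighted by [gam]. *)
Lemma coupled_Vadj h q (g := balance (edgewise Vop q)) : balanced h ->
  coupled (edgewise Vadj h) (flip q) = L2Gdot h (flip g) +
    gam%:C * (L2dot (minus_sum h) (P (plus_sum g)) -
              L2dot (plus_sum h) (Q (minus_sum g))).
Proof.
move=> bh; pose j0 : 'I_n := lshift nm (Ordinal np_gt0).
pose e := excess (edgewise Vop q).
pose dp := \sum_(i < np) e (lshift nm i); pose dm := \sum_(i < nm) e (rshift np i).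
have n_gt0 : (0 < n)%N by rewrite addn_gt0 np_gt0.
have dpm : dm = - dp.
  have := excess_sum n_gt0 (edgewise Vop q); rewrite big_split_ord /= -/e -/dp -/dm.
  by rewrite addrC => /eqP; rewrite addr_eq0 => /eqP.
have VE : edgewise Vop q = g + [ffun j => e j *: one] by exact: balanceE.
have pV : Vop (plus_sum q) = plus_sum g + dp *: one.
  rewrite -plus_sum_edgewise VE linearD; congr (_ + _).
  by rewrite /dp scaler_suml; apply: eq_bigr => i _; rewrite ffunE.
have mV : Vop (minus_sum q) = minus_sum g + dm *: one.
  rewrite -minus_sum_edgewise VE linearD; congr (_ + _).
  by rewrite /dm scaler_suml; apply: eq_bigr => i _; rewrite ffunE.
set m := flux h j0.
have hp : L2dot (plus_sum h) one = np%:R * m.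
  rewrite (form_suml hd) (eq_bigr (fun=> m)) => [|i _]; last exact: bh.
  by rewrite sumr_const card_ord mulr_natl.
have hm : L2dot (minus_sum h) one = nm%:R * m.
  rewrite (form_suml hd) (eq_bigr (fun=> m)) => [|i _]; last exact: bh.
  by rewrite sumr_const card_ord mulr_natl.
have t1 : L2Gdot (edgewise Vadj h) (flip q) = L2Gdot h (flip g) + 2 * m * conjc dp.
  rewrite -(flip_symmetric (edgewise _ _)).
  have -> : flip (edgewise Vadj h) = edgewise Vadj (flip h).
    by apply/ffunP => j; rewrite !ffunE linearZ.
  rewrite (edgewise_adjoint _ _ (@Vadj_adjoint R)) VE (formDr hg) flip_symmetric.
  congr (_ + _).
  rewrite flip_symmetric /L2Gdot big_split_ord /=.
  rewrite (eq_bigr (fun i => m * conjc (e (lshift nm i)))) => [|i _]; last first.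
    rewrite !ffunE edge_sign_lshift scale1r (formZr hd) mulrC; congr (_ * _).
    exact: bh.
  rewrite -mulr_sumr -rmorph_sum -/dp.
  rewrite (eq_bigr (fun i => - m * conjc (e (rshift np i)))) => [|i _]; last first.
    rewrite !ffunE edge_sign_rshift scaleN1r (formNr hd) (formZr hd) mulNr mulrC.
    by congr (- (_ * _)); exact: bh.
  rewrite -mulr_sumr -rmorph_sum -/dm dpm rmorphN mulrNN -mulrDl.
  by rewrite mulr_natl mulr2n.
have t2 : L2dot (Smul (minus_sum (edgewise Vadj h))) (plus_sum (flip q)) =
    L2dot (minus_sum h) (P (plus_sum g)) + conjc dp * (nm%:R * m).
  rewrite minus_sum_edgewise plus_sum_flip Smul_Vadj pV P_D P_Z P_one.
  by rewrite (formDr hd) (formZr hd) hm.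
have t3 : L2dot (plus_sum (edgewise Vadj h)) (Smul (minus_sum (flip q))) =
    - L2dot (plus_sum h) (Q (minus_sum g)) + conjc dp * ((s^-1)%:C * (np%:R * m)).
  rewrite plus_sum_edgewise minus_sum_flip Vadj_Smul linearN mV.
  rewrite -scaleN1r Q_Z scaleN1r (formNr hd) Q_D Q_Z Q_one scalerA.
  rewrite (formDr hd) (formZr hd) hp dpm conjc_Mreal rmorphN opprD.
  by rewrite !mulNr opprK -mulrA.
rewrite /coupled t1 t2 t3.
(* The total coefficient of m * [conjc dp]; its vanishing is what determines [gam]. *)
have cancel : 2 + gam%:C * (nm%:R + (s^-1)%:C * np%:R) = 0 :> C.
  have cR : 2 + gam * (nm%:R + s^-1 * np%:R) = 0 :> R.
    rewrite /gam /s natrM; field.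
    by rewrite gt_eqF ?ltr0n// gt_eqF// addr_gt0// mulr_gt0// ltr0n.
  have := congr1 (real_complex R) cR.
  by rewrite !(rmorphD, rmorphM, rmorph_nat, rmorph0).
move: cancel; move: (L2Gdot _ _) (L2dot _ _) (L2dot _ _) (gam%:C) ((s^-1)%:C) (conjc dp) => X Z Y ga si d.
move: (m) (np%:R : C) (nm%:R : C) => m' N M cancel.
have -> : X + 2 * m' * d + ga * (Y + d * (M * m') + (- Z + d * (si * (N * m')))) =
  X + ga * (Y - Z) + m' * d * (2 + ga * (M + si * N)) by ring.
by rewrite cancel mulr0 addr0.
Qed.

Lemma coupled_bound : exists2 K : R, 0 <= K & forall p q,
  cmod (coupled (Kop R n p) (flip q)) <=
  K * (nrm (energy (@L2Gdot R n) (Kop R n)) p * nrm (energy (@L2Gdot R n) (Kop R n)) q).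
Proof.
(* 2 s and 2 bound P and Q; np and nm bound the sums over the edges of each sign. *)
exists (1 + `|gam| * (nm%:R * (2 * s * np%:R) + np%:R * (2 * nm%:R))).
  by rewrite !(addr_ge0, mulr_ge0)// ltW.
have n_gt0 : (0 < n)%N by rewrite addn_gt0 np_gt0.
move=> p q; rewrite !(nrm_Kop_energy n_gt0).
set h := balance (edgewise Vop p); set g := balance (edgewise Vop q).
rewrite (_ : Kop R n p = edgewise Vadj h)// coupled_Vadj; last exact: balance_balanced.
set X := nrm _ h; set Y := nrm _ g.
have X0 : 0 <= X by exact: nrm_ge0.
have Y0 : 0 <= Y by exact: nrm_ge0.
apply: le_trans (cmodD _ _) _; rewrite mulrDl mul1r; apply: lerD.
  by apply: le_trans (cauchy_schwarz hg _ _) _; rewrite nrm_flip.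
rewrite cmodM cmod_real -[leRHS]mulrA ler_wpM2l// mulrDl.
apply: le_trans (cmodD _ _) _; rewrite cmodN; apply: lerD.
  apply: le_trans (cauchy_schwarz hd _ _) _.
  rewrite (_ : nm%:R * (2 * s * np%:R) * (X * Y) = (nm%:R * X) * (2 * s * (np%:R * Y))); last by ring.
  apply: ler_pM; [exact: nrm_ge0|exact: nrm_ge0|exact: nrm_minus_sum|]; apply: le_trans (nrm_P _) _.
  by apply: ler_wpM2l; [rewrite mulr_ge0// ltW|exact: nrm_plus_sum].
apply: le_trans (cauchy_schwarz hd _ _) _.
rewrite (_ : np%:R * (2 * nm%:R) * (X * Y) = (np%:R * X) * (2 * (nm%:R * Y))); last by ring.
apply: ler_pM; [exact: nrm_ge0|exact: nrm_ge0|exact: nrm_plus_sum|]; apply: le_trans (nrm_Q _) _.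
by apply: ler_wpM2l; [|exact: nrm_minus_sum].
Qed.

End coupling.

(** * The graph of the indefinite Kirchhoff Laplacian *)

Section boundary_values.
Variable R : realType.
Local Notation L2 := (L2 R).
Local Notation C := (R[i]).
Implicit Types (u v : L2).

Lemma boundary_value_unique u x (z z' : C) : 0 <= x <= 1 ->
  boundary_value u x z -> boundary_value u x z' -> z = z'.
Proof.
move=> x01 [c [cR cI uc <-]] [c' [cR' cI' uc' <-]].
apply: (@prim_unique _ u c cR cI c' cR' cI' _ x x01).
exact: ae_eq_trans (ae_eq_sym uc) uc'.
Qed.

Lemma boundary_value_Vop v (c : C) x : boundary_value (Vop v + c *: one) x (prim v x + c).
Proof.
exists (fun t => prim v t + c); split=> //.
- apply: continuous_subspaceT => t; under eq_fun do rewrite ReD.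
  by apply: cvgD; [exact: continuous_Re_prim|exact: cvg_cst].
- apply: continuous_subspaceT => t; under eq_fun do rewrite ImD.
  by apply: cvgD; [exact: continuous_Im_prim|exact: cvg_cst].
- apply: ae_eq_trans (L2funD _ _) _.
  apply: filterS3 (VopE v) (L2funZ c one) (oneE R) => t e1 e2 e3 It.
  by rewrite e1// e2// e3// mulr1.
Qed.

Lemma Vadj_VopN v : Vadj v = Vop (- v) + L2dot v one *: one.
Proof. by rewrite Vadj_Vop linearN addrC. Qed.

End boundary_values.

Section graph.
Variables (R : realType) (np nm : nat).
Hypotheses (np_gt0 : (0 < np)%N) (nm_gt0 : (0 < nm)%N).
Local Notation n := (np + nm)%N.
Local Notation L2G := (L2G R n).
Implicit Types (f g h p q : L2G).
Let hd := @L2dot_form R.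

Let n_gt0 : (0 < n)%N. Proof. by rewrite addn_gt0 np_gt0. Qed.
Let j0 : 'I_n := Ordinal n_gt0.

Lemma kirchhoff_domain_Kop p :
  kirchhoff_domain (Kop R n p) (- balance (edgewise Vop p)) (- p).
Proof.
set h := balance _.
have fE j : Kop R n p j = Vop (- h j) + L2dot (h j) one *: one.
  by rewrite ffunE Vadj_VopN.
have f1E j : (- h) j = Vop (- p j) + excess (edgewise Vop p) j *: one.
  by rewrite !ffunE opprB linearN addrC.
split.
- move=> j; split; first by rewrite fE [(- h) j]ffunE; exact: weak_derivative_Vop.
  by rewrite f1E [(- p) j]ffunE; exact: weak_derivative_Vop.
- move=> j; rewrite fE; have := boundary_value_Vop (- h j) (L2dot (h j) one) 1.
  by rewrite prim_ge1// (formNl hd) addNr.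
- exists (flux h j0) => j; rewrite fE.
  have := boundary_value_Vop (- h j) (L2dot (h j) one) 0.
  by rewrite prim_le0// add0r -[L2dot _ _]/(flux h j) (balance_balanced _ j j0).
- exists (excess (edgewise Vop p)); last exact: excess_sum.
  move=> j; rewrite f1E.
  have := boundary_value_Vop (- p j) (excess (edgewise Vop p) j) 0.
  by rewrite prim_le0// add0r.
Qed.

(** The du Bois-Reymond lemma, used twice on each edge, expresses f1 and f as primitives plus
    constants. The outer condition gives f = [Vadj] (- f1), continuity at the vertex makes - f1
    balanced, and the Kirchhoff condition makes the constants d_j vanish under [balance]. *)
Lemma Kop_of_kirchhoff_domain f f1 f2 : kirchhoff_domain f f1 f2 -> f = Kop R n (- f2).
Proof.
move=> [wd v1 [z v0] [d vd d0]].
have I0 : 0 <= (0 : R) <= 1 by rewrite lexx ler01.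
have I1 : 0 <= (1 : R) <= 1 by rewrite lexx ler01.
have f1E j : f1 j = Vop (f2 j) + d j *: one.
  have [_ /du_bois_reymond [c cE]] := wd j.
  have := vd j; rewrite {1}cE => /(boundary_value_unique I0 (boundary_value_Vop _ _ _)).
  by rewrite prim_le0// add0r => <-.
have fE j : f j = Vadj (- f1 j) /\ z = flux (- f1) j.
  have [/du_bois_reymond [c cE] _] := wd j.
  have := v1 j; have := v0 j; rewrite cE.
  move=> /(boundary_value_unique I0 (boundary_value_Vop _ _ _)) + /(boundary_value_unique I1 (boundary_value_Vop _ _ _)).
  rewrite prim_le0// add0r prim_ge1// => cz /eqP; rewrite addrC addr_eq0 => /eqP cE'.
  rewrite /flux ffunE (formNl hd) -cE' -cz; split=> //.
  by rewrite Vadj_VopN opprK (formNl hd) -cE'.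
have bal : balanced (- f1) by move=> i j; rewrite -(fE i).2 -(fE j).2.
have VE : edgewise Vop (- f2) = - f1 + [ffun j => d j *: one].
  by apply/ffunP => j; rewrite !ffunE f1E linearN opprD subrK.
have bd : balance [ffun j => d j *: one] = 0 :> L2G.
  have fl j : flux ([ffun j => d j *: one] : L2G) j = d j.
    by rewrite /flux ffunE (formZl hd) dot_one_one mulr1.
  apply/ffunP => j; rewrite !ffunE /excess fl (eq_bigr _ (fun i _ => fl i)) d0.
  by rewrite mulr0 subr0 subrr.
rewrite (_ : Kop R n (- f2) = edgewise Vadj (balance (edgewise Vop (- f2))))//.
rewrite VE linearD /= bd addr0 (balance_id n_gt0 bal).
by apply/ffunP => j; rewrite (fE j).1 !ffunE.
Qed.

Lemma indefinite_kirchhoffE :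
  indefinite_kirchhoff R np nm = [set fg | fg.1 = Kop R n (flip fg.2)].
Proof.
apply/seteqP; split=> -[f g].
  move=> [f1 [f2 [/Kop_of_kirchhoff_domain /= -> gE]]]; congr (Kop R n _).
  apply/ffunP => j; rewrite !ffunE gE /edge_sign.
  by case: ifP => _; rewrite ?scale1r ?scaleN1r.
move=> /= ->; exists (- balance (edgewise Vop (flip g))), (- flip g); split.
  exact: kirchhoff_domain_Kop.
move=> j; rewrite !ffunE /edge_sign /=.
by case: (j < np)%N; rewrite ?scale1r ?scaleN1r ?opprK.
Qed.

End graph.

Theorem theorem4p5 (R : realType) (np nm : nat)
    (np_gt0 : (0 < np)%N) (nm_gt0 : (0 < nm)%N) :
  (exists C : set (L2G R (np + nm) * L2G R (np + nm)),
     selfadjoint (@L2Gdot R (np + nm)) C /\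
     similar_op (@L2Gdot R (np + nm)) (indefinite_kirchhoff R np nm) C) /\
  (exists e : nat -> L2G R (np + nm),
     riesz_basis (@L2Gdot R (np + nm)) e /\
     forall k, eigenvector (indefinite_kirchhoff R np nm) (e k)).
Proof.
have n_gt0 : (0 < np + nm)%N by rewrite addn_gt0 np_gt0.
have [c c0 bound] := @coupled_bound R np nm np_gt0.
refine (@similar_selfadjoint_riesz_basis R (L2G R (np + nm)) (@L2Gdot R (np + nm))
  (Kop R (np + nm)) (@L2G_complete R (np + nm)) (Kop_symmetric n_gt0)
  (Kop_ge0 n_gt0) (Kop_definite n_gt0) 1 ler01 (@nrm_Kop R (np + nm) n_gt0) (Kop_compact n_gt0)
  (@L2G_infinite_dim R _ n_gt0)
  (@flip R np nm) (@flip_symmetric R np nm) (@flip_involutive R np nm)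
  _ (4 * nm%:R + 1)^-1 c (@coupled_form R np nm np_gt0 nm_gt0) _ c0 _ _ _ (@indefinite_kirchhoffE R np nm np_gt0)).
- by rewrite invr_gt0 ltr_wpDl// mulr_ge0.
- by move=> x; exact: coupled_coercive.
(* [coupled_bound] is taken at q = J K y, for which J q = K y. *)
- by move=> x y; have := bound x (flip (Kop R (np + nm) y)); rewrite flip_involutive.
Qed.
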